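(* Let $u$ be a weak solution of $$\partial_t^\alpha u+\varepsilon^2Au=g(u)\quad\text{a.e. in }(0,T),\qquad u(0)=v,$$ with $\|v\|_{L^\infty(\Omega)}\le1$. Then $\|u(t)\|_{L^\infty(\Omega)}\le1$ for all $t\in(0,T]$.
   Context: Setting: $d\ge1$, $\Omega\subset\mathbb R^d$ is a bounded domain with smooth enough boundary, $\Omega^c=\mathbb R^d\setminus\Omega$, $s\in(0,1)$, $0<\alpha\le1$, $\varepsilon>0$, $T>0$. The function $g\in C^2(\mathbb R)$ satisfies $|g|,|g'|,|g''|<B$ on $\mathbb R$ for some $B>0$, and $g(x)=f(x):=x-x^3$ for all $x\in[-1-R,1+R]$, for some $R>0$. Caputo derivative: $\partial_t^\alpha u(t)=\frac1{\Gamma(1-\alpha)}\int_0^t(t-r)^{-\alpha}\partial_ru(r)\,dr$ if $0<\alpha<1$, and $\partial_t^\alpha u=\partial_tu$ if $\alpha=1$. $\widetilde H^s(\Omega)=\{v\in H^s(\mathbb R^d):\operatorname{supp}v\subset\overline\Omega\}$, with inner product $$\langle u,v\rangle_{H^s(\mathbb R^d)}=\frac{C(d,s)}2\iint_{(\mathbb R^d\times\mathbb R^d)\setminus(\Omega^c\times\Omega^c)}\frac{(u(x)-u(y))(v(x)-v(y))}{|x-y|^{d+2s}}\,dy\,dx,\quad C(d,s)=\frac{2^{2s}s\Gamma(s+\frac d2)}{\pi^{d/2}\Gamma(1-s)}.$$ The operator $A:\widetilde H^s(\Omega)\to H^{-s}(\Omega)$ ($H^{-s}(\Omega)$ the dual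 of $\widetilde H^s(\Omega)$) is $(Au,\varphi)=\langle u,\varphi\rangle_{H^s(\mathbb R^d)}$ for all $\varphi\in\widetilde H^s(\Omega)$. Weak solution: $u\in W^{1,1}((0,T),L^2(\Omega))\cap C((0,T],\widetilde H^s(\Omega))$ with $u(0)=v$ and, for a.e. $t\in(0,T)$, $(\partial_t^\alpha u,\varphi)+\varepsilon^2\langle u,\varphi\rangle_{H^s(\mathbb R^d)}=(g(u),\varphi)$ for all $\varphi\in\widetilde H^s(\Omega)$. *)

(* Defs.v *)
From HB Require Import structures.
From mathcomp Require Import all_boot all_order all_algebra.
From mathcomp Require Import all_classical all_reals all_analysis.
From mathcomp Require Import measurable_realfun.

Set Implicit Arguments.
Unset Strict Implicit.
Unset Printing Implicit Defensive.

Import Order.TTheory GRing.Theory Num.Theory.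
Import numFieldNormedType.Exports.

Local Open Scope classical_set_scope.
Local Open Scope ring_scope.

(* ['rV[R]_n] carries the sigma-algebra generated by the coordinates, that is
   the product (equivalently, the Borel) sigma-algebra of R^n. *)
Definition rV_display : measure_display.
Proof. exact: default_measure_display. Qed.

Section measurable_rV.
Context {R : realType} {n : nat}.

Definition rV_coord (i : 'I_n) (x : 'rV[R]_n) : R := x ord0 i.

Let rV_set0 : g_sigma_preimage rV_coord set0.
Proof. exact: sigma_algebra0. Qed.

Let rV_setC A : g_sigma_preimage rV_coord A -> g_sigma_preimage rV_coord (~` A).
Proof. exact: sigma_algebraC. Qed.

Let rV_bigcup (F : _^nat) : (forall i, g_sigma_preimage rV_coord (F i)) ->
  g_sigma_preimage rV_coord (\bigcup_i (F i)).
Proof. exact: sigma_algebra_bigcup. Qed.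

HB.instance Definition _ := @isMeasurable.Build rV_display
  'rV[R]_n (g_sigma_preimage rV_coord) rV_set0 rV_setC rV_bigcup.

Lemma measurable_rV_coord (i : 'I_n) : measurable_fun setT (rV_coord i).
Proof.
move=> _ Y mY; apply: sub_gen_smallest.
by rewrite (bigD1 i)//=; left; exists Y.
Qed.

Lemma measurable_fun_rV d (T : measurableType d) (f : T -> 'rV[R]_n) :
  (forall i, measurable_fun setT (rV_coord i \o f)) -> measurable_fun setT f.
Proof.
move=> mf; apply: (measurability (\big[setU/set0]_(i < n)
  preimage_set_system setT (rV_coord i) measurable)) => //.
move=> _ [B + <-].
elim/big_ind : _ => // [P Q HP HQ [/HP//|/HQ//]|i _ [C mC <-]].
by have := mf i measurableT C mC; rewrite !setTI.
Qed.

End measurable_rV.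

Lemma product_measure_sigma_finite d1 d2 (T1 : measurableType d1)
    (T2 : measurableType d2) (R : realType)
    (m1 : {sigma_finite_measure set T1 -> \bar R})
    (m2 : {sigma_finite_measure set T2 -> \bar R}) :
  sigma_finite setT (m1 \x m2)%E.
Proof.
have /sigma_finiteP[F [TF ndF Foo]] := sigma_finiteT m1.
have /sigma_finiteP[G [TG ndG Goo]] := sigma_finiteT m2.
exists (fun n => F n `*` G n).
  rewrite -setXTT TF TG predeqE => -[x y]; split.
    move=> [/= [n _ Fnx] [k _ Gky]]; exists (maxn n k) => //; split.
    - by move: x Fnx; exact/subsetPset/ndF/leq_maxl.
    - by move: y Gky; exact/subsetPset/ndG/leq_maxr.
  by move=> [n _ []/= ? ?]; split; exists n.
move=> k; have [? ?] := Foo k; have [? ?] := Goo k.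
split; first exact: measurableX.
by rewrite product_measure1E// lte_mul_pinfty// ge0_fin_numE.
Qed.

Section lebesgue_rV.
Context {R : realType}.

Definition rV_cons n (z : R * 'rV[R]_n) : 'rV[R]_n.+1 :=
  row_mx (z.1%:M : 'rV_1) z.2 : 'rV_(1 + n).

Definition rV_uncons n (x : 'rV[R]_n.+1) : R * 'rV[R]_n :=
  (x ord0 ord0, rsubmx (x : 'rV_(1 + n))).

Lemma rV_cons0 n (z : R * 'rV[R]_n) : rV_cons z ord0 ord0 = z.1.
Proof.
have -> : ord0 = lshift n (ord0 : 'I_1) :> 'I_(1 + n) by exact/val_inj.
apply: etrans (row_mxEl (z.1%:M : 'rV_1) z.2 ord0 ord0) _.
by rewrite mxE eqxx mulr1n.
Qed.

Lemma rV_consS n (z : R * 'rV[R]_n) (j : 'I_n) :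
  rV_cons z ord0 (rshift 1 j : 'I_n.+1) = z.2 ord0 j.
Proof. exact: (row_mxEr (z.1%:M : 'rV_1) z.2 ord0 j). Qed.

Lemma rV_consK n : cancel (@rV_cons n) (@rV_uncons n).
Proof.
move=> [a y]; rewrite /rV_uncons rV_cons0; congr pair.
by apply/rowP => j; rewrite mxE; exact: (rV_consS (a, y)).
Qed.

Lemma measurable_rV_cons n : measurable_fun setT (@rV_cons n).
Proof.
apply: measurable_fun_rV => i.
have [j ->|j ->] := @split_ordP 1 n i.
- rewrite (_ : _ \o _ = fst); first exact: measurable_fst.
  apply/funext => z /=; rewrite /rV_coord -[RHS](rV_cons0 z); congr (_ _ _).
  by apply/val_inj; rewrite /= ord1.
- rewrite (_ : _ \o _ = rV_coord j \o snd).
    exact: measurableT_comp (measurable_rV_coord j) measurable_snd.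
  by apply/funext => z /=; exact: rV_consS.
Qed.

Lemma measurable_rV_uncons n : measurable_fun setT (@rV_uncons n).
Proof.
apply: measurable_fun_pair => /=; first exact: (@measurable_rV_coord R n.+1 ord0).
apply: measurable_fun_rV => i.
rewrite (_ : _ \o _ = rV_coord (rshift 1 i)); first exact: measurable_rV_coord.
by apply/funext => x; rewrite /= /rV_coord mxE.
Qed.

Section step.
Variables (n : nat) (m : {sigma_finite_measure set 'rV[R]_n -> \bar R}).

Definition lebesgue_rV_step :=
  pushforward (lebesgue_measure \x m)%E (@rV_cons n).

HB.instance Definition _ := Measure.copy lebesgue_rV_step
  (measure_function_pushforward__canonical__measure_function_Measure
    (lebesgue_measure \x m)%E (@measurable_rV_cons n)).

Let step_sigma_finite : sigma_finite setT lebesgue_rV_step.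
Proof.
have [F FT Ffin] := product_measure_sigma_finite lebesgue_measure m.
exists (fun k => @rV_uncons n @^-1` F k).
  by rewrite -preimage_bigcup -FT preimage_setT.
move=> k; have [mF Fk] := Ffin k; split.
  by rewrite -[X in measurable X]setTI; exact: measurable_rV_uncons.
rewrite /lebesgue_rV_step /pushforward -comp_preimage.
by rewrite (_ : _ \o _ = id)//; apply/funext => z; exact: rV_consK.
Qed.

HB.instance Definition _ :=
  Measure_isSigmaFinite.Build _ _ _ lebesgue_rV_step step_sigma_finite.

End step.

(* Lebesgue measure on R^n: the n-fold product of Lebesgue measure on R. *)
Fixpoint lebesgue_rV n : {sigma_finite_measure set 'rV[R]_n -> \bar R} :=
  match n with
  | 0 => @dirac _ 'rV[R]_0 0 R
  | n'.+1 => lebesgue_rV_step (lebesgue_rV n')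
  end.

End lebesgue_rV.

Section euclidean.
Context {R : realType} {d : nat}.
Implicit Types x y e : 'rV[R]_d.

Definition dotv x y : R := \sum_i x ord0 i * y ord0 i.

(* The library norm of ['rV[R]_d] is the sup norm. *)
Definition enorm x : R := Num.sqrt (dotv x x).

Definition orth_part e x := x - dotv e x *: e.

(* Near each boundary point, [Omega] is the strict epigraph, in the direction
   of a unit vector [e], of a Lipschitz function [gam] of the component
   orthogonal to [e]. *)
Definition lipschitz_boundary (Omega : set 'rV[R]_d) :=
  forall x, (closure Omega `\` interior Omega) x ->
  exists (r L : R) (e : 'rV[R]_d) (gam : 'rV[R]_d -> R),
    [/\ 0 < r, enorm e = 1,
        (forall y z, `|gam y - gam z| <= L * enorm (orth_part e (y - z))) &
        forall y, enorm (y - x) < r -> (Omega y <-> gam y < dotv e y)].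

Definition bounded_lipschitz_domain (Omega : set 'rV[R]_d) :=
  [/\ Omega !=set0, open Omega, connected Omega, bounded_set Omega &
      lipschitz_boundary Omega].

End euclidean.

(* The integral converges for [0 < z]. *)
Definition Gamma {R : realType} (z : R) : R :=
  \int[lebesgue_measure]_(t in `]0, +oo[) (t `^ (z - 1) * expR (- t)).

Section sobolev.
Context {R : realType} {d : nat}.
Implicit Types (s : R) (Omega : set 'rV[R]_d) (u v : 'rV[R]_d -> R).

Local Notation mu := (@lebesgue_rV R d).

Definition is_L2 Omega u := u \_ Omega \in Lfun mu 2%:E.

Definition L2norm Omega u : \bar R := ('N[mu]_2%:E[EFin \o (u \_ Omega)])%E.

Definition L2dist Omega u v : \bar R := L2norm Omega (u \- v).

Definition L2inner Omega u v : R := \int[mu]_(x in Omega) (u x * v x).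

Definition is_Linfty Omega u := u \_ Omega \in Lfun mu +oo%E.

Definition Linfty_norm Omega u : \bar R :=
  ('N[mu]_+oo%E[EFin \o (u \_ Omega)])%E.

Definition gagliardo_integrand s u v (z : 'rV[R]_d * 'rV[R]_d) : R :=
  (u z.1 - u z.2) * (v z.1 - v z.2) / enorm (z.1 - z.2) `^ (d%:R + 2 * s).

Definition is_Hs s u := u \in Lfun mu 2%:E /\
  (\int[(mu \x mu)%E]_z (gagliardo_integrand s u u z)%:E < +oo)%E.

(* Complement of the largest open set on which [u] vanishes almost everywhere. *)
Definition ess_supp u : set 'rV[R]_d :=
  ~` \bigcup_(U in [set U | open U /\ {ae mu, forall x, U x -> u x = 0}]) U.

Definition is_tildeHs Omega s u := is_Hs s u /\ ess_supp u `<=` closure Omega.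

Definition Cds s : R :=
  2 `^ (2 * s) * s * Gamma (s + d%:R / 2) / (pi `^ (d%:R / 2) * Gamma (1 - s)).

Definition Hs_inner Omega s u v : R :=
  Cds s / 2 * \int[(mu \x mu)%E]_(z in ~` (~` Omega `*` ~` Omega))
    gagliardo_integrand s u v z.

Definition Hs_norm Omega s u : R := Num.sqrt (Hs_inner Omega s u u).

End sobolev.

Section bochner.
Context {R : realType} {d : nat}.
Implicit Types (Omega : set 'rV[R]_d) (D : set R).

Local Notation lambda := (@lebesgue_measure R).

Record simpleL2 Omega D := SimpleL2 {
  simple_size : nat;
  simple_set : 'I_simple_size -> set R;
  simple_val : 'I_simple_size -> 'rV[R]_d -> R;
  simpleP : forall i, [/\ measurable (simple_set i), simple_set i `<=` D,
        (lambda (simple_set i) < +oo)%E & is_L2 Omega (simple_val i)] }.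

Definition simple_eval Omega D (S : simpleL2 Omega D) (t : R) : 'rV[R]_d -> R :=
  fun x => \sum_i \1_(simple_set (s := S) i) t * simple_val (s := S) i x.

Definition simple_integral Omega D (S : simpleL2 Omega D) : 'rV[R]_d -> R :=
  fun x => \sum_i fine (lambda (simple_set (s := S) i)) * simple_val (s := S) i x.

(* [w : D -> L^2(Omega)] is Bochner integrable with integral (the class of) [I];
   elements of L^2(Omega) are given by representatives defined on R^d. *)
Definition is_bochner_integral Omega D (w : R -> 'rV[R]_d -> R)
    (I : 'rV[R]_d -> R) :=
  [/\ forall t, D t -> is_L2 Omega (w t), is_L2 Omega I &
  exists S : nat -> simpleL2 Omega D,
  [/\ forall n, measurable_fun D
        (fun t => L2dist Omega (w t) (simple_eval (S n) t)),
      (fun n => \int[lambda]_(t in D)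
         L2dist Omega (w t) (simple_eval (S n) t))%E @ \oo --> 0%E &
      (fun n => L2dist Omega I (simple_integral (S n))) @ \oo --> 0%E]].

(* The test functions [C^1_c] of Brezis' definition of W^{1,p} on an interval. *)
Definition is_C1c (T : R) (phi : R -> R) :=
  [/\ forall t, derivable phi t 1, continuous (derive1 phi : R -> R) &
      exists a b, [/\ 0 < a, b < T & forall t, phi t != 0 -> a <= t <= b]].

Definition is_weak_time_derivative Omega (T : R) (u w : R -> 'rV[R]_d -> R) :=
  forall phi, is_C1c T phi -> exists I,
    is_bochner_integral Omega `]0, T[ (fun t x => derive1 phi t * u t x) I /\
    is_bochner_integral Omega `]0, T[ (fun t x => phi t * w t x) (\- I).

(* [u] is in W^{1,1}(]0,T[, L^2(Omega)) with weak derivative [w]. *)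
Definition is_W11 Omega (T : R) (u w : R -> 'rV[R]_d -> R) :=
  [/\ exists I, is_bochner_integral Omega `]0, T[ u I,
      exists I, is_bochner_integral Omega `]0, T[ w I &
      is_weak_time_derivative Omega T u w].

(* [c] is the Caputo derivative of order [alpha] at time [t] of a function whose
   first-order time derivative is [w]. *)
Definition is_caputo_derivative Omega (alpha : R) (w : R -> 'rV[R]_d -> R)
    (t : R) (c : 'rV[R]_d -> R) :=
  if alpha == 1 then c = w t
  else exists2 I,
    is_bochner_integral Omega `]0, t[ (fun r x => (t - r) `^ (- alpha) * w r x) I &
    c = (fun x => (Gamma (1 - alpha))^-1 * I x).

End bochner.

Section weak_solution.
Context {R : realType} {d : nat}.

(* [u] is the representative of an element of W^{1,1}(]0,T[, L^2(Omega)) that is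
   continuous on [0, T], so that its value at 0 makes sense. The derivative [w]
   is chosen before [t], as it is only determined for almost every [t]. *)
Definition weak_solution (Omega : set 'rV[R]_d) (s alpha eps T : R) (g : R -> R)
    (v : 'rV[R]_d -> R) (u : R -> 'rV[R]_d -> R) :=
  exists2 w, is_W11 Omega T u w &
  [/\ [/\ forall t, 0 < t <= T -> is_tildeHs Omega s (u t) &
          forall t0, 0 < t0 <= T ->
            Hs_norm Omega s (u t \- u t0) @[t --> within `]0, T] (nbhs t0)]
              --> (0 : R)],
      [/\ L2dist Omega (u t) (u 0) @[t --> 0^'+] --> 0%E &
          {ae (@lebesgue_rV R d), forall x, Omega x -> u 0 x = v x}] &
      {ae (@lebesgue_measure R), forall t, 0 < t < T ->
        exists2 c, is_caputo_derivative Omega alpha w t c &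
        forall phi, is_tildeHs Omega s phi ->
          L2inner Omega c phi + eps ^+ 2 * Hs_inner Omega s (u t) phi
          = L2inner Omega (g \o u t) phi}].

End weak_solution.

(* Main.v *)
Require Import Defs.
From mathcomp Require Import all_boot all_order all_algebra.
From mathcomp Require Import all_classical all_reals all_analysis.
From mathcomp Require Import measurable_realfun.
From mathcomp Require Import ess_sup_inf ring lra.
Import Order.TTheory GRing.Theory Num.Theory.
Import numFieldNormedType.Exports.

(** Let p = [excess], p(x) = x - min(1, max(-1, x)), be the signed amount by which x
    leaves [-1, 1], and let G(t) be the integral over Omega of p(u(t))^2. The bound on
    u(t) says that G(t) = 0. It holds at time 0, and the equation tested with p(u(t))
    propagates it.

    The function p is nondecreasing, 1-Lipschitz and zero at 0. Hence p(u(t)) is an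
    admissible test function ([is_tildeHs_comp]), and the form <u, p(u)> has a
    nonnegative integrand ([Hs_inner_monotone_ge0]). As g vanishes at 1 and -1 and has
    slope at most B, g(x) p(x) <= B p(x)^2 ([reaction_excess]). The time derivative
    therefore satisfies (D u(t), p(u(t))) <= B G(t) for almost every t.

    In the other direction p^2 is convex with derivative 2p, so that G(t) - G(r) is at
    most 2 (p(u(t)), u(t) - u(r)), which is the integral over ]r, t[ of
    W_t(x) = 2 (w(x), p(u(t))), with w the weak time derivative of u
    ([energy_increment]). The test function is frozen at the later time t; two
    arguments recover the derivative of G from this.

    For order 1, p(u(x)) is continuous in x with values in L^2, so that W_t(x) is at
    most 2 B G(x) + e |w(x)| for x close to t. Adding such inequalities over short
    intervals gives G(t) <= 2 B int_0^t G ([gronwall_local]).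

    For order alpha < 1 with kernel k(x) = x^(-alpha), the tested Caputo derivative is,
    up to a constant, the integral of k(t - x) W_t(x) over ]0, t[. Below the decreasing
    k lies a step kernel, a sum of a_j times the indicator of ]0, jh[ with a_j >= 0. The
    j-th step contributes a_j times the integral of W_t over ]t - jh, t[, which is at
    least a_j (G(t) - G(t - jh)). After integration in t the error is at most a constant
    times int_0^h k, and tends to 0 with h. If y(t) = int_0^t G is zero at t - d, the
    steps longer than d alone give about k(d) y(t) on the left, against K y(t) on the
    right; as k(d) > K for small d, y(t) = 0 ([gronwall_kernel]). In both cases the
    vanishing of y extends by a fixed time step, and so to the whole interval.

    Three preparations connect these arguments with the weak formulation. A Bochner
    integral is paired with a fixed function ([bochner_scalar]), which reduces the time
    derivative to scalar functions; the increments of a scalar function with an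
    integrable weak derivative are integrals ([du_bois_reymond]); and continuity in the
    fractional seminorm implies continuity in L^2 ([fractional_poincare], where the
    normalizing constant is positive by [Gamma_gt0]). *)

Set Implicit Arguments.
Unset Strict Implicit.
Unset Printing Implicit Defensive.

Local Open Scope classical_set_scope.
Local Open Scope ring_scope.

(** * Almost-everywhere reasoning, limits and translations *)
Section almost_everywhere.
Context d (T : measurableType d) (R : realType) (mu : {measure set T -> \bar R}).

Lemma ae_imply (P Q : T -> Prop) : (forall x, P x -> Q x) ->
  {ae mu, forall x, P x} -> {ae mu, forall x, Q x}.
Proof.
by move=> PQ; apply: filterS => //; exact: (ae_filter_ringOfSetsType mu).
Qed.

Lemma ae_imply2 (P Q S : T -> Prop) : (forall x, P x -> Q x -> S x) ->
  {ae mu, forall x, P x} -> {ae mu, forall x, Q x} -> {ae mu, forall x, S x}.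
Proof.
by move=> PQ; apply: filterS2 => //; exact: (ae_filter_ringOfSetsType mu).
Qed.

End almost_everywhere.

Section ereal_limits.
Context {R : realType}.

Lemma cvge0_near_lt (I : Type) (F : set_system I) {FF : Filter F}
    (u : I -> \bar R) (e : R) : 0 < e ->
  u x @[x --> F] --> 0%E -> \forall x \near F, (u x < e%:E)%E.
Proof. by move=> e0 ucv; have := ucv _ (@open_ereal_lt' R 0%E e%:E e0). Qed.

Lemma cvge0_ex_lt (u : nat -> \bar R) (e : R) : 0 < e ->
  u n @[n --> \oo] --> 0%E -> exists n, (u n < e%:E)%E.
Proof.
move=> e0 ucv; have [n _ /(_ n (leqnn n))] := cvge0_near_lt e0 ucv.
by exists n.
Qed.

Lemma cvge0Zl (u : nat -> \bar R) (a : R) :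
  u n @[n --> \oo] --> 0%E -> (a%:E * u n)%E @[n --> \oo] --> 0%E.
Proof. by move=> u0; have := cvgeZl (isT : a%:E \is a fin_num) u0; rewrite mule0. Qed.

End ereal_limits.

Section translation.
Context {R : realType}.
Local Notation lam := (@lebesgue_measure R).
Local Open Scope ereal_scope.

Lemma measurable_subc (c : R) :
  measurable_fun setT ((fun x : R => (x - c)%R) : measurableTypeR R -> measurableTypeR R).
Proof. exact: measurable_funB. Qed.

(** Translated and untranslated Lebesgue measure agree on half-open intervals,
    which determine a measure on the line. *)
Lemma lebesgue_measure_translation (c : R) (A : set R) : measurable A ->
  pushforward lam ((fun x : R => (x - c)%R) : measurableTypeR R -> measurableTypeR R) A = lam A.
Proof.
move=> mA; apply/esym.
pose m' := measure_function_pushforward__canonical__measure_function_Measure lam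
    (measurable_subc c).
apply: (@lebesgue_measure_unique R m') => //= _ [[a b]] _ <-.
rewrite /m' /pushforward/=.
rewrite (_ : _ @^-1` _ = `](a + c)%R, (b + c)%R]%classic); last first.
  by apply/seteqP; split => x /=; rewrite !in_itv/= lerBlDr ltrBrDr.
by rewrite !lebesgue_measure_itv/= !lte_fin ltrD2r -!EFinB opprD addrACA subrr addr0.
Qed.

Lemma ge0_integral_translation (f : R -> \bar R) (c : R) :
  measurable_fun setT f -> (forall x, 0 <= f x) ->
  \int[lam]_x f (x - c)%R = \int[lam]_x f x.
Proof.
move=> mf f0.
have mc := measurable_subc c.
have /= := @ge0_integral_pushforward _ _ (measurableTypeR R) (measurableTypeR R) R _ mc lam
    setT f measurableT mf.
rewrite preimage_setT => H.
rewrite -[LHS]H //; last first.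
apply: eq_measure_integral => A mA _; exact: lebesgue_measure_translation.
Qed.

End translation.

(** * Step approximation of a decreasing kernel *)
Section step_kernel.
Context {R : realType}.
Variables (k : R -> R) (h : R).
Hypotheses (h0 : 0 < h) (k_ge0 : forall x, 0 <= k x)
  (k_ni : forall x y : R, 0 < x -> x <= y -> k y <= k x).

Definition step_weight (j : nat) : R := k (j.+1%:R * h) - k (j.+2%:R * h).

(** A combination, with nonnegative weights, of the indicators of the intervals
    ]0, (j+1)h[. The weights are the decrements of [k] along the grid of mesh [h],
    so that the sum telescopes to a step function below [k]. An indicator of
    ]0, l[ as convolution kernel against a derivative produces the increment of
    the primitive over a time step of length l; this is why such kernels are
    used. *)
Definition step_kernel (N : nat) (x : R) : R :=
  \sum_(j < N) step_weight j * \1_(`]0, j.+1%:R * h[%classic) x.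

Lemma step_weight_ge0 j : 0 <= step_weight j.
Proof.
rewrite subr_ge0; apply: k_ni; first by rewrite mulr_gt0.
by rewrite ler_pM2r// ler_nat.
Qed.

Lemma step_kernel_ge0 N x : 0 <= step_kernel N x.
Proof. by apply: sumr_ge0 => j _; rewrite mulr_ge0// step_weight_ge0. Qed.

Lemma step_kernel_npos N x : x <= 0 -> step_kernel N x = 0.
Proof.
move=> x0; rewrite /step_kernel big1// => j _.
by rewrite indicE memNset ?mulr0//= in_itv/= ltNge x0.
Qed.

(** Telescoping gives the value of [k] at a grid point at distance at most [h] to
    the right of [x], minus the value at the last grid point. The induction on the
    number of steps avoids naming that grid point. *)
Lemma step_kernel_lower N x : 0 < x ->
  k (x + h) - k (N.+1%:R * h) <= step_kernel N x.
Proof.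
move=> x0; elim: N => [|N IH].
  by rewrite /step_kernel big_ord0 mul1r subr_le0 k_ni// lerDr ltW.
rewrite /step_kernel big_ord_recr/= -/(step_kernel N x) indicE.
have [xN|Nx] := ltP x (N.+1%:R * h).
  by rewrite mem_set/= ?in_itv/= ?x0// mulr1 /step_weight; lra.
rewrite memNset/= ?in_itv/= ?x0/=; last by apply/negP; rewrite -leNgt.
rewrite mulr0 addr0 (le_trans _ (step_kernel_ge0 _ _))// subr_le0 k_ni//.
  by rewrite mulr_gt0.
by rewrite -natr1 mulrDl mul1r lerD2r.
Qed.

(** The telescoped value is at most [k x - k ((N+1)h)] or zero, a bound that is
    stable under adding one step. *)
Lemma step_kernel_upper N x : 0 < x -> step_kernel N x <= k x.
Proof.
move=> x0; suff : step_kernel N x <= Num.max 0 (k x - k (N.+1%:R * h)).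
  move=> /le_trans; apply; rewrite ge_max k_ge0/=.
  by rewrite lerBlDr lerDl k_ge0.
elim: N => [|N IH]; first by rewrite /step_kernel big_ord0 le_max lexx.
rewrite /step_kernel big_ord_recr/= -/(step_kernel N x) indicE.
have kN : k (N.+2%:R * h) <= k (N.+1%:R * h).
  by have := step_weight_ge0 N; rewrite subr_ge0.
have [xN|Nx] := ltP x (N.+1%:R * h).
  rewrite mem_set/= ?in_itv/= ?x0// mulr1 /step_weight.
  rewrite max_r in IH; last by rewrite subr_ge0 k_ni// ltW.
  by rewrite le_max; apply/orP; right; lra.
rewrite memNset/= ?in_itv/= ?x0/=; last by apply/negP; rewrite -leNgt.
rewrite mulr0 addr0 (le_trans IH)// ge_max !le_max lexx/=.
by apply/orP; right; lra.
Qed.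

Lemma measurable_step_kernel N : measurable_fun setT (step_kernel N).
Proof.
apply: measurable_sum => j; apply: measurable_funM => //.
Qed.

End step_kernel.

Section step_kernel_error.
Context {R : realType}.
Local Notation lam := (@lebesgue_measure R).
Local Open Scope ereal_scope.
Variables (k : R -> R) (T h : R) (N : nat).
Hypotheses (h0 : (0 < h)%R) (k_ge0 : forall x, (0 <= k x)%R)
  (k_ni : forall x y : R, (0 < x -> x <= y -> k y <= k x)%R)
  (kN : forall x : R, (x <= 0)%R -> k x = 0%R)
  (kT : forall x, (T < x)%R -> k x = 0%R)
  (mk : measurable_fun setT k)
  (kfin : \int[lam]_x (k x)%:E < +oo)
  (NhT : (T < N.+1%:R * h)%R).

Lemma step_kernel_le x : (step_kernel k h N x <= k x)%R.
Proof.
by have [x0|x0] := leP x 0%R; [rewrite step_kernel_npos// kN|exact: step_kernel_upper].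
Qed.

(** By [step_kernel_lower] the error is at most [k x - k (x + h)], whose integral
    over the half-line telescopes to the integral of [k] over ]0, h]. *)
Lemma step_kernel_error :
  \int[lam]_x (k x - step_kernel k h N x)%:E <= \int[lam]_(x in `]0%R, h]) (k x)%:E.
Proof.
have mkh : measurable_fun setT (EFin \o k) by exact/measurable_EFinP.
have ms : measurable_fun setT (step_kernel k h N) by exact: measurable_step_kernel.
pose f x := (k x * \1_(`]h, +oo[%classic) x)%:E.
have mf : measurable_fun setT f.
  by apply/measurable_EFinP; apply: measurable_funM.
have f0 x : 0 <= f x by rewrite lee_fin mulr_ge0.
have If : \int[lam]_x f x = \int[lam]_(x in `]h, +oo[) (k x)%:E.
  by rewrite integral_mkcond [RHS]integral_mkcond/= patch_setT; apply: eq_integral => x _;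
      rewrite /f restrict_EFin patch_indic.
have kE : \int[lam]_x (k x)%:E = \int[lam]_(x in `]0%R, h]) (k x)%:E + \int[lam]_x f x.
  rewrite If -ge0_integral_setU//.
  - rewrite -itv_bndbnd_setU// ?bnd_simp ?ltW//.
    rewrite [RHS]integral_mkcond; apply: eq_integral => x _.
    rewrite patchE; case: ifPn => // /negP; rewrite inE/= in_itv/= andbT => /negP.
    by rewrite -leNgt => x0; rewrite kN.
  - exact: measurable_funTS.
  - by move=> x _; rewrite lee_fin.
  - apply/disj_setPS => x/= []; rewrite !in_itv/= andbT => /andP[_ xh].
    by rewrite ltNge xh.
have ft : \int[lam]_x f x < +oo.
  by apply: le_lt_trans kfin; rewrite kE leeDr// integral_ge0// => x _; rewrite lee_fin.
have : \int[lam]_x (k x - step_kernel k h N x)%:E + \int[lam]_x f x <= \int[lam]_(x in `]0%R,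
    h]) (k x)%:E + \int[lam]_x f x; last first.
  by rewrite leeD2rE// ge0_fin_numE// integral_ge0.
rewrite -kE -(ge0_integral_translation (- h)%R mf f0) -ge0_integralD//; last 3 first.
- by move=> x _; rewrite lee_fin subr_ge0 step_kernel_le.
- by apply/measurable_EFinP; exact: measurable_funB.
- apply: (measurableT_comp mf); exact: measurable_subc.
apply: ge0_le_integral => //.
- by move=> x _; rewrite adde_ge0// lee_fin subr_ge0 step_kernel_le.
- apply: emeasurable_funD; first by apply/measurable_EFinP; exact: measurable_funB.
  apply: (measurableT_comp mf); exact: measurable_subc.
move=> x _; rewrite /f opprK -EFinD lee_fin indicE.
have [x0|x0] := leP x 0%R.
  rewrite memNset ?mulr0 ?addr0; last first.
    by rewrite /= in_itv/= andbT -[X in (X < _)%R]add0r ltrD2r; apply/negP; rewrite -leNgt.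
  by rewrite lerBlDr lerDl step_kernel_ge0.
rewrite mem_set/= ?in_itv/= ?andbT ?ltrDr// mulr1.
have := step_kernel_lower h0 k_ni N x0.
by rewrite (kT NhT); lra.
Qed.

End step_kernel_error.

(** * Vanishing of an energy controlled by a singular kernel *)
Section continuation.
Context {R : realType}.

(** Since the length [d] of one extension step is fixed, finitely many steps reach
    any time. *)
Lemma zero_continuation (y : R -> \bar R) (T d : R) : 0 < d ->
  (forall t, t <= 0 -> y t = 0%E) ->
  (forall t, t <= T -> y (t - d) = 0%E -> y t = 0%E) ->
  forall t, t <= T -> y t = 0%E.
Proof.
move=> d0 y0 yd t tT.
have H n : forall t, t <= T -> t <= n%:R * d -> y t = 0%E.
  elim: n => [|n IH] r rT; first by rewrite mul0r => /y0.
  rewrite -natr1 mulrDl mul1r => rn; apply: yd => //; apply: IH.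
    by rewrite (le_trans _ rT)// gerBl ltW.
  by rewrite lerBlDr.
apply: (H (Num.truncn (t / d)).+1) => //.
by rewrite -ler_pdivrMr// ltW// truncnS_gt.
Qed.

End continuation.

Section gronwall_kernel.
Context {R : realType}.
Local Notation lam := (@lebesgue_measure R).
Variables (T K C : R) (k G omega : R -> R) (W : R -> R -> R).
Hypotheses (T0 : 0 < T) (K0 : 0 <= K) (C0 : 0 <= C)
  (k_ge0 : forall x, 0 <= k x)
  (k_ni : forall x y : R, 0 < x -> x <= y -> k y <= k x)
  (kN : forall x : R, x <= 0 -> k x = 0)
  (kT : forall x : R, T < x -> k x = 0)
  (mk : measurable_fun setT k)
  (kfin : (\int[lam]_x (k x)%:E < +oo)%E)
  (ksmall : forall e : R, 0 < e -> exists2 h0, 0 < h0 &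
    forall h, 0 < h <= h0 -> (\int[lam]_(x in `]0%R, h]) (k x)%:E <= e%:E)%E)
  (kbig : forall M, exists2 d, 0 < d & M <= k d)
  (mG : measurable_fun setT G) (G_ge0 : forall x, 0 <= G x)
  (GN : forall x, x <= 0 -> G x = 0)
  (Gfin : (\int[lam]_(x in `]0%R, T[) (G x)%:E < +oo)%E)
  (mo : measurable_fun setT omega) (o_ge0 : forall x, 0 <= omega x)
  (ofin : (\int[lam]_x (omega x)%:E < +oo)%E)
  (Wint : forall t, 0 < t < T -> lam.-integrable `]0, t[ (EFin \o W t))
  (WO : forall t, 0 < t < T ->
    {ae lam, forall r, r \in `]0, t[ -> `|W t r| <= C * omega r})
  (GW : forall t r, 0 < t < T -> 0 <= r < t ->
    G t - G r <= \int[lam]_(x in `]r, t[) W t x)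
  (GK : {ae lam, forall t, 0 < t < T ->
    lam.-integrable `]0, t[ (EFin \o (fun r : R => k (t - r) * W t r)) /\
    \int[lam]_(r in `]0, t[) (k (t - r) * W t r) <= K * G t}).

Local Notation kn h N := (step_kernel k h N).
Let E h N t := (\int[lam]_r ((k (t - r) - kn h N (t - r)) * omega r)%:E)%E.

(** The inequality for the singular kernel becomes, up to the convolution [E] of
    the kernel error with the majorant, an inequality between values of [G] at the
    current time and at the delayed times. *)
Let pointwise h N t : 0 < h -> 0 < t < T ->
    lam.-integrable `]0, t[ (EFin \o (fun r : R => k (t - r) * W t r)) ->
    \int[lam]_(r in `]0, t[) (k (t - r) * W t r) <= K * G t ->
    {ae lam, forall r, r \in `]0, t[ -> `|W t r| <= C * omega r} ->
    ((\sum_(j < N) step_weight k h j * G t)%:E <=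
    (\sum_(j < N) step_weight k h j * G (t - j.+1%:R * h))%:E + (K * G t)%:E +
    C%:E * E h N t)%E.
Proof.
move=> h0 t0T kW kWle WOt.
have /andP[t0 tT] := t0T.
have mt : measurable (`]0, t[%classic : set (measurableTypeR R)) by [].
have mkn : measurable_fun setT (fun r : R => kn h N (t - r)).
  by apply: (measurableT_comp (@measurable_step_kernel _ k h N)); exact: measurable_funB.
have mkt : measurable_fun setT (fun r : R => k (t - r)).
  by apply: (measurableT_comp mk); exact: measurable_funB.
pose F (j : nat) (r : R) := (step_weight k h j * (\1_(`]0,
    j.+1%:R * h[%classic) (t - r) * W t r))%:E.
have Wi j : lam.-integrable `]0, t[ (EFin \o (fun r : R =>
    step_weight k h j * (\1_(`]0, j.+1%:R * h[%classic) (t - r) * W t r))).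
  apply: (le_integrable mt _ _ (integrableZl mt (step_weight k h j) (Wint t0T))).
    apply/measurable_EFinP; apply: measurable_funM => //; apply: measurable_funM.
      apply: measurable_funTS.
      by apply: (@measurableT_comp _ _ _ _ _ _ (\1_(`]0, j.+1%:R * h[%classic) : R ->
          R)) => //; exact: measurable_funB.
    by have /measurable_int/measurable_EFinP := Wint t0T.
  move=> r _ /=; rewrite lee_fin !normrM ler_wpM2l// ler_piMl// indicE.
  by case: (_ \in _); rewrite ?normr1 ?normr0.
have knW : lam.-integrable `]0, t[ (EFin \o (fun r : R => kn h N (t - r) * W t r)).
  rewrite (_ : _ \o _ = fun r : R => (\sum_(j <- index_enum 'I_N) F j r)%E).
    by apply: (integrable_sum mt) => j _; exact: Wi.
  apply/funext => r /=; rewrite /step_kernel mulr_suml -sumEFin.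
  by apply: eq_bigr => j _; rewrite /F mulrA.
(* Each step of the kernel turns the rate into an increment of G. *)
have knWE : \sum_(j < N) step_weight k h j * (G t - G (t - j.+1%:R * h)) <=
    \int[lam]_(r in `]0, t[) (kn h N (t - r) * W t r).
  have -> : \int[lam]_(r in `]0, t[) (kn h N (t - r) * W t r) =
      fine (\int[lam]_(r in `]0%R, t[) (\sum_(j <- index_enum 'I_N) F j r))%E.
    congr fine; apply: eq_integral => r _ /=; rewrite /step_kernel mulr_suml -sumEFin.
    by apply: eq_bigr => j _; rewrite /F mulrA.
  rewrite integral_sum//; last by move=> j; exact: Wi.
  rewrite -sum_fine; last by move=> j _; exact: (integrable_fin_num mt (Wi j)).
  apply: ler_sum => j _.
  rewrite -/(Rintegral lam `]0, t[%classic (fun r : R =>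
      step_weight k h j * (\1_(`]0, j.+1%:R * h[%classic) (t - r) * W t r))).
  have jh0 : 0 < j.+1%:R * h by rewrite mulr_gt0.
  rewrite [leRHS](_ : _ = step_weight k h j * \int[lam]_(r in `]Num.max 0 (t - j.+1%:R * h),
      t[) W t r); last first.
    rewrite RintegralZl//; last first.
      apply: (le_integrable mt _ _ (Wint t0T)).
        apply/measurable_EFinP; apply: measurable_funM.
        apply: measurable_funTS.
        by apply: (@measurableT_comp _ _ _ _ _ _ (\1_(`]0, j.+1%:R * h[%classic) : R ->
            R)) => //; exact: measurable_funB.
        by have /measurable_int/measurable_EFinP := Wint t0T.
      move=> r _ /=; rewrite lee_fin !normrM ler_piMl// indicE.
      by case: (_ \in _); rewrite ?normr1 ?normr0.
    congr (_ * _); rewrite Rintegral_mkcond [RHS]Rintegral_mkcond.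
    apply: eq_Rintegral => r _; rewrite !patchE !mem_setE !in_itv/= indicE.
    rewrite mem_setE in_itv/= subr_gt0 gt_max !ltrBlDr (addrC r).
    case: (0 < r); case: (r < t); case: (t < _) => //=; rewrite ?mul1r ?mul0r//.
  rewrite ler_wpM2l ?step_weight_ge0//.
  have [tj|tj] := leP 0 (t - j.+1%:R * h).
    by rewrite GW// tj/= gtrBl.
  rewrite (GN (ltW tj)); have := @GW t 0 t0T; rewrite (GN (lexx 0)); apply.
  by rewrite lexx.
pose I := \int[lam]_(r in `]0, t[) ((k (t - r) - kn h N (t - r)) * W t r).
(* The error of replacing the kernel by its step approximation, in absolute value. *)
have Eb : (`|I|%R%:E <= C%:E * E h N t)%E.
  have dW : lam.-integrable `]0, t[ (EFin \o (fun r : R => (k (t - r) - kn h N (t - r)) * W t r)).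
    rewrite (_ : _ \o _ = ((EFin \o (fun r : R =>
        (k (t - r) * W t r)%R)) \- (EFin \o (fun r : R => (kn h N (t - r) * W t r)%R)))%E).
      exact: integrableB.
    by apply/funext => r /=; rewrite mulrBl EFinB.
  have d0 r : 0 <= k (t - r) - kn h N (t - r) by rewrite subr_ge0 step_kernel_le.
  have mdo : measurable_fun setT (fun r : R => ((k (t - r) - kn h N (t - r)) * omega r)%:E).
    by apply/measurable_EFinP; apply: measurable_funM => //; exact: measurable_funB.
  have do0 r : (0 <= ((k (t - r) - kn h N (t - r)) * omega r)%:E)%E.
    by rewrite lee_fin mulr_ge0.
  rewrite EFin_normr_Rintegral//.
  apply: (le_trans (le_abse_integral _ mt (measurable_int _ dW))).
  rewrite /E -ge0_integralZl_EFin//.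
  apply: (@le_trans _ _ (\int[lam]_(r in `]0%R,
      t[) (C%:E * ((k (t - r) - kn h N (t - r)) * omega r)%:E))%E); last first.
    apply: ge0_subset_integral => //.
      exact: measurable_funeM.
    by move=> r _; rewrite mule_ge0// lee_fin.
  apply: ae_ge0_le_integral => //.
  - apply: measurableT_comp => //; exact: (measurable_int _ dW).
  - by move=> r _; rewrite mule_ge0// lee_fin.
  - apply: measurable_funTS; exact: measurable_funeM.
  apply: ae_imply WOt => r Wr rt; rewrite -EFinM lee_fin normrM ger0_norm//.
  by rewrite mulrCA ler_wpM2l// Wr// inE.
rewrite -EFinD.
apply: (@le_trans _ _ ((\sum_(j < N) step_weight k h j * G (t - j.+1%:R * h) +
    K * G t)%R%:E + `|I|%R%:E)%E); last by rewrite leeD2l.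
rewrite -EFinD lee_fin.
have -> : I =
    \int[lam]_(r in `]0, t[) (k (t - r) * W t r) - \int[lam]_(r in `]0,
        t[) (kn h N (t - r) * W t r).
  rewrite -RintegralB//; apply: eq_Rintegral => r _; exact: mulrBl.
have -> : \sum_(j < N) step_weight k h j * G t =
    \sum_(j < N) step_weight k h j * G (t - j.+1%:R * h) +
        \sum_(j < N) step_weight k h j * (G t - G (t - j.+1%:R * h)).
  by rewrite -big_split/=; apply: eq_bigr => j _; rewrite mulrBr; lra.
rewrite -addrA lerD2l; set a := \int[lam]_(r in `]0, t[) (k (t - r) * W t r).
have aux (S b n : R) : S <= b -> a <= K * G t -> - (a - b) <= n -> S <= K * G t + n by lra.
by apply: aux knWE kWle _; rewrite -normrN ler_norm.
Qed.

Let Y t := (\int[lam]_(r in `]0%R, t[) (G r)%:E)%E.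

Let Ydelay t l : 0 < l ->
  (\int[lam]_(r in `]0%R, t[) (G (r - l))%:E = Y (t - l))%E.
Proof.
move=> l0; rewrite integral_mkcond.
pose f x := (G x * \1_(`]0, t[%classic) (x + l))%:E.
transitivity (\int[lam]_x f (x - l)%R)%E.
  apply: eq_integral => x _; rewrite patchE /f subrK indicE.
  by case: (_ \in _); rewrite ?mulr1 ?mulr0.
rewrite ge0_integral_translation; last 2 first.
- apply/measurable_EFinP; apply: measurable_funM => //.
  by apply: (@measurableT_comp _ _ _ _ _ _ (\1_(`]0, t[%classic) : R -> R)) => //;
      exact: measurable_funD.
- by move=> x; rewrite lee_fin mulr_ge0.
rewrite /Y [RHS]integral_mkcond; apply: eq_integral => x _.
rewrite patchE /f indicE !mem_setE !in_itv/= ltrBrDr.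
have [x0|x0] := leP x 0; first by rewrite GN//= mul0r.
by rewrite addr_gt0//=; case: ifP; rewrite ?mulr1 ?mulr0.
Qed.

Let E_ge0 h N t : 0 < h -> (0 <= E h N t)%E.
Proof.
move=> h0; apply: integral_ge0 => r _; rewrite lee_fin mulr_ge0//.
by rewrite subr_ge0 step_kernel_le.
Qed.

Let mE2 h N : measurable_fun setT
  (fun z : R * R => ((k (z.1 - z.2) - kn h N (z.1 - z.2)) * omega z.2)%:E).
Proof.
have ms : measurable_fun setT (fun z : R * R => z.1 - z.2) by exact: measurable_funB.
apply/measurable_EFinP; apply: measurable_funM.
  apply: measurable_funB; first exact: (measurableT_comp mk ms).
  exact: (measurableT_comp (@measurable_step_kernel _ k h N) ms).
exact: (measurableT_comp mo measurable_snd).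
Qed.

Let measurable_E h N : 0 < h -> measurable_fun setT (E h N).
Proof.
move=> h0.
apply: (@measurable_fun_fubini_tonelli_F _ _ _ _ _ lam _ (mE2 h N)).
move=> z /=; rewrite lee_fin mulr_ge0//.
by rewrite subr_ge0 step_kernel_le.
Qed.

(** Tonelli and translation invariance: the integral of a convolution is the
    product of the integrals. *)
Let E_int h N : 0 < h -> T < N.+1%:R * h -> (\int[lam]_t E h N t <=
  (\int[lam]_(x in `]0%R, h]) (k x)%:E) * \int[lam]_x (omega x)%:E)%E.
Proof.
move=> h0 NhT.
have d0 x : 0 <= k x - kn h N x by rewrite subr_ge0 step_kernel_le.
have mkn : measurable_fun setT (fun x : R => (k x - kn h N x)%:E).
  by apply/measurable_EFinP; apply: measurable_funB => //; exact: measurable_step_kernel.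
rewrite (@fubini_tonelli _ _ _ _ _ lam lam _ (mE2 h N)); last first.
  by move=> z /=; rewrite lee_fin mulr_ge0.
rewrite [leLHS](_ : _ = (\int[lam]_r ((omega r)%:E * \int[lam]_x (k x - kn h N x)%:E))%E);
    last first.
  apply: eq_integral => r _ /=.
  under eq_integral do rewrite mulrC EFinM.
  rewrite ge0_integralZl_EFin//; last 2 first.
  - by move=> x _; rewrite lee_fin.
  - by apply: (measurableT_comp mkn); exact: measurable_funB.
  by rewrite (ge0_integral_translation r mkn)// => x; rewrite lee_fin.
rewrite ge0_integralZr//; last 3 first.
- exact/measurable_EFinP.
- by move=> x _; rewrite lee_fin.
- by apply: integral_ge0 => x _; rewrite lee_fin.
rewrite [leRHS]muleC; apply: lee_wpmul2l;
    last exact: (step_kernel_error h0 k_ge0 k_ni kN kT mk kfin NhT).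
by apply: integral_ge0 => x _; rewrite lee_fin.
Qed.

Let Y_ge0 t : (0 <= Y t)%E.
Proof. by apply: integral_ge0 => x _; rewrite lee_fin. Qed.

Let le_Y t t' : t <= t' -> (Y t <= Y t')%E.
Proof.
move=> tt; apply: ge0_subset_integral => //.
- by apply/measurable_funTS/measurable_EFinP.
- by move=> x _; rewrite lee_fin.
- by move=> x /=; rewrite !in_itv/= => /andP[-> /lt_le_trans]; exact.
Qed.

Let Y_fin t : t <= T -> Y t \is a fin_num.
Proof. by move=> tT; rewrite ge0_fin_numE//; apply: le_lt_trans (le_Y tT) Gfin. Qed.

Let integrated h N t : 0 < h -> T < N.+1%:R * h -> t <= T ->
  ((\sum_(j < N) step_weight k h j)%:E * Y t <=
   \sum_(j < N) (step_weight k h j)%:E * Y (t - j.+1%:R * h) + K%:E * Y t +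
   C%:E * ((\int[lam]_(x in `]0%R, h]) (k x)%:E) * \int[lam]_x (omega x)%:E))%E.
Proof.
move=> h0 NhT tT.
have mt : measurable (`]0, t[%classic : set (measurableTypeR R)) by [].
have a0 j : 0 <= step_weight k h j by exact: step_weight_ge0.
have mGt : measurable_fun (`]0, t[%classic : set (measurableTypeR R)) (EFin \o G).
  by apply/measurable_funTS/measurable_EFinP.
have mGl l : measurable_fun setT (fun x : R => G (x - l)).
  by apply: (measurableT_comp mG); exact: measurable_funB.
apply: (@le_trans _ _ (\int[lam]_(x in `]0%R, t[) ((\sum_(j < N) step_weight k h j * G x)%:E))%E).
  rewrite -ge0_integralZl_EFin//; last 2 first.
  - by move=> x _; rewrite lee_fin.
  - exact: sumr_ge0.
  by under eq_integral do rewrite -EFinM mulr_suml.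
apply: (@le_trans _ _ (\int[lam]_(x in `]0%R,
    t[) ((\sum_(j < N) step_weight k h j * G (x - j.+1%:R * h))%:E + (K * G x)%:E +
        C%:E * E h N x))%E).
  apply: ae_ge0_le_integral => //.
  - by move=> x _; rewrite lee_fin sumr_ge0// => j _; rewrite mulr_ge0.
  - apply/measurable_funTS/measurable_EFinP; apply: measurable_sum => j;
      apply: measurable_funM => //; exact: mGl.
  - move=> x _; rewrite !adde_ge0//.
    + by rewrite lee_fin sumr_ge0// => j _; rewrite mulr_ge0.
    + by rewrite lee_fin mulr_ge0.
    + by rewrite mule_ge0// E_ge0.
  - apply: measurable_funTS; apply: emeasurable_funD; last by apply: measurable_funeM;
      exact: measurable_E.
    apply/measurable_EFinP; apply: measurable_funD; last exact: measurable_funM.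
    by apply: measurable_sum => j; apply: measurable_funM => //; exact: mGl.
  apply: ae_imply GK => x GKx; rewrite /= in_itv/= => /andP[x0 xt].
  have xT : 0 < x < T by rewrite x0 (lt_le_trans xt).
  by have [kW kWle] := GKx xT; exact: (pointwise N h0 xT kW kWle (WO xT)).
rewrite ge0_integralD//; last 4 first.
- by move=> x _; rewrite lee_fin addr_ge0 ?mulr_ge0// sumr_ge0// => j _; rewrite mulr_ge0.
- apply/measurable_funTS/measurable_EFinP; apply: measurable_funD; last exact: measurable_funM.
  by apply: measurable_sum => j; apply: measurable_funM => //; exact: mGl.
- by move=> x _; rewrite mule_ge0// E_ge0.
- by apply: measurable_funTS; apply: measurable_funeM; exact: measurable_E.
rewrite ge0_integralD//; last 4 first.
- by move=> x _; rewrite lee_fin sumr_ge0// => j _; rewrite mulr_ge0.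
- by apply/measurable_funTS/measurable_EFinP; apply: measurable_sum => j;
    apply: measurable_funM => //; exact: mGl.
- by move=> x _; rewrite lee_fin mulr_ge0.
- by apply/measurable_funTS/measurable_EFinP; exact: measurable_funM.
apply: leeD; first apply: leeD.
- under eq_integral do rewrite -sumEFin.
  rewrite ge0_integral_sum//; last 2 first.
  + by move=> j; apply/measurable_funTS/measurable_EFinP; apply: measurable_funM => //;
      exact: mGl.
  + by move=> j x _; rewrite lee_fin mulr_ge0.
  apply: lee_sum => j _; rewrite -Ydelay ?mulr_gt0//.
  rewrite -ge0_integralZl_EFin//; first by move=> x _; rewrite lee_fin.
  by apply/measurable_funTS/measurable_EFinP; exact: mGl.
- by rewrite /Y -ge0_integralZl_EFin// => x _; rewrite lee_fin.
rewrite ge0_integralZl_EFin//; last 2 first.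
- by move=> x _; rewrite E_ge0.
- by apply: measurable_funTS; exact: measurable_E.
rewrite lee_wpmul2l ?lee_fin//.
apply: le_trans (E_int h0 NhT); apply: ge0_subset_integral => //.
- exact: measurable_E.
- by move=> x _; exact: E_ge0.
Qed.

(** Let [y] be the primitive of [G] and suppose [y(t - d/2) = 0]. Then [G] contributes
    nothing at the delays of at least [d/2], while the shorter delays contribute
    nonnegative amounts because [y] is nondecreasing. The weights of the long delays
    sum to at least [k d >= K + 1] and multiply [y(t)], against [K y(t)] and a kernel
    error that tends to 0 with the mesh. *)
Lemma gronwall_kernel : (\int[lam]_(x in `]0%R, T[) (G x)%:E = 0)%E.
Proof.
have [d d0 dK] := kbig (K + 1).
apply: (@zero_continuation _ Y T (d / 2)) => //; first by rewrite divr_gt0.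
  by move=> t t0; rewrite /Y set_itv_ge ?integral_set0// bnd_simp -leNgt.
move=> t tT Yt0; apply/eqP; rewrite eq_le Y_ge0 andbT.
have YE := fineK (Y_fin tT).
pose w := fine (\int[lam]_x (omega x)%:E).
have o0 : (0 <= \int[lam]_x (omega x)%:E)%E by apply: integral_ge0 => x _; rewrite lee_fin.
have wE : w%:E = (\int[lam]_x (omega x)%:E)%E by rewrite fineK// ge0_fin_numE.
have w0 : 0 <= w by rewrite fine_ge0.
rewrite -YE lee_fin; apply/ler_addgt0Pl => e e0; rewrite addr0.
have Cw : 0 < C * w + 1 by rewrite ltr_wpDl// mulr_ge0.
have [h1 h10 kh1] := ksmall (divr_gt0 e0 Cw).
(* A mesh of at most d/2 ensures k (d/2 + h) >= k d. *)
pose h := Num.min h1 (d / 2).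
have h0 : 0 < h by rewrite lt_min h10 divr_gt0.
have hh1 : 0 < h <= h1 by rewrite h0 ge_min lexx.
pose N := (Num.truncn (T / h)).+1.
have NhT : T < N.+1%:R * h.
  rewrite -ltr_pdivrMr// (lt_trans (truncnS_gt (T / h)))// ltr_nat ltnS.
  done.
have := integrated h0 NhT tT.
set S := (\sum_(j < N) _)%E.
have -> : S = (\sum_(j < N) (step_weight k h j * (1 - \1_(`]0,
    j.+1%:R * h[%classic) (d / 2)))%:E * Y (t - j.+1%:R * h))%E.
  apply: eq_bigr => j _; rewrite indicE mem_setE in_itv/= divr_gt0//=.
  have [dj|dj] := ltP; last by rewrite subr0 mulr1.
  suff -> : Y (t - j.+1%:R * h) = 0%E by rewrite !mule0.
  by apply/eqP; rewrite eq_le Y_ge0 -Yt0 le_Y// lerD2l lerN2 ltW.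
have SY : ((\sum_(j < N) (step_weight k h j * (1 - \1_(`]0,
    j.+1%:R * h[%classic) (d / 2)))%:E * Y (t - j.+1%:R * h)) <=
  (\sum_(j < N) step_weight k h j - kn h N (d / 2))%:E * Y t)%E.
  rewrite /step_kernel -sumrB -YE -EFinM mulr_suml -sumEFin; apply: lee_sum => j _.
  rewrite [leRHS]EFinM YE [leRHS](_ : _ = ((step_weight k h j * (1 - \1_(`]0,
      j.+1%:R * h[%classic) (d / 2)))%:E * Y t)%E).
    apply: lee_wpmul2l; last by rewrite le_Y// gerBl mulr_ge0// ltW.
    rewrite lee_fin; apply: mulr_ge0; first exact: step_weight_ge0.
    by rewrite subr_ge0 indicE lern1 leq_b1.
  by rewrite mulrBr mulr1.
move=> H0.
have : ((\sum_(j < N) step_weight k h j)%:E * Y t <=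
    (\sum_(j < N) step_weight k h j - kn h N (d / 2))%:E * Y t + K%:E * Y t +
    C%:E * ((e / (C * w + 1))%:E * w%:E))%E.
  apply: le_trans H0 _; apply: leeD; first exact: leeD.
  apply: lee_wpmul2l; first by rewrite lee_fin.
  by rewrite wE; apply: lee_wpmul2r => //; exact: kh1.
rewrite -YE -!EFinM -!EFinD lee_fin => {}H0.
have := @step_kernel_lower _ k h h0 k_ni N (d / 2) (divr_gt0 d0 (ltr0Sn _ 1)).
rewrite (kT NhT) subr0.
have kd : k d <= k (d / 2 + h).
  apply: k_ni; first by rewrite addr_gt0// divr_gt0.
  by rewrite [leRHS]splitr lerD2l ge_min lexx orbT.
move=> kn1.
have Kn : K + 1 <= kn h N (d / 2) by exact: le_trans dK (le_trans kd kn1).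
have y0 : 0 <= fine (Y t) by rewrite fine_ge0.
have H2 : (kn h N (d / 2) - K) * fine (Y t) <= C * w * (e / (C * w + 1)).
  by move: H0; set A := \sum_(j < N) _; move: (kn h N (d/2)) => q; rewrite !mulrDl mulNr; lra.
have H3 : fine (Y t) <= (kn h N (d / 2) - K) * fine (Y t).
  by rewrite ler_peMl// lerBrDl.
apply: (le_trans H3); apply: (le_trans H2).
rewrite mulrCA ler_piMr ?(ltW e0)// ler_pdivrMr// mul1r lerDl//.
Qed.

End gronwall_kernel.

(** * Vanishing of an energy controlled locally in time *)
Section interval_induction.
Context {R : realType}.

(** Continuous induction: the supremum of the times at which [P] holds is reached,
    and cannot be smaller than [T], because [P] propagates across it. *)
Lemma interval_induction (P : R -> Prop) (T : R) : 0 <= T -> P 0 ->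
  (forall t0, 0 <= t0 <= T -> exists2 d, 0 < d & forall r t,
     0 <= r -> r <= t -> t <= T -> `|r - t0| < d -> `|t - t0| < d ->
     P r -> P t) -> P T.
Proof.
move=> T0 P0 Ploc; pose A := [set t | 0 <= t <= T /\ P t].
have A0 : A 0 by rewrite /A/= lexx.
have hsA : has_sup A by split; [exists 0|exists T => t [/andP[]]].
have c0 : 0 <= sup A by apply: ub_le_sup => //; exact: hsA.2.
have cT : sup A <= T by apply: ge_sup; [exists 0|move=> t [/andP[]]].
have cP : 0 <= sup A <= T by rewrite c0.
have [d d0 dP] := Ploc _ cP.
have [r Ar rc] := sup_adherent d0 hsA.
have [/andP[r0 rT] Pr] := Ar.
have rs : r <= sup A by apply: ub_le_sup => //; exact: hsA.2.
pose t := Num.min (sup A + d / 2) T.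
have d20 : 0 < d / 2 by rewrite divr_gt0.
have st : sup A <= t by rewrite le_min cT lerDl ltW.
have tT : t <= T by rewrite ge_min lexx orbT.
have td : t <= sup A + d / 2 by rewrite ge_min lexx.
have Pt : P t.
  apply: (dP r t) => //; first exact: le_trans st.
  - by rewrite ltr_norml; apply/andP; split; lra.
  - by rewrite ltr_norml; apply/andP; split; lra.
have ts : t <= sup A.
  by apply: ub_le_sup; [exact: hsA.2|split=> //; rewrite tT (le_trans c0)].
suff -> : T = t by [].
apply/eqP; rewrite eq_le tT andbT.
by move: ts; rewrite {1}/t ge_min => /orP[|/le_trans]; [lra|apply].
Qed.

End interval_induction.

Section gronwall_local.
Context {R : realType}.
Local Notation lam := (@lebesgue_measure R).
Local Open Scope ereal_scope.
Variables (T K : R) (G omega : R -> R).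
Hypotheses (K0 : (0 <= K)%R)
  (mG : measurable_fun setT G) (G_ge0 : forall x, (0 <= G x)%R)
  (GN : forall x : R, (x <= 0)%R -> G x = 0%R)
  (Gfin : \int[lam]_(x in `]0%R, T[) (G x)%:E < +oo)
  (mo : measurable_fun setT omega) (o_ge0 : forall x, (0 <= omega x)%R)
  (ofin : \int[lam]_x (omega x)%:E < +oo)
  (Gloc : forall e t0 : R, (0 < e)%R -> (0 <= t0 < T)%R ->
    exists2 d : R, (0 < d)%R & forall r t : R, (0 <= r)%R -> (r < t)%R -> (t < T)%R ->
     (`|r - t0| < d)%R -> (`|t - t0| < d)%R ->
     (G t)%:E <= (G r)%:E + \int[lam]_(x in `]r, t[) (K * G x + e * omega x)%:E).

Let Y t := \int[lam]_(r in `]0%R, t[) (G r)%:E.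

Let Y_ge0 t : 0 <= Y t.
Proof. by apply: integral_ge0 => x _; rewrite lee_fin. Qed.

Let le_Y (t t' : R) : (t <= t')%R -> Y t <= Y t'.
Proof.
move=> tt; apply: ge0_subset_integral => //.
- by apply/measurable_funTS/measurable_EFinP.
- by move=> x _; rewrite lee_fin.
- by move=> x /=; rewrite !in_itv/= => /andP[-> /lt_le_trans]; exact.
Qed.

Let Y_fin (t : R) : (t <= T)%R -> Y t \is a fin_num.
Proof. by move=> tT; rewrite ge0_fin_numE//; apply: le_lt_trans (le_Y tT) Gfin. Qed.

Let bound_e (e t : R) : (0 < e)%R -> (0 <= t < T)%R ->
  (G t)%:E <= \int[lam]_(x in `]0%R, t[) (K * G x + e * omega x)%:E.
Proof.
move=> e0 /andP[t0 tT].
have F0 x : 0 <= (K * G x + e * omega x)%:E.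
  by rewrite lee_fin addr_ge0// mulr_ge0// ltW.
have mF : measurable_fun setT (fun x => (K * G x + e * omega x)%:E).
  by apply/measurable_EFinP; apply: measurable_funD; exact: measurable_funM.
pose P (s : R) := (G s)%:E <= \int[lam]_(x in `]0%R, s[) (K * G x + e * omega x)%:E.
apply: (@interval_induction R P t) => //.
  by rewrite /P GN// integral_ge0.
move=> s /andP[s0 st].
have [d d0 dP] := Gloc e0 (introT andP (conj s0 (le_lt_trans st tT))).
exists d => // r q r0; rewrite le_eqVlt => /predU1P[->//|rq] qt rs qs Pr.
apply: (le_trans (dP r q r0 rq (le_lt_trans qt tT) rs qs)).
apply: (le_trans (leeD Pr (lexx _))).
rewrite -ge0_integral_setU//; last 2 first.
- exact: measurable_funTS.
- apply/disj_setPS => x/= []; rewrite !in_itv/= => /andP[_ xr] /andP[rx _].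
  by move: (lt_trans xr rx); rewrite ltxx.
apply: ge0_subset_integral => //.
- exact: measurableU.
- exact: measurable_funTS.
- move=> x /= []; rewrite !in_itv/= => /andP[x0 xr].
    by rewrite x0 (lt_trans xr).
  by rewrite xr andbT (le_lt_trans r0).
Qed.

Let bound (t : R) : (0 <= t < T)%R -> (G t)%:E <= K%:E * Y t.
Proof.
move=> /[dup] t0T /andP[t0 tT].
have o0 : 0 <= \int[lam]_x (omega x)%:E by apply: integral_ge0 => x _; rewrite lee_fin.
pose w := fine (\int[lam]_x (omega x)%:E).
have wE : w%:E = \int[lam]_x (omega x)%:E by rewrite fineK// ge0_fin_numE.
have w0 : (0 <= w)%R by rewrite fine_ge0.
have YE := fineK (Y_fin (ltW tT)).
rewrite -YE -EFinM lee_fin; apply/ler_addgt0Pr => e e0.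
have e1 : (0 < e / (w + 1))%R by rewrite divr_gt0// ltr_wpDl.
have := bound_e e1 t0T.
under eq_integral do rewrite EFinD.
rewrite ge0_integralD//; last 4 first.
- by move=> x _; rewrite lee_fin mulr_ge0.
- by apply/measurable_funTS/measurable_EFinP; exact: measurable_funM.
- by move=> x _; rewrite lee_fin mulr_ge0// ltW.
- by apply/measurable_funTS/measurable_EFinP; exact: measurable_funM.
under eq_integral do rewrite EFinM.
rewrite ge0_integralZl_EFin//; last 2 first.
- by move=> x _; rewrite lee_fin.
- by apply/measurable_funTS/measurable_EFinP.
under [X in _ + X]eq_integral do rewrite EFinM.
rewrite ge0_integralZl_EFin//; last 3 first.
- by move=> x _; rewrite lee_fin.
- by apply/measurable_funTS/measurable_EFinP.
- exact: ltW.
move=> H; rewrite -lee_fin; apply: (le_trans H).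
rewrite [leRHS]EFinD [in leRHS]EFinM YE; apply: leeD => //.
apply: (@le_trans _ _ ((e / (w + 1))%:E * w%:E)).
  apply: lee_wpmul2l; first by rewrite lee_fin ltW.
  rewrite wE; apply: ge0_subset_integral => //.
  - by apply/measurable_EFinP.
  - by move=> x _; rewrite lee_fin.
rewrite -EFinM lee_fin mulrAC ler_pdivrMr ?ltr_wpDl//.
by rewrite ler_wpM2l ?ltW// ltrDl.
Qed.

(** Continuous induction adds up the local inequalities, so that
    [G t <= int_0^t (K G + e omega)] for every [e > 0], whence [G <= K y] for the
    primitive [y] of [G]. If [y] vanishes at [t - d] then [y(t) <= d K y(t)], and
    [d K <= 1/2]. *)
Lemma gronwall_local : \int[lam]_(x in `]0%R, T[) (G x)%:E = 0.
Proof.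
pose d := ((K + 1)^-1 / 2)%R.
have K1 : (0 < K + 1)%R by rewrite ltr_wpDl.
have d0 : (0 < d)%R by rewrite divr_gt0// invr_gt0.
apply: (@zero_continuation _ Y T d) => //.
  by move=> t t0; rewrite /Y set_itv_ge ?integral_set0// bnd_simp -leNgt.
move=> t tT Yt0; apply/eqP; rewrite eq_le Y_ge0 andbT.
have YE := fineK (Y_fin tT).
have y0 : (0 <= fine (Y t))%R by rewrite fine_ge0.
have H : Y t <= Y (t - d)%R + \int[lam]_(x in `[(t - d)%R, t[) (K * fine (Y t))%:E.
  have mi : measurable (`[(t - d)%R, t[%classic : set (measurableTypeR R)) by [].
  apply: (@le_trans _ _ (Y (t - d)%R + \int[lam]_(x in `[(t - d)%R, t[) (G x)%:E)).
    rewrite -ge0_integral_setU//; last 3 first.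
    - by apply/measurable_funTS/measurable_EFinP.
    - by move=> x _; rewrite lee_fin.
    - apply/disj_setPS => x/= []; rewrite !in_itv/= => /andP[_ xr] /andP[rx _].
      by move: (lt_le_trans xr rx); rewrite ltxx.
    apply: ge0_subset_integral => //.
    - exact: measurableU.
    - by apply/measurable_funTS/measurable_EFinP.
    - by move=> x _; rewrite lee_fin.
    - move=> x /=; rewrite !in_itv/= => /andP[x0 xt].
      by have [xd|xd] := ltP x (t - d)%R; [left; rewrite x0|right].
  rewrite leeD2l//; apply: ge0_le_integral => //.
  - by move=> x _; rewrite lee_fin.
  - by apply/measurable_funTS/measurable_EFinP.
  - move=> x /=; rewrite in_itv/= => /andP[xd xt]; rewrite lee_fin.
    have [x0|x0] := leP x 0%R; first by rewrite GN// mulr_ge0.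
    have : (0 <= x < T)%R by rewrite ltW//= (lt_le_trans xt).
    move=> /bound /le_trans; rewrite -lee_fin; apply.
    by rewrite EFinM YE; apply: lee_wpmul2l; rewrite ?lee_fin// le_Y// ltW.
move: H; rewrite Yt0 add0e integral_cst//=.
rewrite lebesgue_measure_itv/= lte_fin gtrBl d0 -EFinB opprB addrCA subrr addr0 -YE -EFinM
    !lee_fin.
move=> H.
have Kd : (K * d <= 1/2)%R.
  by rewrite /d mulrA ler_pM2r ?invr_gt0// ler_pdivrMr// mul1r lerDl.
have : (K * fine (Y t) * d <= 1 / 2 * fine (Y t))%R.
  by rewrite mulrAC ler_wpM2r.
lra.
Qed.

End gronwall_local.

(** * Real-valued scalar product and norm on square-integrable functions *)
Section L2.
Context d (T : measurableType d) (R : realType) (mu : {measure set T -> \bar R}).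
Implicit Types f g h : T -> R.
Local Notation L2 := (Lfun mu 2%:E).

Definition L2ip f g : R := \int[mu]_x (f x * g x).
(** The library norm is extended-real valued; on square-integrable functions it is
    finite and this is its value. *)
Definition L2n f : R := fine ('N[mu]_2%:E[EFin \o f])%E.

Lemma le12 : (1 <= 2%:E :> \bar R)%E. Proof. by rewrite lee_fin ler1n. Qed.

Lemma L2_measurable f : f \in L2 -> measurable_fun setT f.
Proof. by rewrite inE => /andP[/[!inE]]. Qed.

Lemma L2nE f : f \in L2 -> (L2n f)%:E = ('N[mu]_2%:E[EFin \o f])%E.
Proof.
rewrite inE => /andP[_]; rewrite inE /= /finite_norm => lf.
by rewrite /L2n fineK// ge0_fin_numE ?Lnorm_ge0.
Qed.

Lemma L2n_ge0 f : 0 <= L2n f.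
Proof. by rewrite fine_ge0// Lnorm_ge0. Qed.

Lemma L2D f g : f \in L2 -> g \in L2 -> (fun x => f x + g x) \in L2.
Proof. by have [_ H] := Lfun_addr_closed mu le12; exact: H. Qed.

Lemma L2Z (a : R) f : f \in L2 -> (fun x => a * f x) \in L2.
Proof.
move=> fL; have -> : (fun x => a * f x) = a \o* f.
  by apply/funext => x; rewrite /= mulrC.
by apply: Lfun_scale => //; rewrite ler1n.
Qed.

Lemma L2B f g : f \in L2 -> g \in L2 -> (fun x => f x - g x) \in L2.
Proof.
move=> fL gL; have -> : (fun x => f x - g x) = (fun x => f x + (-1) * g x).
  by apply/funext => x; rewrite mulN1r.
exact: L2D fL (L2Z _ gL).
Qed.

Lemma L2_sum I (s : seq I) (F : I -> T -> R) : (forall i, F i \in L2) ->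
  (fun x => \sum_(i <- s) F i x) \in L2.
Proof.
move=> FL; elim: s => [|i s IH].
  rewrite (_ : (fun x => _) = cst 0); last by apply/funext => x; rewrite big_nil.
  exact: (@LfunP _ _ _ mu 2%:E le12 (cst 0)).
rewrite (_ : (fun x => _) = (fun x => F i x + \sum_(j <- s) F j x)).
  exact: L2D (FL i) IH.
by apply/funext => x; rewrite big_cons.
Qed.

Lemma integral_sqrE f :
  (\int[mu]_x (f x ^+ 2)%:E = (('N[mu]_2%:E[EFin \o f]) `^ 2))%E.
Proof.
rewrite poweR_Lnorm//; apply: eq_integral => x _.
by change ((f x ^+ 2)%:E = (`|f x|%R%:E `^ 2)%E);
    rewrite poweR_EFin powR_mulrn// real_normK// num_real.
Qed.

Lemma L2P f : f \in L2 <-> measurable_fun setT f /\ (\int[mu]_x (f x ^+ 2)%:E < +oo)%E.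
Proof.
split.
  move=> fL; split; first exact: L2_measurable.
  by rewrite integral_sqrE poweR_lty// -L2nE// ltry.
move=> [mf ifoo]; rewrite inE; apply/andP; split; first by rewrite inE.
rewrite inE/= /finite_norm; apply: (@lty_poweRy _ _ 2) => //.
by rewrite -integral_sqrE.
Qed.

Lemma L2_le f g : measurable_fun setT f -> g \in L2 ->
  (forall x, `|f x| <= `|g x|) -> f \in L2.
Proof.
move=> mf gL fg; apply/L2P; split => //.
have /L2P[mg] := gL; apply: le_lt_trans; apply: ge0_le_integral => //.
- by move=> x _; rewrite lee_fin sqr_ge0.
- by apply/measurable_EFinP; exact: measurable_funX.
- by apply/measurable_EFinP; exact: measurable_funX.
- move=> x _; rewrite lee_fin -[f x ^+ 2]real_normK ?num_real//.
  by rewrite -[g x ^+ 2]real_normK ?num_real// lerXn2r ?nnegrE.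
Qed.

Lemma L2_int f g : f \in L2 -> g \in L2 ->
  mu.-integrable setT (EFin \o (fun x => f x * g x)).
Proof. by move=> fL gL; apply/Lfun1_integrable; exact: Lfun2_mul_Lfun1. Qed.

Lemma L2ipE f g : f \in L2 -> g \in L2 -> (L2ip f g)%:E = (\int[mu]_x (f x * g x)%:E)%E.
Proof. by move=> fL gL; rewrite fineK//; apply: integrable_fin_num => //; exact: L2_int. Qed.

Lemma L2ipC f g : L2ip f g = L2ip g f.
Proof. by apply: eq_Rintegral => x _; rewrite mulrC. Qed.

Lemma L2ipDl f g h : f \in L2 -> g \in L2 -> h \in L2 ->
  L2ip (fun x => f x + g x) h = L2ip f h + L2ip g h.
Proof.
move=> fL gL hL; rewrite -RintegralD//; try exact: L2_int.
by apply: eq_Rintegral => x _; rewrite mulrDl.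
Qed.

Lemma L2ipZl (a : R) f h : f \in L2 -> h \in L2 ->
  L2ip (fun x => a * f x) h = a * L2ip f h.
Proof.
move=> fL hL; rewrite -RintegralZl//; last exact: L2_int.
by apply: eq_Rintegral => x _; rewrite mulrA.
Qed.

Lemma L2ipBl f g h : f \in L2 -> g \in L2 -> h \in L2 ->
  L2ip (fun x => f x - g x) h = L2ip f h - L2ip g h.
Proof.
move=> fL gL hL; rewrite -RintegralB//; try exact: L2_int.
by apply: eq_Rintegral => x _; rewrite mulrBl.
Qed.

Lemma L2ip_suml I (s : seq I) (F : I -> T -> R) h : (forall i, F i \in L2) -> h \in L2 ->
  L2ip (fun x => \sum_(i <- s) F i x) h = \sum_(i <- s) L2ip (F i) h.
Proof.
move=> FL hL; elim: s => [|i s IH].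
  rewrite big_nil /L2ip; under eq_Rintegral do rewrite big_nil mul0r.
  by rewrite Rintegral_cst// mul0r.
rewrite big_cons -IH -L2ipDl//; last exact: L2_sum.
by congr (L2ip _ h); apply/funext => x; rewrite big_cons.
Qed.

Lemma le_L2ip f g f' g' : f \in L2 -> g \in L2 -> f' \in L2 -> g' \in L2 ->
  (forall x, f x * g x <= f' x * g' x) -> L2ip f g <= L2ip f' g'.
Proof. by move=> fL gL fL' gL' H; apply: le_Rintegral => //; exact: L2_int. Qed.

Lemma L2ip_sqr f : f \in L2 -> L2ip f f = L2n f ^+ 2.
Proof.
move=> fL; apply: EFin_inj; rewrite L2ipE//.
have := integral_sqrE f; rewrite -L2nE// poweR_EFin powR_mulrn ?L2n_ge0// => <-.
Qed.

Lemma L2ip_CauchySchwarz f g : f \in L2 -> g \in L2 -> `|L2ip f g| <= L2n f * L2n g.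
Proof.
move=> fL gL; rewrite -lee_fin EFinM !L2nE//.
apply: (le_trans _ (hoelder _ (L2_measurable fL) (L2_measurable gL) _ _ _)) => //.
  rewrite /L2ip EFin_normr_Rintegral//; last exact: L2_int.
  rewrite Lnorm1; apply: le_abse_integral => //.
  exact: (measurable_int _ (L2_int fL gL)).
by rewrite -mulr2n -[RHS](@mulVf _ 2)// mulr_natr.
Qed.

Lemma L2n_triangle f g : f \in L2 -> g \in L2 ->
  L2n (fun x => f x + g x) <= L2n f + L2n g.
Proof.
move=> fL gL; rewrite -lee_fin EFinD !L2nE//; last exact: L2D.
by apply: minkowski_EFin; rewrite ?ler1n//; exact: L2_measurable.
Qed.

Lemma L2n_le f g : measurable_fun setT f -> g \in L2 ->
  (forall x, `|f x| <= `|g x|) -> L2n f <= L2n g.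
Proof.
move=> mf gL fg; have fL := L2_le mf gL fg.
rewrite -(@ler_pXn2r _ 2) ?nnegrE ?L2n_ge0// -!L2ip_sqr//.
apply: le_L2ip => // x; rewrite -!expr2 -[f x ^+ 2]real_normK ?num_real//.
by rewrite -[g x ^+ 2]real_normK ?num_real// lerXn2r ?nnegrE.
Qed.

Lemma L2n_opp f : L2n (fun x => - f x) = L2n f.
Proof.
by rewrite /L2n (_ : _ \o _ = (\- (EFin \o f))%E)// oppe_Lnorm.
Qed.

Lemma L2n_subC f g : L2n (fun x => f x - g x) = L2n (fun x => g x - f x).
Proof. by rewrite -L2n_opp; congr L2n; apply/funext => x; rewrite opprB. Qed.

Lemma L2nZ (a : R) f : f \in L2 -> L2n (fun x => a * f x) = `|a| * L2n f.
Proof.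
move=> fL; apply/eqP; rewrite -(@eqrXn2 _ 2) ?mulr_ge0 ?L2n_ge0//.
rewrite -L2ip_sqr; last exact: L2Z.
rewrite L2ipZl//; last exact: L2Z.
by rewrite L2ipC L2ipZl// exprMn -L2ip_sqr// real_normK ?num_real// mulrA expr2.
Qed.

Lemma L2n_sum I (s : seq I) (a : I -> R) (F : I -> T -> R) : (forall i, F i \in L2) ->
  L2n (fun x => \sum_(i <- s) a i * F i x) <= \sum_(i <- s) `|a i| * L2n (F i).
Proof.
move=> FL; elim: s => [|i s IH].
  rewrite big_nil (_ : (fun x => _) = (fun x => 0 * (cst 0 : T -> R) x)).
    by rewrite L2nZ ?normr0 ?mul0r//; exact: (@LfunP _ _ _ mu 2%:E le12 (cst 0)).
  by apply/funext => x; rewrite big_nil mul0r.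
rewrite big_cons (_ : (fun x => _) = (fun x => a i * F i x + \sum_(j <- s) a j * F j x)).
  apply: (le_trans (L2n_triangle (L2Z _ (FL i)) (L2_sum _ _))) => //.
    by move=> j; exact: L2Z.
  by rewrite L2nZ// lerD2l.
by apply/funext => x; rewrite big_cons.
Qed.

Lemma L2n_sub_triangle f g h : f \in L2 -> g \in L2 -> h \in L2 ->
  L2n (fun x => f x - h x) <= L2n (fun x => f x - g x) + L2n (fun x => g x - h x).
Proof.
move=> fL gL hL; apply: le_trans (L2n_triangle (L2B fL gL) (L2B gL hL)).
by rewrite le_eqVlt; apply/orP; left; apply/eqP; congr L2n; apply/funext => x;
    rewrite addrA subrK.
Qed.

Lemma L2n_dist f g : f \in L2 -> g \in L2 -> `|L2n f - L2n g| <= L2n (fun x => f x - g x).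
Proof.
move=> fL gL; have H f' g' : f' \in L2 -> g' \in L2 ->
    L2n f' <= L2n (fun x => f' x - g' x) + L2n g'.
  move=> fL' gL'; apply: le_trans (L2n_triangle (L2B fL' gL') gL').
  by rewrite le_eqVlt; apply/orP; left; apply/eqP; congr L2n; apply/funext => x; rewrite subrK.
rewrite ler_norml; apply/andP; split; last by rewrite lerBlDr H.
by rewrite lerNl opprB lerBlDr L2n_subC H.
Qed.

End L2.

(** * Measurable versions of functions approximated in mean *)
Section sandwich.
Context d (T : measurableType d) (R : realType) (mu : {measure set T -> \bar R}).
Variables (D : set T) (mD : measurable D) (f : T -> R) (fn rn : nat -> T -> R).
Hypotheses (ifn : forall n, mu.-integrable D (EFin \o fn n))
  (mrn : forall n, measurable_fun D (rn n))
  (rn0 : forall n t, D t -> 0 <= rn n t)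
  (fE : forall n t, D t -> `|f t - fn n t| <= rn n t)
  (cvr : (\int[mu]_(t in D) (rn n t)%:E)%E @[n --> \oo] --> 0%E).

Let lo n t := fn n t - rn n t.
Let hi n t := - (fn n t + rn n t).
Let W t := sups (lo ^~ t) 0.
Let V t := - sups (hi ^~ t) 0.

Let mfn n : measurable_fun D (fn n).
Proof. by have /measurable_int/measurable_EFinP := ifn n. Qed.

Let lof n t : D t -> lo n t <= f t.
Proof. by move=> Dt; have := fE n Dt; rewrite ler_norml /lo => /andP[]; lra. Qed.

Let hif n t : D t -> hi n t <= - f t.
Proof. by move=> Dt; have := fE n Dt; rewrite ler_norml /hi => /andP[]; lra. Qed.

Let lo_ub t : D t -> has_ubound (range (lo ^~ t)).
Proof. by move=> Dt; exists (f t) => _ [n _ <-]; exact: lof. Qed.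

Let hi_ub t : D t -> has_ubound (range (hi ^~ t)).
Proof. by move=> Dt; exists (- f t) => _ [n _ <-]; exact: hif. Qed.

Let mW : measurable_fun D W.
Proof. by apply: measurable_fun_sups => // n; exact: measurable_funB. Qed.

Let mV : measurable_fun D V.
Proof.
apply: measurable_funN; apply: measurable_fun_sups => // n.
by apply: measurable_funN; exact: measurable_funD.
Qed.

Let supsE (u : nat -> R) : sups u 0 = sup (range u).
Proof.
by rewrite /sups /sdrop/=; congr sup; apply/seteqP; split => x [n _ <-]; exists n.
Qed.

Let loW n t : D t -> lo n t <= W t.
Proof.
move=> Dt; rewrite /W supsE; apply: ub_le_sup; last by exists n.
exact: lo_ub.
Qed.

Let Wf t : D t -> W t <= f t.
Proof.
move=> Dt; rewrite /W supsE; apply: ge_sup; first by exists (lo 0 t); exists 0%N.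
by move=> _ [n _ <-]; exact: lof.
Qed.

Let hiV n t : D t -> hi n t <= - V t.
Proof.
move=> Dt; rewrite /V supsE opprK; apply: ub_le_sup; last by exists n.
exact: hi_ub.
Qed.

Let fV t : D t -> f t <= V t.
Proof.
move=> Dt; rewrite /V supsE lerNr; apply: ge_sup; first by exists (hi 0 t); exists 0%N.
by move=> _ [n _ <-]; exact: hif.
Qed.

Let Wfn n t : D t -> `|W t - fn n t| <= rn n t.
Proof.
move=> Dt; have := loW n Dt; have := Wf Dt; have := fE n Dt; rewrite /lo !ler_norml.
by move=> /andP[H1 H2] H3 H4; apply/andP; split; lra.
Qed.

Let VW n t : D t -> `|V t - W t| <= 2 * rn n t.
Proof.
move=> Dt; have := loW n Dt; have := hiV n Dt; have := Wf Dt; have := fV Dt.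
by rewrite /lo /hi ler_norml => H1 H2 H3 H4; apply/andP; split; have := rn0 n Dt; lra.
Qed.

(** The function [f] is not assumed measurable. It lies between the supremum [W] of
    the functions [fn - rn] and the infimum [V] of the functions [fn + rn], which
    are measurable, and [V - W <= 2 rn] for every [n], so that [V = W] almost
    everywhere. In addition [W] satisfies the same approximation as [f], at every
    point. *)
Lemma ae_measurable_sandwich : exists W : T -> R,
  [/\ mu.-integrable D (EFin \o W),
      {ae mu, forall t, D t -> f t = W t} &
      forall n, ((`|\int[mu]_(t in D) fn n t - \int[mu]_(t in D) W t|)%:E <=
        \int[mu]_(t in D) (rn n t)%:E)%E].
Proof.
have [n0 n0fin] : exists n, (\int[mu]_(t in D) (rn n t)%:E < 1%:E)%E.
  exact: cvge0_ex_lt cvr.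
have irn : mu.-integrable D (EFin \o rn n0).
  apply/integrableP; split; first by apply/measurable_EFinP.
  rewrite (eq_integral (fun t => (rn n0 t)%:E)); first exact: lt_trans n0fin (ltry _).
  by move=> t; rewrite inE => Dt /=; rewrite ger0_norm// rn0.
have iW : mu.-integrable D (EFin \o W).
  apply: (le_integrable mD _ _ (integrableD mD (integrable_abse (ifn n0)) irn)).
    exact/measurable_EFinP.
  move=> t Dt /=; rewrite lee_fin.
  rewrite [leRHS]ger0_norm ?addr_ge0 ?rn0//.
  have -> : W t = fn n0 t + (W t - fn n0 t) by rewrite addrC subrK.
  by rewrite (le_trans (ler_normD _ _))// lerD2l Wfn.
exists W; split => //.
  have : ae_eq mu D (fun t => (V t - W t)%:E) (cst 0%E).
    apply/ae_eq_integral_abs => //.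
      by apply/measurable_EFinP; exact: measurable_funB.
    apply/eqP; rewrite eq_le integral_ge0 ?andbT//.
    have cv2 : (2%:E * \int[mu]_(t in D) (rn n t)%:E)%E @[n --> \oo] --> 0%E.
      exact: cvge0Zl.
    apply: (cvge_ge _ cv2); apply: nearW => n.
    rewrite -ge0_integralZl_EFin//.
    - apply: ge0_le_integral => //.
      + by apply/measurable_EFinP; apply: measurableT_comp => //; exact: measurable_funB.
      + by apply: measurable_funeM; apply/measurable_EFinP.
      + by move=> t Dt; rewrite -EFinM lee_fin VW.
    - by move=> t Dt; rewrite lee_fin rn0.
    - by apply/measurable_EFinP.
  apply: ae_imply => t /= H Dt; have [VWt] := H Dt.
  have := fV Dt; have := Wf Dt; move: VWt; lra.
move=> n.
have ib : mu.-integrable D (EFin \o (fun t => fn n t - W t)).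
  exact: (integrableB mD (ifn n) iW).
rewrite -RintegralB// EFin_normr_Rintegral//.
apply: (le_trans (le_abse_integral _ mD (measurable_int _ ib))).
apply: ge0_le_integral => //.
- by apply: measurableT_comp => //; exact: (measurable_int _ ib).
- by apply/measurable_EFinP.
- by move=> t Dt; rewrite /= lee_fin distrC Wfn.
Qed.

End sandwich.

(** * Bochner integrals tested against a fixed function *)
Section bochner.
Context {R : realType} {d : nat}.
Local Notation mu := (@lebesgue_rV R d).
Local Notation lam := (@lebesgue_measure R).
Local Notation L2 := (Lfun mu 2%:E).
Implicit Types (Omega : set 'rV[R]_d) (u v : 'rV[R]_d -> R).

Lemma restrictB Omega u v :
  (u \- v) \_ Omega = (fun x => (u \_ Omega) x - (v \_ Omega) x).
Proof. by apply/funext => x; rewrite !patchE; case: ifP => // _; rewrite subr0. Qed.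

Lemma L2distE Omega u v : is_L2 Omega u -> is_L2 Omega v ->
  L2dist Omega u v = (L2n mu (fun x => (u \_ Omega) x - (v \_ Omega) x))%:E.
Proof.
by move=> uL vL; rewrite L2nE; [rewrite /L2dist /L2norm restrictB|exact: L2B].
Qed.

Lemma L2innerE Omega u v : L2inner Omega u v = L2ip mu (u \_ Omega) (v \_ Omega).
Proof.
rewrite /L2inner /L2ip Rintegral_mkcond; apply: eq_Rintegral => x _.
by rewrite !patchE; case: ifP; rewrite ?mulr0.
Qed.

Lemma simple_evalE Omega (D : set R) (S : simpleL2 Omega D) t :
  (simple_eval S t) \_ Omega =
  (fun x => \sum_(i < simple_size S) (\1_(simple_set (s := S) i) t * ((simple_val (s :=
      S) i) \_ Omega) x)).
Proof.
apply/funext => x; rewrite /simple_eval patchE; case: ifPn => xO.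
  by apply: eq_bigr => i _; rewrite patchE xO.
by rewrite big1// => i _; rewrite patchE (negbTE xO) mulr0.
Qed.

Lemma simple_integralE Omega (D : set R) (S : simpleL2 Omega D) :
  (simple_integral S) \_ Omega =
  (fun x => \sum_(i < simple_size S) (fine (lam (simple_set (s := S) i)) * ((simple_val (s :=
      S) i) \_ Omega) x)).
Proof.
apply/funext => x; rewrite /simple_integral patchE; case: ifPn => xO.
  by apply: eq_bigr => i _; rewrite patchE xO.
by rewrite big1// => i _; rewrite patchE (negbTE xO) mulr0.
Qed.

Lemma simple_eval_L2 Omega (D : set R) (S : simpleL2 Omega D) t : is_L2 Omega (simple_eval S t).
Proof.
rewrite /is_L2 simple_evalE; apply: L2_sum => i; apply: L2Z.
by have [] := simpleP (s := S) i.
Qed.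

Lemma simple_integral_L2 Omega (D : set R) (S : simpleL2 Omega D) : is_L2 Omega
    (simple_integral S).
Proof.
rewrite /is_L2 simple_integralE; apply: L2_sum => i; apply: L2Z.
by have [] := simpleP (s := S) i.
Qed.

Lemma integrable_indicM (D : set (measurableTypeR R)) (A : set (measurableTypeR R)) (c : R) :
    measurable D -> measurable A ->
  A `<=` D -> (lam A < +oo)%E ->
  lam.-integrable D (EFin \o (fun t => \1_A t * c)) /\
  \int[lam]_(t in D) (\1_A t * c) = fine (lam A) * c.
Proof.
move=> mD mA AD Afin.
have iA : lam.-integrable D (EFin \o \1_A).
  apply/integrableP; split; first by apply/measurable_EFinP; exact: measurable_indic.
  rewrite (eq_integral (fun t => (\1_A t)%:E)); last first.
    by move=> t _ /=; rewrite ger0_norm.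
  by rewrite integral_indic// setIidl.
split.
  have -> : EFin \o (fun t => \1_A t * c) = (fun t => c%:E * (EFin \o \1_A) t)%E.
    by apply/funext => t /=; rewrite -EFinM mulrC.
  exact: integrableZl.
rewrite RintegralZr//; congr (_ * _).
by rewrite /Rintegral integral_indic// setIidl.
Qed.

(** The sets of a simple function may overlap, but pairing with [psi] is linear. *)
Lemma simple_scalar Omega (D : set (measurableTypeR R)) (S : simpleL2 Omega D) psi :
  measurable D -> is_L2 Omega psi ->
  lam.-integrable D (EFin \o (fun t => L2inner Omega (simple_eval S t) psi)) /\
  \int[lam]_(t in D) L2inner Omega (simple_eval S t) psi = L2inner Omega (simple_integral S) psi.
Proof.
move=> mD pL.
pose c i := L2ip mu ((simple_val (s := S) i) \_ Omega) (psi \_ Omega).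
have E t : L2inner Omega (simple_eval S t) psi =
    \sum_(i <- index_enum 'I_(simple_size S)) \1_(simple_set (s := S) i) t * c i.
  rewrite L2innerE simple_evalE L2ip_suml//; last first.
    by move=> i; apply: L2Z; have [] := simpleP (s := S) i.
  by apply: eq_bigr => i _; rewrite L2ipZl//; have [] := simpleP (s := S) i.
have H i : lam.-integrable D (EFin \o (fun t => \1_(simple_set (s := S) i) t * c i)) /\
    \int[lam]_(t in D) (\1_(simple_set (s := S) i) t * c i) = fine (lam (simple_set (s :=
        S) i)) * c i.
  by have [? ? ? ?] := simpleP (s := S) i; apply: integrable_indicM.
pose F i (t : R) := (\1_(simple_set (s := S) i) t * c i)%:E.
have EE : (EFin \o (fun t => L2inner Omega (simple_eval S t) psi)) =
   (fun t => \sum_(i <- index_enum 'I_(simple_size S)) F i t)%E.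
  by apply/funext => t /=; rewrite E -sumEFin.
split.
  by rewrite EE; apply: integrable_sum => // i _; exact: (H i).1.
rewrite /Rintegral.
have -> : (\int[lam]_(t in D) (L2inner Omega (simple_eval S t) psi)%:E =
  \int[lam]_(t in D) (\sum_(i <- index_enum 'I_(simple_size S)) F i t))%E.
  by apply: eq_integral => t _; have := congr1 (fun f => f t) EE.
rewrite integral_sum//; last by move=> i; exact: (H i).1.
rewrite -sum_fine; last by move=> i _; exact: (integrable_fin_num mD (H i).1).
rewrite L2innerE simple_integralE L2ip_suml//; last first.
  by move=> i; apply: L2Z; have [] := simpleP (s := S) i.
apply: eq_bigr => i _; rewrite L2ipZl//; last by have [] := simpleP (s := S) i.
exact: (H i).2.
Qed.

(** A Bochner integral commutes with the scalar product by [psi]. The pairing of [w t]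
    with [psi] is only almost everywhere equal to a measurable function, hence the
    representative [W]. *)
Lemma bochner_scalar Omega (D : set (measurableTypeR R)) w I psi :
  measurable D -> is_bochner_integral Omega D w I -> is_L2 Omega psi ->
  exists W : R -> R, [/\ lam.-integrable D (EFin \o W),
    {ae lam, forall t, D t -> L2inner Omega (w t) psi = W t} &
    \int[lam]_(t in D) W t = L2inner Omega I psi].
Proof.
move=> mD [wL IL [S [mS S0 SI]]] pL.
pose N := L2n mu (psi \_ Omega).
have N0 : 0 <= N by exact: L2n_ge0.
pose r n t := N * fine (L2dist Omega (w t) (simple_eval (S n) t)).
have dE n t : D t -> L2dist Omega (w t) (simple_eval (S n) t) =
    (L2n mu (fun x => (w t \_ Omega) x - ((simple_eval (S n) t) \_ Omega) x))%:E.
  by move=> Dt; rewrite L2distE//; [exact: wL|exact: simple_eval_L2].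
have rE n t : D t -> (r n t)%:E = (N%:E * L2dist Omega (w t) (simple_eval (S n) t))%E.
  by move=> Dt; rewrite /r dE// -EFinM.
have mr n : measurable_fun D (r n).
  apply/measurable_EFinP.
  apply: (eq_measurable_fun (fun t => (N%:E * L2dist Omega (w t) (simple_eval (S n) t))%E)).
    by move=> t; rewrite inE => Dt /=; rewrite rE.
  by apply: measurable_funeM; exact: mS.
have r0 n t : D t -> 0 <= r n t.
  by move=> Dt; rewrite /r dE//= mulr_ge0// L2n_ge0.
have bnd u v' : is_L2 Omega u -> is_L2 Omega v' ->
    `|L2inner Omega u psi - L2inner Omega v' psi| <= N * L2n mu (fun x =>
        (u \_ Omega) x - (v' \_ Omega) x).
  move=> uL vL; rewrite !L2innerE -L2ipBl// [leRHS]mulrC.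
  by apply: L2ip_CauchySchwarz => //; exact: L2B.
have fE n t : D t -> `|L2inner Omega (w t) psi - L2inner Omega (simple_eval (S n) t) psi| <=
    r n t.
  by move=> Dt; rewrite /r dE//=; apply: bnd; [exact: wL|exact: simple_eval_L2].
have cvr : (\int[lam]_(t in D) (r n t)%:E)%E @[n --> \oo] --> 0%E.
  have -> : (fun n => \int[lam]_(t in D) (r n t)%:E)%E =
    (fun n => N%:E * \int[lam]_(t in D) L2dist Omega (w t) (simple_eval (S n) t))%E.
    apply/funext => n; rewrite -ge0_integralZl_EFin//.
    - by apply: eq_integral => t; rewrite inE => Dt; rewrite rE.
    - by move=> t Dt; exact: Lnorm_ge0.
    - exact: mS.
  exact: (cvge0Zl N S0).
have [W [iW aeW WI]] := ae_measurable_sandwich mD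
  (fun n => (simple_scalar (S n) mD pL).1) mr r0 fE cvr.
exists W; split => //.
apply/eqP; rewrite -subr_eq0 -normr_le0; apply/ler_addgt0Pl => e e0; rewrite addr0.
have e2 : 0 < e / 2 by rewrite divr_gt0.
have cv1 : (N%:E * L2dist Omega I (simple_integral (S n)))%E @[n --> \oo] --> 0%E.
  exact: cvge0Zl.
have near1 := cvge0_near_lt e2 cvr.
have near2 := cvge0_near_lt e2 cv1.
have [N1 _ H1] := near1; have [N2 _ H2] := near2.
pose n := maxn N1 N2.
have n1 := H1 n (leq_maxl _ _); have n2 := H2 n (leq_maxr _ _).
move: n2; rewrite L2distE//; last exact: simple_integral_L2.
rewrite -EFinM lte_fin => n2.
have := le_lt_trans (WI n) n1; rewrite lte_fin (simple_scalar (S n) mD pL).2.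
have := le_lt_trans (bnd _ _ IL (simple_integral_L2 (S n))) n2.
set a := L2inner Omega I psi; set b := L2inner Omega (simple_integral (S n)) psi.
set c := Rintegral _ _ _ => {}H1 {}H2.
have -> : c - a = - (b - c) - (a - b) by ring.
rewrite (le_trans (ler_normB _ _))// normrN [leRHS]splitr.
by apply: lerD; exact: ltW.
Qed.

(** One simple function [S] at finite mean distance is enough: take the distance of
    [w t] to [S t] plus the sum of the norms of the values of [S]. *)
Lemma bochner_majorant Omega (D : set (measurableTypeR R)) w I :
  measurable D -> is_bochner_integral Omega D w I ->
  exists om : R -> R, [/\ measurable_fun D om, forall t, D t -> 0 <= om t,
    (\int[lam]_(t in D) (om t)%:E < +oo)%E &
    forall t, D t -> L2n mu (w t \_ Omega) <= om t].
Proof.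
move=> mD [wL IL [S [mS S0 SI]]].
have [n n1] := cvge0_ex_lt ltr01 S0.
have dE t : D t -> L2dist Omega (w t) (simple_eval (S n) t) =
    (L2n mu (fun x => (w t \_ Omega) x - ((simple_eval (S n) t) \_ Omega) x))%:E.
  by move=> Dt; rewrite L2distE//; [exact: wL|exact: simple_eval_L2].
pose c i := L2n mu ((simple_val (s := S n) i) \_ Omega).
pose sg t := \sum_(i <- index_enum 'I_(simple_size (S n))) \1_(simple_set (s := S n) i) t * c i.
pose om t := fine (L2dist Omega (w t) (simple_eval (S n) t)) + sg t.
have H i : lam.-integrable D (EFin \o (fun t => \1_(simple_set (s := S n) i) t * c i)).
  by have [? ? ? ?] := simpleP (s := S n) i; exact: (integrable_indicM _ _ _ _ _).1.
pose F i (t : R) := (\1_(simple_set (s := S n) i) t * c i)%:E.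
have isg : lam.-integrable D (EFin \o sg).
  have -> : EFin \o sg = (fun t => \sum_(i <- index_enum 'I_(simple_size (S n))) F i t)%E.
    by apply/funext => t /=; rewrite /sg -sumEFin.
  by apply: integrable_sum => // i _; exact: H.
have c0 i : 0 <= c i by exact: L2n_ge0.
have sg0 t : 0 <= sg t by apply: sumr_ge0 => i _; rewrite mulr_ge0.
have md : measurable_fun D (fun t => fine (L2dist Omega (w t) (simple_eval (S n) t))).
  apply/measurable_EFinP.
  apply: (eq_measurable_fun (fun t => L2dist Omega (w t) (simple_eval (S n) t))).
    by move=> t; rewrite inE => Dt /=; rewrite dE.
  exact: mS.
have d0 t : D t -> 0 <= fine (L2dist Omega (w t) (simple_eval (S n) t)).
  by move=> Dt; rewrite fine_ge0// Lnorm_ge0.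
have msg : measurable_fun D sg by have /measurable_int/measurable_EFinP := isg.
exists om; split.
- exact: measurable_funD.
- by move=> t Dt; rewrite addr_ge0// d0.
- under eq_integral do rewrite EFinD.
  have h1 t : D t -> (0 <= (fine (L2dist Omega (w t) (simple_eval (S n) t)))%:E)%E.
    by move=> Dt; rewrite lee_fin d0.
  have h2 t : D t -> (0 <= (sg t)%:E)%E by rewrite lee_fin.
  rewrite (ge0_integralD lam mD h1 _ h2); [|exact/measurable_EFinP|exact/measurable_EFinP].
  apply: lte_add_pinfty.
    apply: (@le_lt_trans _ _ 1%:E); last exact: ltry.
    rewrite (eq_integral (fun t : measurableTypeR R =>
        L2dist Omega (w t) (simple_eval (S n) t))); first exact: ltW.
    by move=> t; rewrite inE => Dt; rewrite dE.
  have /integrableP[_] := isg; apply: le_lt_trans.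
  rewrite le_eqVlt; apply/orP; left; apply/eqP; apply: eq_integral => t _ /=.
  by rewrite ger0_norm.
- move=> t Dt; rewrite /om dE//=.
  have wtL := wL _ Dt.
  have sL := simple_eval_L2 (S n) t.
  have : L2n mu (simple_eval (S n) t \_ Omega) <= sg t.
    rewrite simple_evalE /sg.
    have vL i : (simple_val (s := S n) i) \_ Omega \in L2 by have [] := simpleP (s := S n) i.
    apply: (le_trans (L2n_sum _ _ vL)); apply: ler_sum => i _.
    by rewrite ger0_norm.
  have E : (fun x => (w t \_ Omega) x - (simple_eval (S n) t \_ Omega) x +
      (simple_eval (S n) t \_ Omega) x) = w t \_ Omega.
    by apply/funext => x; rewrite subrK.
  have := L2n_triangle (L2B wtL sL) sL; rewrite E.
  by move=> H1 H2; apply: (le_trans H1); rewrite lerD2l.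
Qed.

End bochner.

(** * Continuously differentiable test functions *)
Section smoothstep.
Context {R : realType}.

Definition sqpos (x : R) : R := Num.max 0 x ^+ 2.

Let posc : continuous (fun z : R => Num.max 0 z).
Proof.
move=> x; apply: (@continuous_max _ _ (cst 0) id); first exact: cst_continuous.
exact: cvg_id.
Qed.

Lemma is_derive_sqpos (x : R) : is_derive x 1 sqpos (2 * Num.max 0 x).
Proof.
have [x0|x0|->] := ltgtP x 0.
- have : is_derive x (1 : R) (cst 0 : R -> R) 0 by exact: is_derive_cst.
  rewrite mulr0; apply: near_eq_is_derive => //.
  near=> z; rewrite /sqpos max_l ?expr0n//.
  by apply: ltW; near: z; exact: lt_nbhsl.
- apply: (@near_eq_is_derive _ _ _ (fun z : R => z * z)) => //; last first.
    apply: (is_derive_eq (is_deriveM (is_derive_id x (1 : R)) (is_derive_id x (1 : R)))).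
    by rewrite /GRing.scale/= !mulr1; lra.
  near=> z; rewrite /sqpos max_r ?expr2//.
  by apply: ltW; near: z; exact: lt_nbhsr.
- apply/is_derive1_caratheodory; exists (fun z : R => Num.max 0 z); split.
  + move=> z; rewrite /sqpos maxxx expr0n/= !subr0.
    by have [z0|z0] := leP z 0; rewrite ?mul0r ?expr0n// expr2.
  + exact: posc.
  + by rewrite maxxx mulr0.
Unshelve. all: by end_near. Qed.

(** The function [sqpos] is continuously differentiable; this second difference of it
    is 0 before 0 and 1 after 1. *)
Definition smoothstep (x : R) : R :=
  2 * sqpos x - 4 * sqpos (x - 2^-1) + 2 * sqpos (x - 1).

Definition tent (x : R) : R :=
  4 * (Num.max 0 x - 2 * Num.max 0 (x - 2^-1) + Num.max 0 (x - 1)).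

Lemma is_derive_smoothstep (x : R) : is_derive x 1 smoothstep (tent x).
Proof.
have D c : is_derive x (1:R) (fun y => sqpos (y - c)) (2 * Num.max 0 (x - c)).
  have H : is_derive x (1:R) (fun y => y - c) 1.
    apply: (is_derive_eq (is_deriveB (is_derive_id x (1:R)) (is_derive_cst c x (1:R)))).
    by rewrite subr0.
  have -> : (fun y => sqpos (y - c)) = sqpos \o (fun y : R => y - c) by [].
  apply: (is_derive_eq (@is_derive1_comp _ sqpos (fun y : R =>
      y - c) _ _ _ (is_derive_sqpos (x - c)) H)).
  by rewrite mulr1.
apply: (is_derive_eq (is_deriveD (is_deriveB (is_deriveZ 2 (is_derive_sqpos x)) (is_deriveZ 4
    (D 2^-1))) (is_deriveZ 2 (D 1)))).
rewrite /tent /GRing.scale/=; ring.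
Qed.

Lemma tent_continuous : continuous tent.
Proof.
have cB c : continuous (fun x : R => Num.max 0 (x - c)).
  move=> x; apply: (@continuous_comp _ _ _ (fun x : R => x - c) (fun z : R => Num.max 0 z)).
    by apply: cvgB; [exact: cvg_id|exact: cvg_cst].
  exact: posc.
move=> x; apply: cvgM; first exact: cvg_cst.
apply: cvgD; last exact: cB.
apply: cvgB; first exact: posc.
by apply: cvgM; [exact: cvg_cst|exact: cB].
Qed.

Lemma tent_ge0 x : 0 <= tent x.
Proof.
rewrite /tent; have [] := leP x 0; have [] := leP (x - 2^-1) 0; have [] := leP (x - 1) 0; lra.
Qed.

Lemma smoothstep_le0 x : x <= 0 -> smoothstep x = 0.
Proof.
by move=> x0; rewrite /smoothstep /sqpos !max_l ?expr0n/= ?mulr0 ?subrr ?addr0//; lra.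
Qed.

Lemma smoothstep_ge1 x : 1 <= x -> smoothstep x = 1.
Proof.
move=> x1; rewrite /smoothstep /sqpos.
have -> : Num.max 0 x = x by rewrite max_r; lra.
have -> : Num.max 0 (x - 2^-1) = x - 2^-1 by rewrite max_r; lra.
have -> : Num.max 0 (x - 1) = x - 1 by rewrite max_r; lra.
lra.
Qed.

Lemma tent_out x : ~~ (0 < x < 1) -> tent x = 0.
Proof.
rewrite negb_and -!leNgt /tent => /orP[] x0.
  by rewrite !max_l; lra.
by rewrite !max_r; lra.
Qed.

Lemma smoothstep_bound x : 0 <= smoothstep x <= 1.
Proof.
rewrite /smoothstep /sqpos.
have [] := leP x 0; have [] := leP (x - 2^-1) 0; have [] := leP (x - 1) 0 => *; apply/andP;
    split; nra.
Qed.

End smoothstep.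

(** * The du Bois-Reymond lemma *)
Section du_bois_reymond.
Context {R : realType}.
Local Notation lam := (@lebesgue_measure R).

Let step (a e t : R) : R := smoothstep ((t - a) / e).
Let bump (a e t : R) : R := e^-1 * tent ((t - a) / e).

Let is_derive_step a e t : is_derive t (1 : R) (step a e) (bump a e t).
Proof.
have H : is_derive t (1 : R) (fun t : R => (t - a) / e) e^-1.
  apply: (is_derive_eq (is_deriveM (is_deriveB (is_derive_id t (1:R)) (is_derive_cst a t
      (1:R))) (is_derive_cst e^-1 t (1:R)))).
  by rewrite /GRing.scale/= subr0 mulr1 mulr0 add0r.
have -> : step a e = smoothstep \o (fun t : R => (t - a) / e) by [].
apply: (is_derive_eq (@is_derive1_comp _ smoothstep (fun t : R =>
    (t - a) / e) _ _ _ (is_derive_smoothstep ((t - a) / e)) H)).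
by rewrite mulrC.
Qed.

Let bump_continuous a e : continuous (bump a e).
Proof.
move=> t; apply: cvgM; first exact: cvg_cst.
apply: (@continuous_comp _ _ _ (fun t : R => (t - a) / e) tent); last exact: tent_continuous.
by apply: cvgM; [apply: cvgB; [exact: cvg_id|exact: cvg_cst]|exact: cvg_cst].
Qed.

Let bump_ge0 a e t : 0 < e -> 0 <= bump a e t.
Proof. by move=> e0; rewrite mulr_ge0 ?tent_ge0// invr_ge0 ltW. Qed.

Let bump_out a e t : 0 < e -> ~~ (a <= t <= a + e) -> bump a e t = 0.
Proof.
move=> e0 ta; rewrite /bump tent_out ?mulr0//; apply: contra ta => /andP[].
by rewrite pmulr_lgt0 ?invr_gt0// subr_gt0 ltr_pdivrMr// mul1r ltrBlDl => /ltW-> /ltW.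
Qed.

Let integral_bump a e : 0 < e -> (\int[lam]_(t in `[a, (a + e)%R]) (bump a e t)%:E = 1)%E.
Proof.
move=> e0; have s0 : step a e a = 0 by rewrite /step subrr mul0r smoothstep_le0.
have s1 : step a e (a + e) = 1.
  by rewrite /step addrAC subrr add0r mulfV ?gt_eqF// smoothstep_ge1.
rewrite (@continuous_FTC2 _ (bump a e) (step a e)).
- by rewrite s0 s1 sube0.
- by rewrite ltrDl.
- by apply: continuous_subspaceT; exact: bump_continuous.
- have dS t : derivable (step a e) t 1 by have [] := is_derive_step a e t.
  have cS : continuous (step a e).
    by move=> t; apply: differentiable_continuous; apply/derivable1_diffP.
  by split => //; [apply: cvg_at_right_filter; exact: cS|apply: cvg_at_left_filter; exact: cS].
- by move=> t _; rewrite derive1E; have [] := is_derive_step a e t.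
Qed.

Variables (T : R) (U W : R -> R).
Hypotheses (cU : forall t, 0 < t < T -> {for t, continuous U})
  (iW : lam.-integrable `]0, T[ (EFin \o W))
  (weak : forall phi, is_C1c T phi ->
    \int[lam]_(t in `]0, T[) (derive1 phi t * U t) = - \int[lam]_(t in `]0, T[) (phi t * W t)).

Let average_int a e : 0 < a -> 0 < e -> a + e < T ->
  lam.-integrable `[a, (a + e)] (EFin \o (fun t => bump a e t * U t)) /\
  lam.-integrable `]0, T[ (EFin \o (fun t => bump a e t * U t)) /\
  \int[lam]_(t in `]0, T[) (bump a e t * U t) = \int[lam]_(t in `[a, (a + e)]) (bump a e t * U t).
Proof.
move=> a0 e0 aT.
have i1 : lam.-integrable `[a, (a + e)] (EFin \o (fun t => bump a e t * U t)).
  apply: continuous_compact_integrable; first exact: segment_compact.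
  apply: continuous_in_subspaceT => t; rewrite inE/= in_itv/= => /andP[at_ tae].
  apply: cvgM; first exact: bump_continuous.
  by apply: cU; rewrite (lt_le_trans a0)//= (le_lt_trans tae).
have E : (fun t => bump a e t * U t) \_ `]0, T[ = (fun t => bump a e t * U t) \_ `[a, (a + e)].
  apply/funext => t; rewrite !patchE !mem_setE !in_itv/=.
  have [/andP[at_ tae]|] := boolP (a <= t <= a + e).
    by rewrite (lt_le_trans a0)//= (le_lt_trans tae).
  by move=> /(bump_out e0) ->; rewrite mul0r; case: ifP.
split => //; split; last by rewrite Rintegral_mkcond E -Rintegral_mkcond.
have m1 : measurable (`]0, T[%classic : set (measurableTypeR R)) by [].
have m2 : measurable (`[a, (a + e)%R]%classic : set (measurableTypeR R)) by [].
apply/(integrable_mkcond _ m1); rewrite restrict_EFin E -restrict_EFin.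
exact/(integrable_mkcond _ m2).
Qed.

Let average a (eta : R) : 0 < a < T -> 0 < eta -> exists2 e0, 0 < e0 &
  forall e, 0 < e <= e0 -> a + e < T /\
  `|\int[lam]_(t in `]0, T[) (bump a e t * U t) - U a| <= eta.
Proof.
move=> /andP[a0 aT] eta0.
have : {for a, continuous U} by apply: cU; rewrite a0.
move=> /cvgrPdist_le /(_ _ eta0) /nbhs_ballP[r r0 rU].
exists (Num.min (r / 2) ((T - a) / 2)).
  by rewrite lt_min !divr_gt0// subr_gt0.
move=> e /andP[e0]; rewrite le_min => /andP[er eT].
have aeT : a + e < T by lra.
split => //; have [i1 [_ ->]] := average_int a0 e0 aeT.
have m2 : measurable (`[a, (a + e)%R]%classic : set (measurableTypeR R)) by [].
have ib : lam.-integrable `[a, (a + e)] (EFin \o bump a e).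
  apply: continuous_compact_integrable; first exact: segment_compact.
  by apply: continuous_subspaceT; exact: bump_continuous.
have Ib : \int[lam]_(t in `[a, (a + e)]) bump a e t = 1 by rewrite /Rintegral integral_bump.
have icb : lam.-integrable `[a, (a + e)] (EFin \o (fun t => bump a e t * U a)).
  have -> : EFin \o (fun t => bump a e t * U a) = (fun t => (EFin \o bump a e) t * (U a)%:E)%E.
    by apply/funext => t /=; rewrite -EFinM.
  exact: integrableZr.
have -> : U a = \int[lam]_(t in `[a, (a + e)]) (bump a e t * U a).
  by rewrite RintegralZr// Ib mul1r.
rewrite -RintegralB//.
have id : lam.-integrable `[a, (a + e)] (EFin \o (fun t => bump a e t * U t - bump a e t * U a)).
  exact: (integrableB m2 i1 icb).
apply: (le_trans (le_normr_Rintegral m2 id)).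
apply: (@le_trans _ _ (\int[lam]_(t in `[a, (a + e)]) (bump a e t * eta))); last first.
  by rewrite RintegralZr// Ib mul1r.
apply: le_Rintegral => //.
- exact: integrable_norm.
- have -> : EFin \o (fun t => bump a e t * eta) = (fun t => (EFin \o bump a e) t * eta%:E)%E.
    by apply/funext => t /=; rewrite -EFinM.
  exact: integrableZr.
move=> t /=; rewrite in_itv/= => /andP[at_ tae].
rewrite -mulrBr normrM ger0_norm ?bump_ge0// ler_wpM2l ?bump_ge0// distrC.
apply: rU => /=; rewrite /ball/= ler0_norm; lra.
Qed.

Let plateau a b e (t : R) := step a e t - step b e t.

Let plateau_derive a b e t : is_derive t (1 : R) (plateau a b e) (bump a e t - bump b e t).
Proof. exact: is_deriveB (is_derive_step a e t) (is_derive_step b e t). Qed.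

Let plateauE a b e : derive1 (plateau a b e) = (fun t => bump a e t - bump b e t).
Proof. by apply/funext => t; rewrite derive1E; have [] := plateau_derive a b e t. Qed.

Let plateau_C1c a b e : 0 < a -> a < b -> 0 < e -> b + e < T -> is_C1c T (plateau a b e).
Proof.
move=> a0 ab e0 beT; split.
- by move=> t; have [] := plateau_derive a b e t.
- by rewrite plateauE => t; apply: cvgB; exact: bump_continuous.
- exists a, (b + e); split => // t; apply: contraR; rewrite negb_and -!ltNge => /orP[ta|tb].
    rewrite /plateau /step !smoothstep_le0 ?subrr//.
      by rewrite pmulr_lle0 ?invr_gt0//; lra.
    by rewrite pmulr_lle0 ?invr_gt0//; lra.
  rewrite /plateau /step !smoothstep_ge1 ?subrr//.
    by rewrite ler_pdivlMr//; lra.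
  by rewrite ler_pdivlMr//; lra.
Qed.

Let plateau_cvg a b t (e : nat -> R) : (forall n, 0 < e n) -> e n @[n --> \oo] --> (0 : R) ->
    a < b ->
  plateau a b (e n) t @[n --> \oo] --> (\1_(`]a, b]%classic) t : R).
Proof.
move=> e0 e_cvg ab.
have S c : step c (e n) t @[n --> \oo] --> (\1_(`]c, +oo[%classic) t : R).
  rewrite indicE mem_setE in_itv/= andbT; have [ct|tc] := ltP c t.
    apply: cvg_near_cst.
    have tc0 : 0 < t - c by rewrite subr_gt0.
    have /cvgrPdist_le /(_ _ tc0) := e_cvg; apply: filterS => n /=.
    rewrite sub0r normrN gtr0_norm// => en; rewrite /step smoothstep_ge1//.
    by rewrite ler_pdivlMr// mul1r.
  apply: cvg_near_cst; apply: nearW => n; rewrite /step smoothstep_le0//.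
  by rewrite pmulr_lle0 ?invr_gt0// subr_le0.
have E : \1_(`]a, b]%classic) t = \1_(`]a, +oo[%classic) t - \1_(`]b, +oo[%classic) t :> R.
  rewrite !indicE !mem_setE !in_itv/= ?andbT.
  rewrite [t <= b]leNgt; have [at_|ta] := ltP a t; have [bt|tb] := ltP b t;
      rewrite /= ?mulr0n ?mulr1n ?subrr ?subr0//.
  by move: (lt_le_trans bt ta); rewrite ltNge (ltW ab).
by rewrite E; apply: cvgB; exact: S.
Qed.

(** The test functions rise smoothly from 0 to 1 right after [a] and fall back right
    after [b]. Their derivatives are approximate identities at [a] and [b], and they
    converge boundedly to the indicator of ]a, b]. *)
Lemma du_bois_reymond a b : 0 < a -> a < b -> b < T ->
  U b - U a = \int[lam]_(t in `]a, b[) W t.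
Proof.
move=> a0 ab bT.
have mT : measurable (`]0, T[%classic : set (measurableTypeR R)) by [].
pose L := \int[lam]_(t in `]a, b[) W t.
apply/eqP; rewrite -subr_eq0 -normr_le0 -/L; apply/ler_addgt0Pl => eta eta0; rewrite addr0.
have eta4 : 0 < eta / 4 by rewrite divr_gt0.
have [ea ea0 Ha] := @average a (eta / 4) (introT andP (conj a0 (lt_trans ab bT))) eta4.
have [eb eb0 Hb] := @average b (eta / 4) (introT andP (conj (lt_trans a0 ab) bT)) eta4.
pose e0 := Num.min ea eb.
have e00 : 0 < e0 by rewrite lt_min ea0.
(* Widths of the transition layers of the test functions. *)
pose e (n : nat) := e0 * n.+1%:R^-1.
have e_gt0 n : 0 < e n by rewrite mulr_gt0// invr_gt0.
have e_cvg : e n @[n --> \oo] --> (0 : R).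
  by rewrite -[X in _ --> X](mulr0 e0); apply: cvgM; [exact: cvg_cst|exact: cvg_harmonic].
have e_le n : e n <= e0.
  by rewrite ler_piMr ?(ltW e00)// invf_le1// ler1n.
have mW : measurable_fun (`]0, T[%classic : set (measurableTypeR R)) W by have
    /measurable_int/measurable_EFinP := iW.
have mp n : measurable_fun (`]0, T[%classic : set (measurableTypeR R)) (fun t =>
    plateau a b (e n) t * W t).
  apply: measurable_funM => //; apply: measurable_funTS.
  apply: continuous_measurable_fun => t.
  by apply: differentiable_continuous; apply/derivable1_diffP;
      have [] := plateau_derive a b (e n) t.
have IL : \int[lam]_(t in `]0, T[) (\1_(`]a, b]%classic) t * W t) = L.
  have -> : L = \int[lam]_(t in `]a, b]) W t.
    rewrite /L Rintegral_itv_bndo_bndc//.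
    apply: integrableS iW => //.
    by move=> t /=; rewrite !in_itv/= => /andP[at_ tb]; rewrite (lt_trans a0)//= (lt_trans tb).
  rewrite Rintegral_mkcond [RHS]Rintegral_mkcond; apply: eq_Rintegral => t _.
  rewrite !patchE !mem_setE !in_itv/= indicE mem_setE in_itv/=.
  have [/andP[at_ tb]|] := boolP (a < t <= b).
    by rewrite (lt_trans a0)//= (le_lt_trans tb)// mul1r.
  by rewrite mul0r; case: ifP.
have dct : \int[lam]_(t in `]0, T[) (plateau a b (e n) t * W t) @[n --> \oo] --> L.
  rewrite -IL.
  have ae1 : {ae lam, forall t, `]0, T[%classic t ->
      (plateau a b (e n) t * W t)%:E @[n --> \oo] --> (\1_(`]a, b]%classic) t * W t)%:E}.
    apply: aeW => t _; apply/cvg_EFin; first exact: nearW.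
    by apply: cvgM; [exact: plateau_cvg|exact: cvg_cst].
  have ae2 : {ae lam, forall t n, `]0, T[%classic t ->
      (`|(plateau a b (e n) t * W t)%:E| <= `|(W t)%:E|)%E}.
    apply: aeW => t n _; rewrite lee_fin normrM ler_piMl//.
    rewrite /plateau /step; have /andP[? ?] := smoothstep_bound ((t - a) / e n).
    have /andP[? ?] := smoothstep_bound ((t - b) / e n).
    by rewrite ler_norml; apply/andP; split; lra.
  have m1 n : measurable_fun (`]0, T[%classic : set (measurableTypeR R)) (fun t =>
      (plateau a b (e n) t * W t)%:E).
    exact/measurable_EFinP.
  have m2 : measurable_fun (`]0, T[%classic : set (measurableTypeR R)) (fun t =>
      (\1_(`]a, b]%classic) t * W t)%:E).
    by apply/measurable_EFinP; apply: measurable_funM.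
  have DC := dominated_convergence mT m1 m2 ae1 (integrable_abse iW) ae2.
  case: DC => i1 _ cv.
  apply: fine_cvg; rewrite fineK; first exact: cv.
  exact: (integrable_fin_num mT i1).
have /cvgrPdist_le /(_ _ eta4) [n _ /(_ n (leqnn n)) /= Hn] := dct.
have en : 0 < e n <= e0 by rewrite e_gt0 e_le.
have ena : 0 < e n <= ea by rewrite e_gt0 (le_trans (e_le n))// ge_min lexx.
have enb : 0 < e n <= eb by rewrite e_gt0 (le_trans (e_le n))// ge_min lexx orbT.
have [aT Han] := Ha _ ena; have [beT Hbn] := Hb _ enb.
have := weak (plateau_C1c a0 ab (e_gt0 n) beT).
rewrite plateauE.
have [_ [ia _]] := average_int a0 (e_gt0 n) aT.
have [_ [ib _]] := average_int (lt_trans a0 ab) (e_gt0 n) beT.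
have -> : \int[lam]_(t in `]0, T[) ((bump a (e n) t - bump b (e n) t) * U t) =
   \int[lam]_(t in `]0, T[) (bump a (e n) t * U t) - \int[lam]_(t in `]0,
       T[) (bump b (e n) t * U t).
  by rewrite -RintegralB//; apply: eq_Rintegral => t _; rewrite mulrBl.
move: Han Hbn Hn.
set A := Rintegral _ _ _; set A' := Rintegral _ _ _; set P := Rintegral _ _ _.
rewrite !ler_norml => /andP[? ?] /andP[? ?] /andP[? ?] ?.
by apply/andP; split; lra.
Qed.

End du_bois_reymond.

(** * Boxes, open sets and essential supports *)
Section countable_base.
Context {R : realType} {d : nat}.
Local Notation mu := (@lebesgue_rV R d).

Lemma measurable_rect (I : 'I_d -> interval R) :
  measurable [set x : 'rV[R]_d | forall i, x ord0 i \in I i].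
Proof.
rewrite (_ : [set x | _] = \bigcap_(i in [set: 'I_d]) (rV_coord i @^-1` [set` I i])).
  apply: fin_bigcap_measurable => // i _; rewrite -[X in measurable X]setTI.
  by apply: measurable_rV_coord => //; exact: measurable_itv.
by apply/seteqP; split=> x xI i; have := xI i; [|exact].
Qed.

Let box (k : 'rV[rat]_d * nat) : set 'rV[R]_d :=
  [set x | forall i, x ord0 i \in
    `]ratr (k.1 ord0 i) - k.2.+1%:R^-1, ratr (k.1 ord0 i) + k.2.+1%:R^-1[].

Let box_base (U : set 'rV[R]_d) x : open U -> U x -> exists2 k, box k x & box k `<=` U.
Proof.
move=> oU Ux; have /nbhs_ballP[e /= e0 xU] := open_nbhs_nbhs (conj oU Ux).
have [n ne] : exists n : nat, n.+1%:R^-1 < e / 2.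
  have e2 : 0 < e / 2 by rewrite divr_gt0.
  exists (Num.truncn (e / 2)^-1).
  by rewrite invf_plt ?posrE ?ltr0n// truncnS_gt.
have n0 : 0 < n.+1%:R^-1 :> R by rewrite invr_gt0 ltr0n.
have /choice[q qE] : forall i, exists q : rat,
    x ord0 i \in `]ratr q - n.+1%:R^-1, ratr q + n.+1%:R^-1[.
  move=> i; have : x ord0 i - n.+1%:R^-1 < x ord0 i +
      n.+1%:R^-1 by by rewrite ltrBlDr -addrA ltrDl addr_gt0.
  move=> /rat_in_itvoo[q]; rewrite in_itv/= => /andP[q1 q2].
  by exists q; rewrite in_itv/= ltrBlDr q2 -ltrBlDr q1.
exists (\row_i q i, n).
  by move=> i /=; rewrite mxE; exact: qE.
move=> y yk; apply: xU; split => //= i j; rewrite (ord1 i) /ball/=.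
have := yk j; rewrite /= mxE; have := qE j.
rewrite !in_itv/= ltr_norml.
have aux (X Y Q r : R) : r < e / 2 -> Q - r < X < Q + r -> Q - r < Y < Q + r -> - e < X - Y < e.
  by move=> ? /andP[? ?] /andP[? ?]; apply/andP; split; lra.
exact: aux ne.
Qed.

(** Boxes with rational centres and radii 1/(n+1) form a countable base. *)
Lemma open_measurable_rV (U : set 'rV[R]_d) : open U -> measurable U.
Proof.
move=> oU; rewrite (_ : U = \bigcup_(k in [set k | box k `<=` U]) box k).
  rewrite bigcup_mkcond; apply: countable_bigcupT_measurable => // k.
  by case: ifP => // _; exact: measurable_rect.
apply/seteqP; split => [x Ux|x [k kU kx]]; last exact: kU.
by have [k kx kU] := box_base oU Ux; exists k.
Qed.

(** The complement of the essential support is a union of open sets on which [u]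
    vanishes almost everywhere. Boxes of the countable base replace them, so that
    only countably many null sets are united. *)
Lemma ess_supp_ae (u : 'rV[R]_d -> R) :
  {ae mu, forall x, ~ ess_supp u x -> u x = 0}.
Proof.
pose P (n : nat) (x : 'rV[R]_d) := if unpickle n is Some k then
  {ae mu, forall x, box k x -> u x = 0} -> box k x -> u x = 0 else True.
have H : forall n, {ae mu, forall x, P n x}.
  move=> n; rewrite /P; case: unpickle => [k|]; last exact: aeW.
  have [aek|naek] := pselect {ae mu, forall x, box k x -> u x = 0}.
    by apply: ae_imply aek => x + _.
  by apply: aeW => x /naek.
move/ae_foralln: H; apply: ae_imply => x Px nx.
have [U [[oU aeU] Ux]] : exists U, (open U /\ {ae mu, forall x, U x -> u x = 0}) /\ U x.
  apply: contrapT => nU; apply: nx => -[U [oU aeU] Ux]; apply: nU; exists U; split => //.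
have [k kx kU] := box_base oU Ux.
have := Px (pickle k); rewrite /P pickleK; apply => //.
by apply: ae_imply aeU => y uy /kU.
Qed.

End countable_base.

Section far_box.
Context {R : realType}.

Definition unit_box (a : R) d : set 'rV[R]_d := [set y | forall i, a < y ord0 i < a + 1].
Arguments unit_box : clear implicits.

Lemma measurable_unit_box a d : measurable (unit_box a d).
Proof.
rewrite (_ : unit_box a d = [set y | forall i, y ord0 i \in `]a, a + 1[]).
  exact: measurable_rect.
by apply/seteqP; split => y H i; have := H i; rewrite in_itv.
Qed.

Lemma lebesgue_unit_box a d : @lebesgue_rV R d (unit_box a d) = 1%E.
Proof.
elim: d => [|d IH].
  by rewrite /= diracE mem_set// => -[].
rewrite /=/lebesgue_rV_step /pushforward.
rewrite (_ : _ @^-1` _ = `]a, (a + 1)[%classic `*` unit_box a d).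
  rewrite product_measure1E ?IH//; last exact: measurable_unit_box.
  rewrite mule1; have : lebesgue_measure (`]a, (a + 1)[%classic : set R) = 1%E.
    by rewrite lebesgue_measure_itv/= lte_fin ltrDl ltr01 -EFinB addrAC subrr add0r.
  exact.
apply/seteqP; split => -[t y] /=.
- move=> H; split; first by have := H ord0; rewrite rV_cons0 in_itv.
  by move=> i; have := H (rshift 1 i); rewrite rV_consS.
- rewrite in_itv/= => -[ta ya] i.
  have [j ->|j ->] := @split_ordP 1 d i.
    by rewrite (_ : lshift d j = ord0) ?rV_cons0//; apply/val_inj; rewrite /= ord1.
  by rewrite rV_consS; exact: ya.
Qed.

End far_box.
Arguments unit_box {R} a d _.

(** * Power integrals and positivity of the Gamma function *)
Section powR_integral.
Context {R : realType}.
Local Notation lam := (@lebesgue_measure R).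
Implicit Types z h : R.

Lemma continuous_powR z (x : R) : 0 < x -> {for x, continuous (fun t : R => t `^ z)}.
Proof.
move=> x0; apply: differentiable_continuous; apply/derivable1_diffP.
by apply: derivable_powR; rewrite in_itv/= andbT.
Qed.

Lemma integral_powR_itv_cc z (a h : R) : 0 < z -> 0 < a -> a < h ->
  (\int[lam]_(x in `[a, h]) (x `^ (z - 1))%:E = (h `^ z / z - a `^ z / z)%:E)%E.
Proof.
move=> z0 a0 ah; have dF (x : R) : 0 < x ->
    is_derive x 1 (fun t : R => t `^ z / z) (x `^ (z - 1)).
  move=> x0; apply: is_derive_eq (is_deriveM (is_derive1_powR z x0) (is_derive_cst z^-1 x 1)) _.
  by rewrite scaler0 add0r /GRing.scale/= mulrA mulVf ?mul1r ?gt_eqF.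
rewrite EFinB.
apply: (@continuous_FTC2 _ (fun x : R => x `^ (z - 1)) (fun x : R => x `^ z / z)) => //.
- apply: continuous_in_subspaceT => x; rewrite inE/= in_itv/= => /andP[ax _].
  by apply: continuous_powR; rewrite (lt_le_trans a0).
- have cF (x : R) : 0 < x -> {for x, continuous (fun t : R => t `^ z / z)}.
    move=> x0; apply: differentiable_continuous; apply/derivable1_diffP.
    by have := dF _ x0 => -[].
  split.
  + move=> x; rewrite in_itv/= => /andP[ax _].
    by have := dF _ (lt_trans a0 ax) => -[].
  + by apply: cvg_at_right_filter; exact: cF.
  + by apply: cvg_at_left_filter; apply: cF; exact: lt_trans ah.
- move=> x; rewrite in_itv/= => /andP[ax _].
  by rewrite derive1E; have := dF _ (lt_trans a0 ax) => -[].
Qed.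

(** Fundamental theorem of calculus on [h/(n+2), h] and monotone convergence. *)
Lemma integral_powR_near0 z h : 0 < z -> 0 < h ->
  (\int[lam]_(x in `]0%R, h]) (x `^ (z - 1))%:E <= (h `^ z / z)%:E)%E.
Proof.
move=> z0 h0.
pose F (n : nat) : set R := `[h / n.+2%:R, h]%classic.
have FE : `]0, h]%classic = \bigcup_n F n.
  apply/seteqP; split => x /=; rewrite in_itv/=.
    move=> /andP[x0 xh]; exists (Num.truncn (h / x)) => //; rewrite /F/= in_itv/= xh andbT.
    rewrite ler_pdivrMr// mulrC -ler_pdivrMr// (le_trans (ltW (truncnS_gt _)))//.
    by rewrite ler_nat.
  move=> [n _]; rewrite /F/= in_itv/= => /andP[nx ->]; rewrite andbT.
  by rewrite (lt_le_trans _ nx)// divr_gt0.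
rewrite FE.
have : (\int[lam]_(x in F i) (x `^ (z - 1))%:E @[i --> \oo] --> \int[lam]_(x in \bigcup_i F
    i) (x `^ (z - 1))%:E)%E.
  apply: ge0_nondecreasing_set_cvg_integral => //.
  - move=> m n mn; rewrite subsetEset => x; rewrite /F/= !in_itv/= => /andP[mx ->].
    rewrite andbT (le_trans _ mx)// ler_pM2l// lef_pV2 ?posrE ?ltr0n//.
    by rewrite ler_nat ltnS.
  - by move=> i; exact: measurable_itv.
  - by move=> i; apply: measurable_funTS; apply/measurable_EFinP; exact: measurable_powR.
  - by move=> i x _; rewrite lee_fin powR_ge0.
move=> /cvg_lim <-//; apply: lime_le.
  apply: ereal_nondecreasing_is_cvgn.
  apply: ge0_nondecreasing_set_nondecreasing_integral => //.
  - move=> m n mn; rewrite subsetEset => x; rewrite /F/= !in_itv/= => /andP[mx ->].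
    rewrite andbT (le_trans _ mx)// ler_pM2l// lef_pV2 ?posrE ?ltr0n//.
    by rewrite ler_nat ltnS.
  - by move=> i; exact: measurable_itv.
  - by move=> i; apply: measurable_funTS; apply/measurable_EFinP; exact: measurable_powR.
  - by move=> i x _; rewrite lee_fin powR_ge0.
apply: nearW => n; rewrite integral_powR_itv_cc// ?divr_gt0//.
  by rewrite lee_fin gerBl divr_ge0 ?powR_ge0// ltW.
by rewrite ltr_pdivrMr// ltr_pMr// ltr1n.
Qed.

End powR_integral.

Section Gamma_gt0.
Context {R : realType}.
Local Notation lam := (@lebesgue_measure R).

(** Half of the exponential absorbs the power, by the exponential series. *)
Lemma pow_exp_bound n (t : R) : 0 <= t ->
  t ^+ n.+1 * expR (- t) <= 2 ^+ n.+1 * n.+1`!%:R * expR (- (t / 2)).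
Proof.
move=> t0; have t20 : 0 <= t / 2 by rewrite divr_ge0.
have := expR_ge1Dxn n t20.
move=> /(le_trans _) => /(_ ((t / 2) ^+ n.+1 / n.+1`!%:R)).
rewrite lerDr ler01 => /(_ isT).
rewrite ler_pdivrMr ?ltr0n ?fact_gt0// exprMn => H.
have -> : expR (- t) = expR (- (t / 2)) * expR (- (t / 2)).
  by rewrite -expRD -opprD -splitr.
rewrite mulrA ler_wpM2r ?expR_ge0//.
rewrite expRN ler_pdivrMr ?expR_gt0//.
move: H; rewrite exprVn ler_pdivrMr ?exprn_gt0//.
move=> /le_trans; apply; rewrite le_eqVlt; apply/orP; left; apply/eqP; ring.
Qed.

(** The definition takes the finite part of an extended-real integral, which would be 0
    if the integral were infinite. Near 0 the integrand is below an integrable power,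
    and on [1, +oo[ below a multiple of an exponential density. *)
Lemma Gamma_gt0 (z : R) : 0 < z -> 0 < Gamma z.
Proof.
move=> z0.
pose f (t : R) := t `^ (z - 1) * expR (- t).
have mf : measurable_fun setT f.
  apply: measurable_funM; first exact: measurable_powR.
  by apply: measurableT_comp => //; exact: measurable_oppr.
have mEf : measurable_fun setT (EFin \o f) by exact/measurable_EFinP.
have f0 t : 0 <= f t by rewrite mulr_ge0 ?powR_ge0 ?expR_ge0.
rewrite (_ : Gamma z = fine (\int[lam]_(t in `]0%R, +oo[) (f t)%:E)%E)//.
apply: fine_gt0; apply/andP; split.
  rewrite lt_neqAle; apply/andP; split; last first.
    by apply: integral_ge0 => t _; rewrite lee_fin; exact: f0.
  apply/eqP => I0.
  have : ae_eq lam (`]0, +oo[%classic : set (measurableTypeR R)) (EFin \o f) (cst 0%E).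
    apply/ae_eq_integral_abs => //; first exact: measurable_funTS.
    by rewrite [RHS]I0; apply: eq_integral => t _; rewrite gee0_abs// lee_fin.
  move=> [N [mN N0 sub]].
  have : (lam `]0%R, +oo[%classic <= 0)%E.
    rewrite -N0; apply: le_measure; rewrite ?inE//.
    move=> t /= t0; apply: sub => /= /(_ t0)[] /eqP.
    rewrite mulf_eq0 powR_eq0 => /orP[/andP[/eqP t00 _]|/eqP].
      by move: t0; rewrite in_itv/= t00 ltxx.
    by move/eqP; rewrite gt_eqF// expR_gt0.
  by rewrite lebesgue_measure_itv/= ltry.
have [n zn] : exists n : nat, z - 1 <= n.+1%:R.
  exists (Num.truncn (z - 1)); exact/ltW/truncnS_gt.
have spl : (`]0, +oo[%classic : set (measurableTypeR R)) = `]0, 1]%classic `|` `]1, +oo[%classic.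
  by rewrite -itv_bndbnd_setU// bnd_simp.
rewrite [X in integral _ X]spl ge0_integral_setU//; last 3 first.
- exact: measurable_funTS.
- by move=> t _; rewrite lee_fin.
- apply/disj_setPS => x/= []; rewrite !in_itv/= andbT => /andP[_ x1].
  by rewrite ltNge x1.
apply: lte_add_pinfty.
  apply: (@le_lt_trans _ _ (1 `^ z / z)%:E); last by rewrite ltry.
  apply: le_trans (integral_powR_near0 z0 ltr01).
  apply: ge0_le_integral => //.
  - by move=> t _; rewrite lee_fin.
  - exact: measurable_funTS.
  - by apply/measurable_funTS/measurable_EFinP; exact: measurable_powR.
  - move=> t /=; rewrite in_itv/= => /andP[t0 _]; rewrite lee_fin ler_piMr ?powR_ge0//.
    by rewrite expR_le1 oppr_le0 ltW.
pose C : R := 2 ^+ n.+1 * n.+1`!%:R * 2.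
have C0 : 0 <= C by rewrite !mulr_ge0// exprn_ge0.
have ptw (t : R) : 1 < t -> f t <= C * exponential_pdf 2^-1 t.
  move=> t1; have t0 : 0 < t by exact: lt_trans t1.
  rewrite (exponential_pdfE _ (ltW t0)).
  apply: (@le_trans _ _ (t ^+ n.+1 * expR (- t))).
    by rewrite ler_wpM2r ?expR_ge0// -(powR_mulrn _ (ltW t0)) ler_powR ?(ltW t1).
  apply: (le_trans (pow_exp_bound n (ltW t0))).
  rewrite /C -!mulrA; do 2 rewrite ler_wpM2l//.
  by rewrite mulrA mulfV// mul1r mulNr mulrC.
have le1 : (\int[lam]_(t in `]1%R, +oo[) (f t)%:E <=
    \int[lam]_(t in `]1%R, +oo[) (C%:E * (exponential_pdf 2^-1 t)%:E))%E.
  apply: ge0_le_integral => //.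
  - by move=> t _; rewrite lee_fin.
  - exact: measurable_funTS.
  - apply: measurable_funTS; apply: measurable_funeM; apply/measurable_EFinP;
      exact: measurable_exponential_pdf.
  - by move=> t /=; rewrite in_itv/= andbT => t1; rewrite -EFinM lee_fin; exact: ptw.
apply: (le_lt_trans le1).
rewrite ge0_integralZl_EFin//; last 2 first.
- by move=> t _; rewrite lee_fin exponential_pdf_ge0.
- by apply/measurable_funTS/measurable_EFinP; exact: measurable_exponential_pdf.
apply: (@le_lt_trans _ _ (C%:E * 1)%E); last by rewrite mule1 ltry.
apply: lee_wpmul2l; first by rewrite lee_fin.
rewrite -(@integral_exponential_pdf R 2^-1); last by rewrite invr_gt0.
apply: ge0_subset_integral => //.
- by apply/measurable_EFinP; exact: measurable_exponential_pdf.
- by move=> t _; rewrite lee_fin exponential_pdf_ge0.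
Qed.

End Gamma_gt0.

(** * Gagliardo energies *)
Section gagliardo.
Context {R : realType} {d : nat}.
Local Notation mu := (@lebesgue_rV R d).
Local Notation V := 'rV[R]_d.
Implicit Types (s : R) (Omega : set V) (u v : V -> R).

Lemma measurable_enorm_sub : measurable_fun setT (fun z : V * V => enorm (z.1 - z.2)).
Proof.
apply: (measurableT_comp (continuous_measurable_fun (@sqrt_continuous R))).
apply: measurable_sum => i.
have H : measurable_fun setT (fun z : V * V => z.1 ord0 i - z.2 ord0 i).
  apply: measurable_funB.
    exact: (measurableT_comp (measurable_rV_coord i) measurable_fst).
  exact: (measurableT_comp (measurable_rV_coord i) measurable_snd).
rewrite (_ : (fun z => _) = (fun z : V * V =>
    (z.1 ord0 i - z.2 ord0 i) * (z.1 ord0 i - z.2 ord0 i))).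
  exact: measurable_funM.
by apply/funext => z; rewrite !mxE.
Qed.

Lemma measurable_gagliardo s u v : measurable_fun setT u -> measurable_fun setT v ->
  measurable_fun setT (gagliardo_integrand s u v).
Proof.
move=> mu_ mv; apply: measurable_funM; first apply: measurable_funM.
- by apply: measurable_funB; [exact: (measurableT_comp mu_ measurable_fst)|exact:
    (measurableT_comp mu_ measurable_snd)].
- by apply: measurable_funB; [exact: (measurableT_comp mv measurable_fst)|exact:
    (measurableT_comp mv measurable_snd)].
rewrite (_ : (fun z => _) = (fun z : V * V => enorm (z.1 - z.2) `^ (- (d%:R + 2 * s)))).
  exact: (measurableT_comp (measurable_powR _) measurable_enorm_sub).
by apply/funext => z; rewrite powRN.
Qed.

Lemma gagliardo_ge0 s u z : 0 <= gagliardo_integrand s u u z.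
Proof. by rewrite divr_ge0 ?powR_ge0// -expr2 sqr_ge0. Qed.

Lemma is_Hs_comp s (p : R -> R) u : measurable_fun setT p -> p 0 = 0 ->
  (forall x y, `|p x - p y| <= `|x - y|) -> is_Hs s u -> is_Hs s (p \o u).
Proof.
move=> mp p0 plip [uL uH]; have mu_ := L2_measurable uL.
have mpu : measurable_fun setT (p \o u) by exact: measurableT_comp.
split.
  apply: (L2_le mpu uL) => x /=; have := plip (u x) 0.
  by rewrite p0 !subr0.
apply: le_lt_trans uH; apply: ge0_le_integral => //.
- by move=> z _; rewrite lee_fin gagliardo_ge0.
- by apply/measurable_EFinP; exact: measurable_gagliardo.
- by apply/measurable_EFinP; exact: measurable_gagliardo.
move=> z _; rewrite lee_fin ler_wpM2r ?invr_ge0 ?powR_ge0// -!expr2.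
rewrite -[leLHS]real_normK ?num_real// -[leRHS]real_normK ?num_real//.
by rewrite lerXn2r ?nnegrE// plip.
Qed.

(** From [(a - b)^2 <= 2 a^2 + 2 b^2]. *)
Lemma is_HsB s u v : is_Hs s u -> is_Hs s v -> is_Hs s (u \- v).
Proof.
move=> [uL uH] [vL vH]; split; first exact: L2B.
have mu_ := L2_measurable uL; have mv := L2_measurable vL.
have mg u' v' : measurable_fun setT u' -> measurable_fun setT v' ->
    measurable_fun setT (fun z => (gagliardo_integrand s u' v' z)%:E).
  by move=> ? ?; apply/measurable_EFinP; exact: measurable_gagliardo.
apply: (@le_lt_trans _ _ (2%:E * \int[(mu \x mu)%E]_z (gagliardo_integrand s u u z)%:E +
   2%:E * \int[(mu \x mu)%E]_z (gagliardo_integrand s v v z)%:E)%E); last first.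
  by rewrite lte_add_pinfty// lte_mul_pinfty// lee_fin.
have g0 u' z : (0 <= (gagliardo_integrand s u' u' z)%:E)%E by rewrite lee_fin gagliardo_ge0.
rewrite -!ge0_integralZl_EFin//; try exact: mg.
rewrite -ge0_integralD//; try (by move=> z _; rewrite mule_ge0// lee_fin);
    try (by apply: measurable_funeM; exact: mg).
apply: ge0_le_integral => //.
- by apply: mg; exact: measurable_funB.
- by apply: emeasurable_funD; apply: measurable_funeM; exact: mg.
move=> z _; rewrite -!EFinM -EFinD lee_fin /gagliardo_integrand /= !mulrA -mulrDl.
rewrite ler_wpM2r ?invr_ge0 ?powR_ge0//.
have aux (a b c e : R) : (a - c - (b - e)) * (a - c - (b - e)) <= 2 * (a - b) * (a - b) +
    2 * (c - e) * (c - e).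
  by have := sqr_ge0 (a - b + (c - e)); nra.
exact: aux.
Qed.

(** The increments of [u] and [p o u] have the same sign, so the integrand is
    nonnegative. *)
Lemma Hs_inner_monotone_ge0 Omega s (p : R -> R) u : 0 <= Cds (d := d) s ->
  {homo p : x y / x <= y} -> 0 <= Hs_inner Omega s u (p \o u).
Proof.
move=> C0 pn; rewrite /Hs_inner; apply: mulr_ge0; first by rewrite divr_ge0.
apply: Rintegral_ge0 => z _; rewrite divr_ge0 ?powR_ge0//=.
have [xy|/ltW xy] := leP (u z.1) (u z.2).
  by rewrite mulr_le0// subr_le0// pn.
by rewrite mulr_ge0// subr_ge0// pn.
Qed.

Lemma ess_supp_comp (p : R -> R) u : p 0 = 0 -> ess_supp (p \o u) `<=` ess_supp u.
Proof.
move=> p0; apply: subsetC => x [U [oU aeU] Ux]; exists U => //; split => //.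
by apply: ae_imply aeU => y uy Uy; rewrite /= uy.
Qed.

Lemma is_tildeHs_comp Omega s (p : R -> R) u : measurable_fun setT p -> p 0 = 0 ->
  (forall x y, `|p x - p y| <= `|x - y|) -> is_tildeHs Omega s u -> is_tildeHs Omega s (p \o u).
Proof.
move=> mp p0 plip [uH us]; split; first exact: is_Hs_comp.
by apply: subset_trans us; exact: ess_supp_comp.
Qed.

End gagliardo.

(** * A fractional Poincare inequality *)
Section poincare.
Context {R : realType} {d : nat}.
Local Notation mu := (@lebesgue_rV R d).
Local Notation V := 'rV[R]_d.

Lemma Cds_gt0 (s : R) : 0 < s < 1 -> 0 < Cds (d := d) s.
Proof.
move=> /andP[s0 s1]; rewrite /Cds divr_gt0//.
  rewrite !mulr_gt0 ?powR_gt0//; apply: Gamma_gt0.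
  by rewrite ltr_wpDr// divr_ge0.
by rewrite mulr_gt0 ?powR_gt0 ?pi_gt0//; apply: Gamma_gt0; rewrite subr_gt0.
Qed.

Lemma coord_le_norm (x : V) i : `|x ord0 i| <= `|x|.
Proof.
rewrite [X in _ <= X](_ : _ = mx_norm x)// mx_normrE.
exact: (le_bigmax _ (fun ij : 'I_1 * 'I_d => `|x ij.1 ij.2|) (ord0, i)).
Qed.

Lemma bounded_coords (Omega : set V) : bounded_set Omega ->
  exists2 M : R, 0 <= M & forall x, closure Omega x -> forall i, `|x ord0 i| <= M.
Proof.
move=> [M0 [_ HM]]; pose M := Num.max 0 (M0 + 1).
have MM : M0 < M by rewrite /M lt_max ltrDl ltr01 orbT.
exists M; first by rewrite le_max lexx.
move=> x clx i; apply: le_trans (coord_le_norm x i) _.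
rewrite leNgt; apply/negP => xM.
have e0 : 0 < `|x| - M by rewrite subr_gt0.
have [y [Oy xy]] := clx _ (nbhsx_ballx x _ e0).
have yM := HM _ MM _ Oy; rewrite /= in yM.
move: xy; rewrite -ball_normE /= => xy.
have := ler_normD (x - y) y; rewrite subrK => xle.
lra.
Qed.

(** A box [Y] far from the bounded set is disjoint from its closure, so that [f]
    vanishes almost everywhere on it. For [x] in the set and [y] in [Y] the
    Gagliardo integrand is [f(x)^2] divided by a bounded power of the distance;
    integrating over [y] first bounds [f(x)^2] by the energy. *)
Lemma fractional_poincare (Omega : set V) (s : R) : (1 <= d)%N -> 0 < s < 1 ->
  open Omega -> bounded_set Omega -> exists2 C : R, 0 <= C &
  forall f, is_Hs s f -> {ae mu, forall x, ~ closure Omega x -> f x = 0} ->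
  f \_ Omega \in Lfun mu 2%:E /\
  L2ip mu (f \_ Omega) (f \_ Omega) <= C * Hs_inner Omega s f f.
Proof.
move=> hd hs oO bO; have [M M0 clM] := bounded_coords bO.
have mO := open_measurable_rV oO.
pose Y := unit_box (M + 1) d.
have mY : measurable Y by exact: measurable_unit_box.
have muY : mu Y = 1%E by exact: lebesgue_unit_box.
(* A bound for the distances between the two sets; adding 1 makes it positive. *)
pose K : R := Num.sqrt (\sum_(i < d) (2 * M + 2) ^+ 2) + 1.
pose p : R := d%:R + 2 * s.
have p0 : 0 <= p by rewrite addr_ge0// mulr_ge0//; have /andP[/ltW] := hs.
have aux (a b : R) : `|a| <= M -> M + 1 < b < M + 1 + 1 ->
    (a - b) ^+ 2 <= (2 * M + 2) ^+ 2 /\ 0 < (a - b) * (a - b).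
  rewrite ler_norml => /andP[a1 a2] /andP[b1 b2].
  have ab : 0 < b - a by lra.
  rewrite -[a - b]opprB sqrrN mulrNN mulr_gt0//; split => //.
  by rewrite lerXn2r ?nnegrE//; lra.
(* The coordinate of index 0, available because the dimension is positive,
    separates the two sets. *)
have dist x y : Omega x -> Y y -> 0 < enorm (x - y) <= K.
  move=> Ox Yy; have xM := clM _ (subset_closure Ox).
  have c i := aux _ _ (xM i) (Yy i).
  apply/andP; split.
    rewrite sqrtr_gt0 /dotv (bigD1 (Ordinal hd))//= ltr_wpDr//.
      by apply: sumr_ge0 => i _; rewrite -expr2 sqr_ge0.
    by rewrite !mxE; exact: (c _).2.
  rewrite /K ler_wpDr// ler_sqrt; last by apply: sumr_ge0 => i _; rewrite sqr_ge0.
  by apply: ler_sum => i _; rewrite !mxE -expr2; exact: (c i).1.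
have K0 : 0 < K by rewrite /K ltr_wpDl// sqrtr_ge0.
pose kap := (K `^ p)^-1.
have kap0 : 0 < kap by rewrite invr_gt0 powR_gt0.
have C0 := Cds_gt0 hs.
exists (kap^-1 / (Cds (d := d) s / 2)).
  by apply: divr_ge0; [rewrite invr_ge0 ltW|apply: divr_ge0 => //; exact: ltW].
move=> f [fL fH] fae; have mf := L2_measurable fL.
pose fO := f \_ Omega.
have mfO : measurable_fun setT fO by apply/(measurable_restrictT f mO); exact: measurable_funTS.
have fOL : fO \in Lfun mu 2%:E.
  apply: (L2_le mfO fL) => x; rewrite /fO patchE; case: ifP => // _.
  by rewrite normr0.
split => //.
pose D : set (V * V) := ~` (~` Omega `*` ~` Omega).
have mD : measurable D by apply: measurableC; apply: measurableX; exact: measurableC.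
pose g z := (gagliardo_integrand s f f z)%:E.
have mg : measurable_fun setT g by apply/measurable_EFinP; exact: measurable_gagliardo.
have g0 z : (0 <= g z)%E by rewrite lee_fin gagliardo_ge0.
have gD0 z : (0 <= (g \_ D) z)%E by rewrite patchE; case: ifP.
have mgD : measurable_fun setT (g \_ D).
  by apply/(measurable_restrictT g mD); exact: measurable_funTS.
have JE : (\int[(mu \x mu)%E]_(z in D) g z = \int[mu]_x \int[mu]_y (g \_ D) (x, y))%E.
  by rewrite integral_mkcond fubini_tonelli1.
have Jfin : (\int[(mu \x mu)%E]_(z in D) g z < +oo)%E.
  by apply: le_lt_trans fH; apply: ge0_subset_integral.
have Yae : {ae mu, forall y, Y y -> f y = 0}.
  apply: ae_imply fae => y fy Yy; apply: fy => /clM /(_ (Ordinal hd)).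
  by have := Yy (Ordinal hd); rewrite ler_norml => /andP[? ?] /andP[? ?]; lra.
have inner x : (((fO x) ^+ 2 * kap)%:E <= \int[mu]_y (g \_ D) (x, y))%E.
  pose c := (fO x) ^+ 2 * kap.
  have c0 : 0 <= c by rewrite mulr_ge0 ?sqr_ge0// ltW.
  have -> : (c%:E = \int[mu]_y (c * \1_Y y)%:E)%E.
    under eq_integral do rewrite EFinM.
    rewrite ge0_integralZl_EFin//; last by apply/measurable_EFinP; exact: measurable_indic.
    rewrite integral_indic// setIT -[LHS]mule1; congr (_ * _)%E.
    exact/esym.
  apply: ae_ge0_le_integral => //.
  - by move=> y _; rewrite lee_fin mulr_ge0.
  - by apply/measurable_EFinP; apply: measurable_funM => //; exact: measurable_indic.
  - by apply: (measurableT_comp mgD); exact: measurable_pair1.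
  apply: ae_imply Yae => y fy _; rewrite indicE.
  have [yY|] := boolP (y \in Y); last by rewrite mulr0.
  have Yy : Y y by rewrite inE in yY.
  rewrite mulr1 /c /fO patchE; have [xO|] := boolP (x \in Omega); last by rewrite expr0n/= mul0r.
  have Ox : Omega x by rewrite inE in xO.
  rewrite patchE mem_set; last by rewrite /D /= => -[].
  rewrite lee_fin /gagliardo_integrand /= (fy Yy) subr0 -expr2 ler_wpM2l ?sqr_ge0//.
  have /andP[e0 eK] := dist _ _ Ox Yy.
  rewrite /kap lef_pV2 ?posrE ?powR_gt0//.
  by apply: ge0_ler_powR => //; rewrite nnegrE ltW.
have main : (kap%:E * (L2ip mu fO fO)%:E <= \int[(mu \x mu)%E]_(z in D) g z)%E.
  rewrite L2ipE// JE -ge0_integralZl_EFin//; last 3 first.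
  - by move=> x _; rewrite lee_fin -expr2 sqr_ge0.
  - by apply/measurable_EFinP; exact: measurable_funM.
  - exact: ltW.
  apply: ge0_le_integral => //.
  - by move=> x _; rewrite mule_ge0// lee_fin ?(ltW kap0)// -expr2 sqr_ge0.
  - by apply: measurable_funeM; apply/measurable_EFinP; exact: measurable_funM.
  - exact: (measurable_fun_fubini_tonelli_F (g \_ D) mgD gD0).
  by move=> x _; rewrite -EFinM -expr2 mulrC; exact: inner.
have J0 : (0 <= \int[(mu \x mu)%E]_(z in D) g z)%E by apply: integral_ge0 => z _; exact: g0.
have -> : Hs_inner Omega s f f = Cds (d :=
    d) s / 2 * fine (\int[(mu \x mu)%E]_(z in D) g z)%E by [].
move: main; rewrite -[X in (_ <= X)%E]fineK ?ge0_fin_numE// -EFinM lee_fin.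
set J := fine _; rewrite mulrA -mulrA => main.
rewrite [X in _ <= X](_ : _ = kap^-1 * J); last by field; rewrite !gt_eqF.
by rewrite ler_pdivlMl.
Qed.

End poincare.

(** * The part of a number outside the unit interval *)
Section excess.
Context {R : realType}.
Implicit Types x y : R.

Definition excess x : R := x - Num.min 1 (Num.max (-1) x).

Lemma excessP x : [\/ x < -1 /\ excess x = x + 1, -1 <= x <= 1 /\ excess x = 0 |
  1 < x /\ excess x = x - 1].
Proof.
rewrite /excess; have [x1|x1] := ltP x (-1).
  by apply: Or31; split => //; rewrite min_r; lra.
have [x2|x2] := leP x 1.
  by apply: Or32; rewrite ?x1 ?subrr.
by apply: Or33; split => //; rewrite ?x2.
Qed.

Lemma excess0 : excess 0 = 0.
Proof. by have [[]|[]|[]] := excessP 0; lra. Qed.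

Lemma excess_eq0 x : excess x = 0 -> `|x| <= 1.
Proof. by have [[? ->]|[/andP[? ?] _]|[? ->]] := excessP x; rewrite ler_norml; lra. Qed.

Lemma excess_le1 x : `|x| <= 1 -> excess x = 0.
Proof. by rewrite ler_norml => /andP[? ?]; have [[? ->]|[_ ->]|[? ->]] := excessP x; lra. Qed.

Lemma excess_nd : {homo excess : x y / x <= y}.
Proof.
move=> x y xy; have [[? ->]|[/andP[? ?] ->]|[? ->]] := excessP x;
  have [[? ->]|[/andP[? ?] ->]|[? ->]] := excessP y; lra.
Qed.

Lemma excess_lip x y : `|excess x - excess y| <= `|x - y|.
Proof.
have H a b : a <= b -> excess b - excess a <= b - a.
  move=> ab; have [[? ->]|[/andP[? ?] ->]|[? ->]] := excessP a;
    have [[? ->]|[/andP[? ?] ->]|[? ->]] := excessP b; lra.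
have [xy|/ltW xy] := leP x y.
  rewrite distrC [leRHS]distrC !ger0_norm ?subr_ge0//; first exact: H.
  exact: excess_nd.
by rewrite !ger0_norm ?subr_ge0//; [exact: H|exact: excess_nd].
Qed.

(** The square of [excess] is convex with derivative [2 excess]. In the proof,
    [x - excess x] is the projection to [-1, 1], and [excess x] has the sign in which
    that projection is extremal. *)
Lemma excess_convex x y :
  excess x * excess x - excess y * excess y <= 2 * (excess x * (x - y)).
Proof.
have cy : -1 <= y - excess y <= 1.
  by have [[? ->]|[/andP[? ?] ->]|[? ->]] := excessP y; apply/andP; split; lra.
have H : 0 <= excess x * ((x - excess x) - (y - excess y)).
  move: cy => /andP[c1 c2]; have [[? ->]|[/andP[? ?] ->]|[? ->]] := excessP x.
  - by apply: mulr_le0; lra.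
  - by rewrite mul0r.
  - by apply: mulr_ge0; lra.
have := sqr_ge0 (excess x - excess y); nra.
Qed.

Lemma excess_continuous : continuous excess.
Proof.
move=> x; apply: cvgB; first exact: cvg_id.
apply: (@continuous_min _ _ (cst 1) (fun x => Num.max (-1) x)); first exact: cst_continuous.
by apply: (@continuous_max _ _ (cst (-1)) id); [exact: cst_continuous|exact: cvg_id].
Qed.

Lemma measurable_excess : measurable_fun setT excess.
Proof. exact: continuous_measurable_fun excess_continuous. Qed.

(** The cubic reaction vanishes at 1 and -1 and [g] is [B]-Lipschitz, hence
    [|g x| <= B |excess x|] wherever [excess x] is nonzero. *)
Lemma reaction_excess (g : R -> R) (B rho : R) : (forall x, derivable g x 1) ->
  (forall x, `|derive1 g x| < B) -> 0 < rho ->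
  (forall x, -1 - rho <= x <= 1 + rho -> g x = x - x ^+ 3) ->
  forall x, `|g x * excess x| <= B * (excess x * excess x).
Proof.
move=> dg gB rho0 gE.
have g1 : g 1 = 0 by rewrite gE; [lra|apply/andP; split; lra].
have gN1 : g (-1) = 0 by rewrite gE; [lra|apply/andP; split; lra].
have lip a b : a < b -> `|g b - g a| <= B * (b - a).
  move=> ab.
  have H1 x : x \in `]a, b[ -> is_derive x (1 : R) g (derive1 g x).
    by move=> _; apply: DeriveDef; [exact: dg|rewrite derive1E].
  have H2 : {within `[a, b], continuous g}.
    apply: continuous_subspaceT => x.
    by apply: differentiable_continuous; apply/derivable1_diffP.
  have [c _ ->] := MVT ab H1 H2.
  rewrite normrM [X in _ * X]gtr0_norm ?subr_gt0// ler_wpM2r ?subr_ge0 ?ltW//.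
move=> x; rewrite normrM; have [[x1 xE]|[_ ->]|[x1 xE]] := excessP x.
- rewrite xE; have := lip _ _ x1; rewrite gN1 sub0r normrN => H.
  by rewrite (@ltr0_norm _ (x + 1)); nra.
- by rewrite normr0 !mulr0.
- rewrite xE; have := lip _ _ x1; rewrite g1 subr0 => H.
  by rewrite (@gtr0_norm _ (x - 1)); nra.
Qed.

End excess.

Section lower_integral.
Context d (T : measurableType d) (R : realType) (mu : {measure set T -> \bar R}).
Local Open Scope ereal_scope.

(** The integral of a nonnegative function is a supremum over simple functions below
    it, which makes sense without measurability of [f]. It cannot be smaller than the
    integral of a measurable function that agrees with [f] almost everywhere. *)
Lemma ge0_le_integral_lower (f f' : T -> \bar R) :
  (forall x, 0 <= f x) -> measurable_fun setT f' -> (forall x, 0 <= f' x) ->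
  {ae mu, forall x, f' x = f x} -> \int[mu]_x f' x <= \int[mu]_x f x.
Proof.
move=> f0 mf' f'0 [N [mN N0 sN]].
have -> : \int[mu]_x f' x = \int[mu]_x (f' \_ (~` N)) x.
  apply: ge0_ae_eq_integral => //.
  - by apply/(measurable_restrictT f' (measurableC mN)); exact: measurable_funTS.
  - by move=> x _; apply: erestrict_ge0.
  exists N; split => // x /= H; apply: contrapT => Nx; apply: H => _.
  by rewrite patchE mem_set.
have fN x : (f' \_ (~` N)) x <= f x.
  rewrite patchE; case: ifPn => // /set_mem Nx.
  by have -> : f' x = f x by apply: contrapT => /sN.
rewrite integral_mkcond [leRHS]integral_mkcond !patch_setT.
rewrite ge0_integralTE; last by move=> x; apply: erestrict_ge0.
rewrite ge0_integralTE//.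
apply: le_ereal_sup => _ /= [h hf <-]; exists h => // x.
exact: le_trans (hf x) (fN x).
Qed.

End lower_integral.

(** * The solution as a continuous path of square-integrable functions *)
Section trajectory.
Context {R : realType} {d : nat}.
Local Notation mu := (@lebesgue_rV R d).
Local Notation lam := (@lebesgue_measure R).
Local Notation L2 := (Lfun mu 2%:E).
Variables (Omega : set 'rV[R]_d) (s T : R) (v : 'rV[R]_d -> R) (u w : R -> 'rV[R]_d -> R).
Hypotheses (hd : (1 <= d)%N) (hs : 0 < s < 1) (T0 : 0 < T)
  (oO : open Omega) (bO : bounded_set Omega)
  (mv : measurable_fun setT (v \_ Omega))
  (uHs : forall t, 0 < t <= T -> is_tildeHs Omega s (u t))
  (uHsc : forall t0, 0 < t0 <= T ->
     Hs_norm Omega s (u t \- u t0) @[t --> within `]0, T] (nbhs t0)] --> (0 : R))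
  (u0 : L2dist Omega (u t) (u 0) @[t --> 0^'+] --> 0%E)
  (uv : {ae mu, forall x, Omega x -> u 0 x = v x}).

(** At time zero [v] replaces [u 0], which agrees with it almost everywhere on [Omega]
    but need not be measurable. *)
Definition traj (t : R) : 'rV[R]_d -> R := if 0 < t then u t \_ Omega else v \_ Omega.

Lemma u_is_L2 t : 0 < t <= T -> is_L2 Omega (u t).
Proof.
move=> tT; have [[uL _] _] := uHs tT.
have mO := open_measurable_rV oO.
have muO : measurable_fun setT (u t \_ Omega).
  by apply/(measurable_restrictT (u t) mO); apply: measurable_funTS; exact: (L2_measurable uL).
apply: (L2_le muO uL) => x; rewrite patchE; case: ifP => // _.
by rewrite normr0.
Qed.

Lemma traj_pos t : 0 < t -> traj t = u t \_ Omega.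
Proof. by rewrite /traj => ->. Qed.

(** The distance to [u 0] is a lower integral; it dominates the distance to [v]. *)
Let traj_right (e : R) : 0 < e -> exists2 dl : R, 0 < dl & forall t, 0 < t <= T -> t < dl ->
  ('N[mu]_2%:E[EFin \o (fun x => ((u t \_ Omega) x - (v \_ Omega) x)%R)] < e%:E)%E.
Proof.
move=> e0.
have [dl /= dl0 H] := cvge0_near_lt e0 u0.
exists dl => // t tT tdl; have /andP[t0 _] := tT.
have : (L2dist Omega (u t) (u 0) < e%:E)%E.
  by apply: H; rewrite /= ?sub0r ?normrN ?gtr0_norm.
apply: le_lt_trans; rewrite /L2dist /L2norm restrictB.
rewrite unlock; apply: gt0_ler_poweR.
- by rewrite invr_ge0.
- by rewrite in_itv/= leey andbT; apply: integral_ge0 => x _; rewrite lee_fin powR_ge0.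
- by rewrite in_itv/= leey andbT; apply: integral_ge0 => x _; rewrite lee_fin powR_ge0.
have mu_ := L2_measurable (u_is_L2 tT).
apply: ge0_le_integral_lower => //.
- by move=> x; rewrite lee_fin powR_ge0.
- rewrite (_ : (fun x => _) = (fun x => (`|(u t \_ Omega) x - (v \_ Omega) x| `^ 2)%:E));
    last first.
    by apply/funext => x; rewrite -poweR_EFin.
  apply/measurable_EFinP.
  apply: (measurableT_comp (measurable_powR _)); apply: measurableT_comp => //.
  exact: measurable_funB.
- by move=> x; exact: poweR_ge0.
- apply: ae_imply uv => x uvx /=.
  have -> : (v \_ Omega) x = (u 0 \_ Omega) x.
    by rewrite !patchE; case: ifPn => // /set_mem /uvx.
  by [].
Qed.

Let v_L2 : v \_ Omega \in L2.
Proof.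
have [dl dl0 H] := traj_right ltr01.
pose t := Num.min (dl / 2) T.
have t0 : 0 < t by rewrite lt_min divr_gt0.
have tT : 0 < t <= T by rewrite t0 ge_min lexx orbT.
have tdl : t < dl by rewrite gt_min; apply/orP; left; lra.
have uL := u_is_L2 tT.
have dL : (fun x => (u t \_ Omega) x - (v \_ Omega) x) \in L2.
  rewrite inE; apply/andP; split.
    by rewrite inE; apply: measurable_funB => //; exact: L2_measurable uL.
  by rewrite inE /= /finite_norm; apply: (lt_trans (H _ tT tdl)); exact: ltry.
have := L2B uL dL.
have -> : (fun x => (u t \_ Omega) x - ((u t \_ Omega) x - (v \_ Omega) x)) = v \_ Omega.
  by apply/funext => x; rewrite opprB addrC subrK.
by [].
Qed.

Lemma traj_L2 t : t <= T -> traj t \in L2.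
Proof.
rewrite /traj; have [t0 tT|_ _] := ltP 0 t; last exact: v_L2.
by apply: u_is_L2; rewrite t0.
Qed.

(** For positive times, continuity in the fractional norm and the fractional Poincare
    inequality; at time zero, the initial condition. *)
Lemma traj_cont t0 (e : R) : 0 <= t0 <= T -> 0 < e -> exists2 dl : R, 0 < dl &
  forall t, 0 <= t <= T -> `|t - t0| < dl -> L2n mu (fun x => traj t x - traj t0 x) <= e.
Proof.
move=> /andP[]; rewrite le_eqVlt => /predU1P[<- _|t00 t0T] e0.
  have [dl dl0 H] := traj_right e0.
  exists dl => // t /andP[]; rewrite le_eqVlt => /predU1P[<- _ _|t_gt0 tT tdl].
    have -> : (fun x => traj 0 x - traj 0 x) = (fun x => 0 * traj 0 x).
      by apply/funext => x; rewrite subrr mul0r.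
    rewrite L2nZ ?normr0 ?mul0r ?(ltW e0)//; apply: traj_L2; exact: ltW.
  have tT' : 0 < t <= T by rewrite t_gt0.
  rewrite traj_pos// /traj ltxx -lee_fin L2nE.
    apply/ltW/H => //.
    by move: tdl; rewrite subr0 gtr0_norm.
  by apply: L2B => //; exact: u_is_L2.
have t0T' : 0 < t0 <= T by rewrite t00.
have [C C0 HC] := fractional_poincare hd hs oO bO.
have C1 : 0 < Num.sqrt C + 1 by rewrite ltr_wpDl// sqrtr_ge0.
have eC : 0 < e / (Num.sqrt C + 1) by rewrite divr_gt0.
have /cvgrPdist_lt /(_ _ eC) /= [r /= r0 H] := uHsc t0T'.
exists (Num.min r t0); first by rewrite lt_min r0.
move=> t /andP[_ tT]; rewrite lt_min => /andP[tr tt0].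
have t_gt0 : 0 < t by move: tt0; rewrite ltr_norml => /andP[? _]; lra.
have tT' : 0 < t <= T by rewrite t_gt0.
have := H t; rewrite /= distrC => /(_ tr); rewrite in_itv/= tT' => /(_ isT).
rewrite sub0r normrN ger0_norm ?sqrtr_ge0// => Hs.
rewrite !traj_pos//.
have dae : {ae mu, forall x, ~ closure Omega x -> (u t \- u t0) x = 0}.
  have [_ st] := uHs tT'; have [_ st0] := uHs t0T'.
  apply: ae_imply2 (ess_supp_ae (u t)) (ess_supp_ae (u t0)) => x h1 h2 nx.
  by rewrite /= h1 ?h2 ?subrr//; [move=> /st0|move=> /st].
have [fL fle] := HC _ (is_HsB (uHs tT').1 (uHs t0T').1) dae.
move: fL fle; rewrite restrictB => fL fle.
rewrite -(@ler_pXn2r _ 2) ?nnegrE ?L2n_ge0 ?(ltW e0)// -L2ip_sqr//.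
apply: (le_trans fle).
have In0 : 0 <= Hs_inner Omega s (u t \- u t0) (u t \- u t0).
  apply: mulr_ge0; first by rewrite divr_ge0// ltW// Cds_gt0.
  by apply: Rintegral_ge0 => z _; exact: gagliardo_ge0.
rewrite -(sqr_sqrtr In0) -{1}(sqr_sqrtr C0) -exprMn lerXn2r ?nnegrE ?mulr_ge0 ?sqrtr_ge0
    ?(ltW e0)//.
apply: (@le_trans _ _ ((Num.sqrt C + 1) * (e / (Num.sqrt C + 1)))); last first.
  by rewrite mulrC divfK// gt_eqF.
apply: ler_pM; rewrite ?sqrtr_ge0 ?lerDl//; exact: ltW.
Qed.

End trajectory.

(** * The truncated power kernel *)
Section truncated_power.
Context {R : realType}.
Local Notation lam := (@lebesgue_measure R).
Variables (T al : R).
Hypotheses (T0 : 0 < T) (al0 : 0 < al < 1).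

(** Cutting the power at [T] keeps it decreasing and makes it integrable on the line,
    and does not change the Caputo derivative at times up to [T]. *)
Definition power_kernel : R -> R := (fun x => x `^ (- al)) \_ `]0, T].

Let z := 1 - al.
Let z0 : 0 < z. Proof. by rewrite subr_gt0; have /andP[] := al0. Qed.
Let zE : z - 1 = - al. Proof. by rewrite /z addrAC subrr add0r. Qed.

Lemma power_kernelE x : 0 < x -> x <= T -> power_kernel x = x `^ (- al).
Proof. by move=> x0 xT; rewrite /power_kernel patchE mem_setE in_itv/= x0 xT. Qed.

Lemma power_kernel_ge0 x : 0 <= power_kernel x.
Proof. by rewrite /power_kernel patchE; case: ifP => // _; exact: powR_ge0. Qed.

Lemma power_kernel_N x : x <= 0 -> power_kernel x = 0.
Proof. by move=> x0; rewrite /power_kernel patchE mem_setE in_itv/= ltNge x0. Qed.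

Lemma power_kernel_T x : T < x -> power_kernel x = 0.
Proof. by move=> xT; rewrite /power_kernel patchE mem_setE in_itv/= [x <= T]leNgt xT andbF. Qed.

Lemma powRN_ni x y : 0 < x -> x <= y -> y `^ (- al) <= x `^ (- al).
Proof.
move=> x0 xy; have y0 := lt_le_trans x0 xy; have /andP[a0 _] := al0.
rewrite !powRN lef_pV2 ?posrE ?powR_gt0//.
by apply: ge0_ler_powR; rewrite ?nnegrE ?(ltW a0) ?(ltW x0) ?(ltW y0).
Qed.

Lemma power_kernel_ni x y : 0 < x -> x <= y -> power_kernel y <= power_kernel x.
Proof.
move=> x0 xy; have [yT|Ty] := leP y T; last by rewrite power_kernel_T// power_kernel_ge0.
by rewrite (power_kernelE x0 (le_trans xy yT)) (power_kernelE (lt_le_trans x0 xy) yT) powRN_ni.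
Qed.

Lemma measurable_power_kernel : measurable_fun setT power_kernel.
Proof.
have mT : measurable (`]0, T]%classic : set (measurableTypeR R)) by [].
apply/(measurable_restrictT _ mT).
by apply: measurable_funTS; exact: measurable_powR.
Qed.

Lemma power_kernel_small h : 0 < h ->
    (\int[lam]_(x in `]0%R, h]) (power_kernel x)%:E <= (h `^ z / z)%:E)%E.
Proof.
move=> h0; apply: le_trans (integral_powR_near0 z0 h0); apply: ge0_le_integral => //.
- by move=> x _; rewrite lee_fin power_kernel_ge0.
- by apply/measurable_funTS/measurable_EFinP; exact: measurable_power_kernel.
- by apply/measurable_funTS/measurable_EFinP; exact: measurable_powR.
move=> x; rewrite /= in_itv/= => /andP[x0 xh]; rewrite lee_fin zE.
by have [xT|Tx] := leP x T; [rewrite power_kernelE|rewrite power_kernel_T// powR_ge0].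
Qed.

Lemma power_kernel_fin : (\int[lam]_x (power_kernel x)%:E < +oo)%E.
Proof.
apply: (@le_lt_trans _ _ (\int[lam]_(x in `]0%R, T]) (power_kernel x)%:E)%E); last first.
  by apply: (le_lt_trans (power_kernel_small T0)); exact: ltry.
rewrite le_eqVlt; apply/orP; left; apply/eqP.
rewrite [RHS]integral_mkcond; apply: eq_integral => x _.
rewrite patchE mem_setE in_itv/=; case: ifPn => //.
rewrite negb_and -leNgt -ltNge => /orP[x0|xT]; first by rewrite power_kernel_N.
by rewrite power_kernel_T.
Qed.

Lemma power_kernel_ksmall e : 0 < e -> exists2 h0, 0 < h0 &
    forall h, 0 < h <= h0 -> (\int[lam]_(x in `]0%R, h]) (power_kernel x)%:E <= e%:E)%E.
Proof.
move=> e0; have ez : 0 < e * z by rewrite mulr_gt0.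
exists ((e * z) `^ z^-1); first exact: powR_gt0.
move=> h /andP[h0 hh]; apply: (le_trans (power_kernel_small h0)); rewrite lee_fin ler_pdivrMr//.
rewrite [leRHS](_ : _ = ((e * z) `^ z^-1) `^ z); last first.
  by rewrite -powRrM mulVf ?gt_eqF// powRr1// ltW.
by apply: ge0_ler_powR; rewrite ?nnegrE ?powR_ge0 ?(ltW z0) ?(ltW h0).
Qed.

Lemma power_kernel_kbig M : exists2 dl, 0 < dl & M <= power_kernel dl.
Proof.
have /andP[a0 _] := al0.
pose m := Num.max M 1; have m0 : 0 < m by rewrite lt_max ltr01 orbT.
pose D := m `^ (- al^-1).
have D0 : 0 < D by exact: powR_gt0.
have dl0 : 0 < Num.min D T by rewrite lt_min D0.
exists (Num.min D T) => //.
rewrite power_kernelE ?ge_min ?lexx ?orbT//.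
apply: (@le_trans _ _ m); first by rewrite le_max lexx.
apply: (@le_trans _ _ (D `^ (- al))).
  by rewrite /D -powRrM mulrNN mulVf ?gt_eqF// powRr1// ltW.
by apply: powRN_ni => //; rewrite ge_min lexx.
Qed.

End truncated_power.

(** * Estimates for the energy of the excess *)
Section ae_integral.
Context {R : realType}.
Local Notation lam := (@lebesgue_measure R).

Lemma eq_ae_Rintegral (D : set (measurableTypeR R)) (f g : R -> R) : measurable D ->
  measurable_fun D f -> measurable_fun D g ->
  {ae lam, forall t, D t -> f t = g t} ->
  \int[lam]_(t in D) f t = \int[lam]_(t in D) g t.
Proof.
move=> mD mf mg fg; congr fine; apply: ae_eq_integral => //.
- exact/measurable_EFinP.
- exact/measurable_EFinP.
by apply: ae_imply fg => t fgt Dt; rewrite /= fgt.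
Qed.

Lemma eq_ae_integrable (D : set (measurableTypeR R)) (f g : R -> R) : measurable D ->
  measurable_fun D f -> lam.-integrable D (EFin \o g) ->
  {ae lam, forall t, D t -> f t = g t} -> lam.-integrable D (EFin \o f).
Proof.
move=> mD mf ig fg; apply/integrableP; split; first exact/measurable_EFinP.
have /integrableP[mg] := ig; apply: le_lt_trans.
rewrite le_eqVlt; apply/orP; left; apply/eqP; apply: ae_eq_integral => //.
- by apply: measurableT_comp => //; exact/measurable_EFinP.
- exact: measurableT_comp.
by apply: ae_imply fg => t fgt Dt; rewrite /= fgt.
Qed.

End ae_integral.

Section energy_estimate.
Context {R : realType} {d : nat}.
Local Notation mu := (@lebesgue_rV R d).
Local Notation lam := (@lebesgue_measure R).
Local Notation L2 := (Lfun mu 2%:E).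
Variables (Omega : set 'rV[R]_d) (T : R) (u w F : R -> 'rV[R]_d -> R) (Iw : 'rV[R]_d -> R).
Hypotheses (T0 : 0 < T)
  (FL : forall t, t <= T -> F t \in L2)
  (Fcont : forall t0 e : R, 0 <= t0 <= T -> 0 < e -> exists2 dl : R, 0 < dl &
     forall t, 0 <= t <= T -> `|t - t0| < dl -> L2n mu (fun x => F t x - F t0 x) <= e)
  (FE : forall t, 0 < t -> F t = u t \_ Omega)
  (F0 : {ae mu, forall x, `|F 0 x| <= 1})
  (wb : is_bochner_integral Omega `]0, T[ w Iw)
  (uw : is_weak_time_derivative Omega T u w).

Let mT : measurable (`]0, T[%classic : set (measurableTypeR R)).
Proof. by []. Qed.

Lemma L2innerZl (a : R) (f g : 'rV[R]_d -> R) : is_L2 Omega f -> is_L2 Omega g ->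
  L2inner Omega (fun x => a * f x) g = a * L2inner Omega f g.
Proof.
move=> fL gL; rewrite !L2innerE -L2ipZl//; congr L2ip; apply/funext => x.
by rewrite !patchE; case: ifP; rewrite ?mulr0.
Qed.

Let uL t : 0 < t <= T -> is_L2 Omega (u t).
Proof. by move=> /andP[t0 tT]; rewrite /is_L2 -FE//; exact: FL. Qed.

Let U_cont psi t0 : is_L2 Omega psi -> 0 < t0 < T ->
  {for t0, continuous (fun t => L2inner Omega (u t) psi)}.
Proof.
move=> pL /andP[t00 t0T]; apply/cvgrPdist_le => e e0.
have t0T' : 0 <= t0 <= T by rewrite !ltW.
have N1 : 0 < L2n mu (psi \_ Omega) + 1 by rewrite ltr_wpDl// L2n_ge0.
have [dl dl0 H] := Fcont t0T' (divr_gt0 e0 N1).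
apply/nbhs_ballP; exists (Num.min dl (Num.min t0 (T - t0))) => /=.
  by rewrite !lt_min dl0 t00 subr_gt0.
move=> t; rewrite /ball/= !lt_min => /and3P[tdl tt0 tT].
have [t1 t2] : 0 < t /\ t < T.
  by move: tt0 tT; rewrite !ltr_norml => /andP[? ?] /andP[? ?]; split; lra.
have tT' : 0 <= t <= T by rewrite !ltW.
have uLt : is_L2 Omega (u t) by apply: uL; rewrite t1 ltW.
have uLt0 : is_L2 Omega (u t0) by apply: uL; rewrite t00 ltW.
rewrite distrC !L2innerE -L2ipBl//.
apply: (le_trans (L2ip_CauchySchwarz (L2B uLt uLt0) pL)).
rewrite -!FE//; rewrite distrC in tdl; have := H _ tT' tdl; set a := L2n mu _ => aE.
apply: (@le_trans _ _ (e / (L2n mu (psi \_ Omega) + 1) * (L2n mu (psi \_ Omega) + 1)));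
    last first.
  by rewrite divfK// gt_eqF.
apply: ler_pM => //; rewrite ?L2n_ge0// lerDl//.
Qed.

(** The weak derivative in time, paired with [psi], is a scalar weak derivative of a
    continuous function. *)
Lemma weak_increment psi (W : R -> R) : is_L2 Omega psi ->
  lam.-integrable `]0, T[ (EFin \o W) ->
  {ae lam, forall t, `]0, T[%classic t -> L2inner Omega (w t) psi = W t} ->
  forall a b, 0 < a -> a < b -> b < T ->
  L2inner Omega (u b) psi - L2inner Omega (u a) psi = \int[lam]_(t in `]a, b[) W t.
Proof.
move=> pL iW wW a b a0 ab bT.
have [wL _ _] := wb.
have mW : measurable_fun (`]0, T[%classic : set (measurableTypeR R)) W by have
    /measurable_int/measurable_EFinP := iW.
apply: (@du_bois_reymond R T (fun t => L2inner Omega (u t) psi) W) => //.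
  by move=> t; exact: U_cont.
move=> phi phiC; have [I [b1 b2]] := uw phiC.
have [dphi cphi _] := phiC.
have [W1 [iW1 aeW1 W1E]] := bochner_scalar mT b1 pL.
have [W2 [iW2 aeW2 W2E]] := bochner_scalar mT b2 pL.
have mW1 : measurable_fun (`]0,
    T[%classic : set (measurableTypeR R)) W1 by have /measurable_int/measurable_EFinP := iW1.
have mW2 : measurable_fun (`]0,
    T[%classic : set (measurableTypeR R)) W2 by have /measurable_int/measurable_EFinP := iW2.
have -> : \int[lam]_(t in `]0, T[) (derive1 phi t * L2inner Omega (u t) psi) =
    L2inner Omega I psi.
  rewrite -W1E; apply: eq_ae_Rintegral => //.
    apply: open_continuous_measurable_fun; first exact: interval_open.
    move=> t; rewrite inE/= in_itv/= => tT.
    by apply: cvgM; [exact: cphi|exact: U_cont].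
  apply: ae_imply aeW1 => t Ht tT; rewrite -Ht// L2innerZl//.
  by apply: uL; move: tT; rewrite /= in_itv/= => /andP[-> /ltW].
have -> : \int[lam]_(t in `]0, T[) (phi t * W t) = L2inner Omega (\- I) psi.
  rewrite -W2E; apply: eq_ae_Rintegral => //.
    apply: measurable_funM => //; apply: measurable_funTS; apply: continuous_measurable_fun => t.
    by apply: differentiable_continuous; apply/derivable1_diffP.
  apply: ae_imply2 wW aeW2 => t Ht1 Ht2 tT; rewrite -Ht1// -Ht2// L2innerZl//.
  exact: wL.
have [_ IL _] := b1.
have -> : (\- I) = (fun x => (-1) * I x) by apply/funext => x; rewrite /= mulN1r.
by rewrite L2innerZl// mulN1r opprK.
Qed.

Definition excess_at (t : R) : 'rV[R]_d -> R := excess \o F t.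

Lemma excess_at_L2 t : t <= T -> excess_at t \in L2.
Proof.
move=> tT; apply: (L2_le _ (FL tT)).
  by apply: measurableT_comp => //; [exact: measurable_excess|exact: L2_measurable (FL tT)].
by move=> x; have := excess_lip (F t x) 0; rewrite excess0 !subr0.
Qed.

Lemma excess_at_lip t t' : t <= T -> t' <= T ->
  L2n mu (fun x => excess_at t x - excess_at t' x) <= L2n mu (fun x => F t x - F t' x).
Proof.
move=> tT tT'; apply: L2n_le.
- exact: L2_measurable (L2B (excess_at_L2 tT) (excess_at_L2 tT')).
- by apply: L2B; exact: FL.
- by move=> x; exact: excess_lip.
Qed.

Lemma excess_at_cont (t0 e : R) : 0 <= t0 <= T -> 0 < e -> exists2 dl : R, 0 < dl &
  forall t, 0 <= t <= T -> `|t - t0| < dl ->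
      L2n mu (fun x => excess_at t x - excess_at t0 x) <= e.
Proof.
move=> t0T e0; have [dl dl0 H] := Fcont t0T e0; exists dl => // t tT tdl.
have /andP[_ ?] := tT; have /andP[_ ?] := t0T.
by apply: le_trans (H _ tT tdl); exact: excess_at_lip.
Qed.

Lemma excess_at_restrict t : 0 < t -> excess_at t = (excess \o u t) \_ Omega.
Proof.
move=> t0; apply/funext => x; rewrite /excess_at /= FE// !patchE.
by case: ifP => // _; exact: excess0.
Qed.

(** Continuous induction in place of compactness of the time interval. *)
Lemma excess_at_bounded : exists2 M : R, 0 <= M & forall t, 0 <= t <= T ->
    L2n mu (excess_at t) <= M.
Proof.
pose Q (t : R) := exists2 M : R, 0 <= M & forall r, 0 <= r <= t -> L2n mu (excess_at r) <= M.
suff : Q T by [].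
apply: (@interval_induction R Q T (ltW T0)).
  exists (L2n mu (excess_at 0)); first exact: L2n_ge0.
  by move=> r; rewrite -eq_le => /eqP <-.
move=> t0 t0T; have [dl dl0 H] := excess_at_cont t0T ltr01.
have /andP[t00 t0T'] := t0T.
exists dl => // r t r0 rt tT rdl tdl [M M0 HM].
exists (M + L2n mu (excess_at t0) + 1); first by rewrite !addr_ge0 ?L2n_ge0.
move=> q /andP[q0 qt]; have [qr|rq] := leP q r.
  have : L2n mu (excess_at q) <= M by apply: HM; rewrite q0.
  by have := L2n_ge0 mu (excess_at t0); lra.
have qT : q <= T by exact: le_trans tT.
have qdl : `|q - t0| < dl.
  by move: rdl tdl; rewrite !ltr_norml => /andP[? ?] /andP[? ?]; apply/andP; split; lra.
have qq : 0 <= q <= T by rewrite q0.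
have := H _ qq qdl.
have := L2n_dist (excess_at_L2 qT) (excess_at_L2 t0T'); rewrite ler_norml => /andP[_ H1] H2.
lra.
Qed.

(** Cut off outside ]0, T[, in particular equal to zero at the initial time, where the
    excess vanishes. *)
Definition energy (t : R) : R := if 0 < t < T then L2ip mu (excess_at t) (excess_at t) else 0.

Lemma energyE t : 0 < t < T -> energy t = L2n mu (excess_at t) ^+ 2.
Proof. by move=> tT; rewrite /energy tT L2ip_sqr//; apply: excess_at_L2;
    have /andP[_ /ltW] := tT. Qed.

Lemma energy_ge0 t : 0 <= energy t.
Proof.
rewrite /energy; case: ifP => // _; apply: Rintegral_ge0 => x _.
by rewrite -expr2 sqr_ge0.
Qed.

Lemma energy_npos t : t <= 0 -> energy t = 0.
Proof. by move=> t0; rewrite /energy ltNge t0. Qed.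

Lemma measurable_energy : measurable_fun setT energy.
Proof.
have -> : energy = (fun t => L2n mu (excess_at t) ^+ 2) \_ `]0, T[.
  apply/funext => t; rewrite patchE mem_setE in_itv/=.
  by case: ifPn => tT; [exact: energyE|rewrite /energy (negbTE tT)].
apply/(measurable_restrictT _ mT).
apply: open_continuous_measurable_fun; first exact: interval_open.
move=> t; rewrite inE/= in_itv/= => /andP[t0 tT].
apply: cvgM.
all: apply/cvgrPdist_le => e e0.
all: have t0T' : 0 <= t <= T by rewrite !ltW.
all: have [dl dl0 H] := excess_at_cont t0T' e0.
all: apply/nbhs_ballP; exists (Num.min dl (Num.min t (T - t))) => /=;
    first by rewrite !lt_min dl0 t0 subr_gt0.
all: move=> r; rewrite /ball/= !lt_min distrC => /and3P[rdl rt rT].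
all: have [r1 r2] : 0 < r /\ r < T by move: rt rT;
    rewrite !ltr_norml => /andP[? ?] /andP[? ?]; split; lra.
all: have rr : 0 <= r <= T by rewrite !ltW.
all: rewrite distrC; apply: (le_trans (L2n_dist (excess_at_L2 (ltW r2)) (excess_at_L2 (ltW tT)))).
all: exact: H.
Qed.

Lemma energy_fin : (\int[lam]_(t in `]0%R, T[) (energy t)%:E < +oo)%E.
Proof.
have [M M0 HM] := excess_at_bounded.
apply: (@le_lt_trans _ _ (\int[lam]_(t in `]0%R, T[) (M ^+ 2)%:E)%E).
  apply: ge0_le_integral => //.
  - by move=> t _; rewrite lee_fin energy_ge0.
  - by apply/measurable_funTS/measurable_EFinP; exact: measurable_energy.
  - move=> t; rewrite /= in_itv/= => tT; rewrite lee_fin energyE// lerXn2r ?nnegrE ?L2n_ge0//.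
    by apply: HM; have /andP[? ?] := tT; rewrite !ltW.
rewrite integral_cst//= lebesgue_measure_itv/= lte_fin T0 oppr0 addr0 -EFinM.
exact: ltry.
Qed.

(** Integrated form of [excess_convex]. *)
Lemma energy_convex t r : 0 < t < T -> 0 < r < T ->
  energy t - energy r <= 2 * (L2ip mu (F t) (excess_at t) - L2ip mu (F r) (excess_at t)).
Proof.
move=> tT rT; have /andP[_ /ltW tT'] := tT; have /andP[_ /ltW rT'] := rT.
have eL := excess_at_L2 tT'; have eL' := excess_at_L2 rT'; have FLt := FL tT'; have FLr := FL rT'.
rewrite /energy tT rT -L2ipBl// -L2ipZl//; last exact: L2B.
rewrite lerBlDr.
have -> : L2ip mu (fun x => 2 * (F t x - F r x)) (excess_at t) +
    L2ip mu (excess_at r) (excess_at r) =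
   \int[mu]_x (2 * (F t x - F r x) * excess_at t x + excess_at r x * excess_at r x).
  by rewrite RintegralD//; apply: L2_int => //; apply: L2Z; exact: L2B.
apply: le_Rintegral => //; first exact: L2_int.
  have := integrableD measurableT (L2_int (L2Z 2 (L2B FLt FLr)) eL) (L2_int eL' eL').
  exact.
by move=> x _; have := excess_convex (F t x) (F r x); rewrite /excess_at/=; lra.
Qed.

Let W0_ex : exists W0 : R -> R -> R, forall t, 0 < t < T ->
  lam.-integrable `]0, T[ (EFin \o W0 t) /\
  {ae lam, forall r, `]0, T[%classic r -> L2inner Omega (w r) (excess \o u t) = W0 t r}.
Proof.
suff /choice[W0 HW0] : forall t, exists W1 : R -> R, 0 < t < T ->
  lam.-integrable `]0, T[ (EFin \o W1) /\
  {ae lam, forall r, `]0, T[%classic r -> L2inner Omega (w r) (excess \o u t) = W1 r}.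
  by exists W0.
move=> t; have [tT|] := boolP (0 < t < T); last by exists (cst 0).
have eL : is_L2 Omega (excess \o u t).
  by rewrite /is_L2 -excess_at_restrict; have /andP[? ?] := tT => //; apply: excess_at_L2;
      exact: ltW.
by have [W1 [? ? _]] := bochner_scalar mT wb eL; exists W1.
Qed.

(** For each [t], a function of [r] that is measurable and almost everywhere equal to
    [2 (w r, excess_at t)]. *)
Definition excess_rate : R -> R -> R := fun t r => 2 * (projT1 (cid W0_ex)) t r.

Lemma excess_rate_int t : 0 < t < T -> lam.-integrable `]0, T[ (EFin \o excess_rate t).
Proof.
move=> tT; have [iW _] := projT2 (cid W0_ex) t tT.
have -> : EFin \o excess_rate t = (fun r => 2%:E * (EFin \o projT1 (cid W0_ex) t) r)%E.
  by apply/funext => r.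
exact: integrableZl.
Qed.

Lemma excess_rateE t : 0 < t < T -> {ae lam, forall r, `]0, T[%classic r ->
  excess_rate t r = 2 * L2ip mu (w r \_ Omega) (excess_at t)}.
Proof.
move=> tT; have [_] := projT2 (cid W0_ex) t tT; apply: ae_imply => r H rT.
have /andP[t0 _] := tT.
by rewrite excess_at_restrict// -L2innerE H.
Qed.

Let excess_is_L2 t : 0 < t < T -> is_L2 Omega (excess \o u t).
Proof.
by move=> /andP[t0 tT]; rewrite /is_L2 -excess_at_restrict//; apply: excess_at_L2; exact: ltW.
Qed.

Let incr_pos t r : 0 < t < T -> 0 < r -> r < t ->
    energy t - energy r <= \int[lam]_(x in `]r, t[) excess_rate t x.
Proof.
move=> tT r0 rt; have /andP[t0 tT'] := tT.
have rT : 0 < r < T by rewrite r0 (lt_trans rt).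
apply: (le_trans (energy_convex tT rT)).
have [iW aeW] := projT2 (cid W0_ex) t tT.
have := weak_increment (excess_is_L2 tT) iW aeW r0 rt tT'.
rewrite !L2innerE -!FE// -excess_at_restrict// => ->.
rewrite RintegralZl//; apply: integrableS iW => //.
by move=> x /=; rewrite !in_itv/= => /andP[rx xt]; rewrite (lt_trans r0)//= (lt_trans xt).
Qed.

Let L2n_excess_at0 : L2n mu (excess_at 0) = 0.
Proof.
have eL : excess_at 0 \in L2 by apply: excess_at_L2; exact: ltW.
apply/eqP; rewrite -sqrf_eq0 -L2ip_sqr//; apply/eqP.
have -> : L2ip mu (excess_at 0) (excess_at 0) = \int[mu]_x (cst 0 : _ -> R) x.
  congr fine; apply: ae_eq_integral => //.
    by apply: (measurable_int _ (L2_int eL eL)).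
    by apply/measurable_EFinP; exact: measurable_cst.
  by apply: ae_imply F0 => x Fx _; rewrite /excess_at /= excess_le1// mul0r.
by rewrite Rintegral_cst// mul0r.
Qed.

(** For [0 < r], convexity and [weak_increment]; the case [r = 0] follows by letting the
    left end of the interval tend to 0, since the excess tends to 0 there. *)
Lemma energy_increment t r : 0 < t < T -> 0 <= r < t ->
  energy t - energy r <= \int[lam]_(x in `]r, t[) excess_rate t x.
Proof.
move=> tT /andP[]; rewrite le_eqVlt => /predU1P[<-|r0] rt; last exact: incr_pos.
have /andP[t0 tT'] := tT.
rewrite (energy_npos (lexx 0)) subr0; apply/ler_addgt0Pr => e e0.
(* Extending by zero gives integrability up to the end point 0. *)
pose Wx := excess_rate t \_ `]0, T[.
have iWx : lam.-integrable `[0, t] (EFin \o Wx).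
  have iW := excess_rate_int tT.
  have : lam.-integrable setT (EFin \o Wx).
    by rewrite /Wx -restrict_EFin; apply/(integrable_mkcond _ mT).
  exact: integrableS.
have e2 : 0 < e / 2 by rewrite divr_gt0.
have [dl1 /= dl10 H1] := parameterized_integral_near_left t0 e2 iWx.
(* Chosen so that eta^2 <= e / 2. *)
pose eta := Num.min 1 (e / 2).
have eta0 : 0 < eta by rewrite lt_min ltr01.
have z0 : 0 <= (0 : R) <= T by apply/andP; split; [exact: lexx|exact: ltW].
have [dl2 dl20 H2] := excess_at_cont z0 eta0.
pose q := Num.min (dl1 / 2) (Num.min (dl2 / 2) (t / 2)).
have q0 : 0 < q by rewrite !lt_min !divr_gt0.
have [q1 [q2 qt]] : q < dl1 /\ q < dl2 /\ q < t.
  have : q <= dl1 / 2 by rewrite /q ge_min lexx.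
  have : q <= dl2 / 2 by rewrite /q !ge_min lexx !orbT.
  have : q <= t / 2 by rewrite /q !ge_min lexx !orbT.
  lra.
have qT : 0 < q < T by rewrite q0 (lt_trans qt).
have Hq := incr_pos tT q0 qt.
have enq : energy q <= e / 2.
  have qT' : 0 <= q <= T by rewrite ltW//= ltW//; have /andP[] := qT.
  have := H2 q qT'; rewrite subr0 gtr0_norm// => /(_ q2) H3.
  have /andP[_ /ltW qT''] := qT.
  have := L2n_dist (excess_at_L2 qT'') (excess_at_L2 (ltW T0));
      rewrite L2n_excess_at0 subr0 ger0_norm ?L2n_ge0// => H4.
  have eE : L2n mu (excess_at q) <= eta by exact: le_trans H3.
  rewrite energyE// expr2; apply: (@le_trans _ _ (eta * eta)).
    by apply: ler_pM; rewrite ?L2n_ge0.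
  rewrite (@le_trans _ _ (1 * eta))//.
    by rewrite ler_wpM2r ?(ltW eta0)// ge_min lexx.
  by rewrite mul1r ge_min lexx orbT.
have iW0t : lam.-integrable `]0, t[ (EFin \o excess_rate t).
  apply: integrableS (excess_rate_int tT) => //.
  by move=> x /=; rewrite !in_itv/= => /andP[-> xt]; rewrite (lt_trans xt).
have split : \int[lam]_(x in `]0, t[) excess_rate t x - \int[lam]_(x in `]0,
    q]) excess_rate t x = \int[lam]_(x in `]q, t[) excess_rate t x.
  by apply: Rintegral_itvB => //; rewrite bnd_simp// ltW.
have small : `|\int[lam]_(x in `]0, q]) excess_rate t x| < e / 2.
  have -> : \int[lam]_(x in `]0, q]) excess_rate t x = parameterized_integral lam 0 q Wx.
    rewrite /parameterized_integral Rintegral_mkcond [RHS]Rintegral_mkcond.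
    apply: eq_Rintegral => x _; rewrite /Wx !patchE !mem_setE !in_itv/=.
    have [x0|x0] := ltP 0 x => /=; last by case: ifP.
    by rewrite (ltW x0)/=; case: ifPn => // xq; rewrite (le_lt_trans xq)//; have /andP[] := qT.
  by apply: H1 => //=; rewrite ?sub0r ?normrN ?gtr0_norm// ltW.
move: small; rewrite ltr_norml => /andP[s1 s2].
move: Hq; rewrite -split; lra.
Qed.

Let om_ex := bochner_majorant mT wb.

Lemma energy_majorant : exists om : R -> R, [/\ measurable_fun setT om,
  forall t, 0 <= om t, (\int[lam]_t (om t)%:E < +oo)%E &
  forall t, 0 < t < T -> L2n mu (w t \_ Omega) <= om t].
Proof.
have [om [mom om0 omfin omw]] := om_ex.
exists (om \_ `]0, T[); split.
- exact/(measurable_restrictT _ mT).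
- by move=> t; rewrite patchE; case: ifPn => // /set_mem; exact: om0.
- move: omfin; rewrite integral_mkcond; apply: le_lt_trans.
  rewrite le_eqVlt; apply/orP; left; apply/eqP; apply: eq_integral => t _.
  by rewrite restrict_EFin.
- move=> t tT; rewrite patchE mem_set; first by apply: omw; rewrite /= in_itv.
  by rewrite /= in_itv.
Qed.

Lemma excess_rate_bound (om : R -> R) (M : R) : (forall t, 0 < t < T ->
    L2n mu (w t \_ Omega) <= om t) ->
  (forall t, 0 <= t <= T -> L2n mu (excess_at t) <= M) ->
  forall t, 0 < t < T ->
  {ae lam, forall r, r \in `]0, t[ -> `|excess_rate t r| <= 2 * M * om r}.
Proof.
move=> omw HM t tT; have /andP[t0 tT'] := tT; have [wL _ _] := wb.
apply: ae_imply (excess_rateE tT) => r rr; rewrite in_itv/= => /andP[r0 rt].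
have rT : 0 < r < T by rewrite r0 (lt_trans rt).
rewrite rr; last by rewrite /= in_itv.
have wrL : is_L2 Omega (w r) by apply: wL; rewrite /= in_itv.
rewrite normrM ger0_norm// -mulrA ler_wpM2l//.
apply: (le_trans (L2ip_CauchySchwarz wrL (excess_at_L2 (ltW tT')))).
rewrite mulrC; apply: ler_pM; rewrite ?L2n_ge0//; first by apply: HM; rewrite !ltW.
exact: omw.
Qed.

(** Paired with the excess, the Caputo integral is the convolution of the truncated
    power with [excess_rate], to which [gronwall_kernel] applies. *)
Lemma energy_zero_caputo (al K : R) : 0 < al < 1 -> 0 <= K ->
  {ae lam, forall t, 0 < t < T -> exists2 I,
     is_bochner_integral Omega `]0, t[ (fun r x => (t - r) `^ (- al) * w r x) I &
     2 * L2inner Omega I (excess \o u t) <= K * energy t} ->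
  (\int[lam]_(t in `]0%R, T[) (energy t)%:E = 0)%E.
Proof.
move=> al01 K0 pde; have [wL _ _] := wb.
have [M M0 HM] := excess_at_bounded.
have [om [mom om0 omfin omw]] := energy_majorant.
apply: (@gronwall_kernel R T K (2 * M) (power_kernel T al) energy om excess_rate) => //.
- by rewrite mulr_ge0.
- exact: power_kernel_ge0.
- exact: power_kernel_ni.
- by move=> x; exact: power_kernel_N.
- by move=> x; exact: power_kernel_T.
- exact: measurable_power_kernel.
- exact: power_kernel_fin.
- exact: power_kernel_ksmall.
- exact: power_kernel_kbig.
- exact: measurable_energy.
- exact: energy_ge0.
- exact: energy_npos.
- exact: energy_fin.
- move=> t /andP[t0 tT]; apply: integrableS (excess_rate_int _) => //; last by rewrite t0.
  by move=> x /=; rewrite !in_itv/= => /andP[-> xt]; rewrite (lt_trans xt).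
- exact: excess_rate_bound.
- by move=> t r; exact: energy_increment.
suff H : forall t : R, 0 < t < T -> (exists2 I,
     is_bochner_integral Omega `]0, t[ (fun r x => (t - r) `^ (- al) * w r x) I &
     2 * L2inner Omega I (excess \o u t) <= K * energy t) ->
   lam.-integrable `]0, t[ (EFin \o (fun r : R => power_kernel T al (t - r) * excess_rate t r)) /\
   \int[lam]_(r in `]0, t[) (power_kernel T al (t - r) * excess_rate t r) <= K * energy t.
  by apply: ae_imply pde => t Ht tT; apply: H => //; exact: Ht.
move=> t tT [I Ib Ile]; have /andP[t0 tT'] := tT.
have mt : measurable (`]0, t[%classic : set (measurableTypeR R)) by [].
have [W3 [iW3 aeW3 W3E]] := bochner_scalar mt Ib (excess_is_L2 tT).
have sub0t : (`]0, t[%classic : set R) `<=` `]0, T[%classic.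
  by move=> x /=; rewrite !in_itv/= => /andP[-> xt]; rewrite (lt_trans xt).
have iW32 : lam.-integrable `]0, t[ (EFin \o (fun r => 2 * W3 r)).
  have -> : EFin \o (fun r => 2 * W3 r) = (fun r => 2%:E * (EFin \o W3) r)%E by apply/funext.
  exact: integrableZl.
have aeE : {ae lam, forall r, `]0, t[%classic r ->
    power_kernel T al (t - r) * excess_rate t r = 2 * W3 r}.
  apply: ae_imply2 aeW3 (excess_rateE tT) => r Hr Hr' rt.
  rewrite (Hr' (sub0t _ rt)) -Hr// L2innerZl//; last 2 first.
  - by apply: wL; exact: sub0t.
  - exact: excess_is_L2.
  move: rt; rewrite /= in_itv/= => /andP[r0 rt].
  rewrite power_kernelE ?subr_gt0//; last by rewrite lerBlDr ltW// ltr_wpDr// ltW.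
  by rewrite L2innerE -excess_at_restrict// mulrCA.
have mr : measurable_fun (`]0, t[%classic : set (measurableTypeR R)) (excess_rate t).
  have /measurable_int/measurable_EFinP := excess_rate_int tT.
  exact: measurable_funS.
have mk : measurable_fun (`]0, t[%classic : set (measurableTypeR R)) (fun r =>
    power_kernel T al (t - r) * excess_rate t r).
  apply: measurable_funM => //; apply: measurable_funTS.
  by apply: (measurableT_comp (measurable_power_kernel T al)); exact: measurable_funB.
have m3 : measurable_fun (`]0, t[%classic : set (measurableTypeR R)) (fun r => 2 * W3 r).
  by have /measurable_int/measurable_EFinP := iW32.
split; first exact: eq_ae_integrable iW32 aeE.
by rewrite (eq_ae_Rintegral mt mk m3 aeE) RintegralZl// W3E.
Qed.

(** Near a fixed time, [excess_at t] is close to [excess_at x], so that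
    [excess_rate t x] differs from [2 (w x, excess_at x)] by at most [e] times the
    majorant of [w]. *)
Lemma energy_zero_classical (K : R) : 0 <= K ->
  {ae lam, forall t, 0 < t < T -> 2 * L2inner Omega (w t) (excess \o u t) <= K * energy t} ->
  (\int[lam]_(t in `]0%R, T[) (energy t)%:E = 0)%E.
Proof.
move=> K0 pde; have [wL _ _] := wb.
have [om [mom om0 omfin omw]] := energy_majorant.
apply: (@gronwall_local R T K energy om) => //.
- exact: measurable_energy.
- exact: energy_ge0.
- exact: energy_npos.
- exact: energy_fin.
move=> e t0 e0 /andP[t00 t0T].
have t0T' : 0 <= t0 <= T by rewrite t00 ltW.
have e4 : 0 < e / 4 by rewrite divr_gt0.
have [dl dl0 H] := excess_at_cont t0T' e4.
exists dl => // r t r0 rt tT rdl tdl.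
have t_gt0 : 0 < t by exact: le_lt_trans rt.
have tT' : 0 < t < T by rewrite t_gt0.
have mrt : measurable (`]r, t[%classic : set (measurableTypeR R)) by [].
have subT : (`]r, t[%classic : set R) `<=` `]0, T[%classic.
  by move=> x /=; rewrite !in_itv/= => /andP[rx xt]; rewrite (le_lt_trans r0)//= (lt_trans xt).
have iW : lam.-integrable `]r, t[ (EFin \o excess_rate t) by apply: integrableS
    (excess_rate_int tT').
have inc : energy t - energy r <= \int[lam]_(x in `]r, t[) excess_rate t x.
  by apply: energy_increment => //; rewrite r0.
have RE : (\int[lam]_(x in `]r, t[) excess_rate t x)%:E = (\int[lam]_(x in `]r,
    t[) (excess_rate t x)%:E)%E.
  by rewrite fineK//; exact: (integrable_fin_num mrt iW).
rewrite addeC -leeBlDr// -EFinB.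
apply: (@le_trans _ _ (\int[lam]_(x in `]r, t[) excess_rate t x)%:E); first by rewrite lee_fin.
rewrite RE.
apply: (@le_trans _ _ (\int[lam]_(x in `]r, t[) ((EFin \o excess_rate t)^\+ x))%E).
  apply: le_integral => //; first exact: integrable_funepos.
  by move=> x _; rewrite funeposE le_max lexx.
apply: ae_ge0_le_integral => //.
- by apply: measurable_funepos; exact: (measurable_int _ iW).
- by move=> x _; rewrite lee_fin addr_ge0// mulr_ge0 ?energy_ge0// ltW.
- apply: measurable_funTS; apply/measurable_EFinP; apply: measurable_funD.
    by apply: measurable_funM => //; exact: measurable_energy.
  exact: measurable_funM.
suff aux : forall x : R, `]r, t[%classic x ->
    2 * L2inner Omega (w x) (excess \o u x) <= K * energy x ->
    excess_rate t x = 2 * L2ip mu (w x \_ Omega) (excess_at t) ->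
        excess_rate t x <= K * energy x + e * om x.
  apply: ae_imply2 pde (excess_rateE tT') => x px rx xrt.
  have xT := subT _ xrt; have xT' : 0 < x < T by move: xT; rewrite /= in_itv.
  rewrite funeposE ge_max; apply/andP; split.
    by rewrite lee_fin; apply: aux => //; [exact: px|exact: rx].
  by rewrite lee_fin addr_ge0// mulr_ge0 ?energy_ge0// ltW.
move=> x xrt px ->.
have xT := subT _ xrt; have wxL : is_L2 Omega (w x) by exact: wL.
move: xT xrt; rewrite /= !in_itv/= => xT /andP[rx xt]; have /andP[x0 xT'] := xT.
have xT2 : 0 <= x <= T by rewrite !ltW.
have tT2 : 0 <= t <= T by rewrite !ltW.
have eLx := excess_at_L2 (ltW xT'); have eLt := excess_at_L2 (ltW tT);
    have eL0 := excess_at_L2 (ltW t0T).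
have xdl : `|x - t0| < dl.
  by move: rdl tdl; rewrite !ltr_norml => /andP[? ?] /andP[? ?]; apply/andP; split; lra.
have D : L2n mu (fun y => excess_at t y - excess_at x y) <= e / 2.
  apply: (le_trans (L2n_sub_triangle eLt eL0 eLx)).
  have := H _ xT2 xdl; rewrite L2n_subC; have := H _ tT2 tdl; lra.
have CS := L2ip_CauchySchwarz (L2B eLt eLx) wxL.
have om_x := omw _ xT.
have split : L2ip mu (w x \_ Omega) (excess_at t) = L2ip mu (w x \_ Omega) (excess_at x) +
    L2ip mu (fun y => excess_at t y - excess_at x y) (w x \_ Omega).
  by rewrite L2ipBl// !(L2ipC _ (w x \_ Omega)) addrC subrK.
rewrite split; move: px; rewrite L2innerE -excess_at_restrict// => px.
have CS2 : `|L2ip mu (fun y => excess_at t y - excess_at x y) (w x \_ Omega)| <= e / 2 * om x.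
  by apply: (le_trans CS); apply: ler_pM; rewrite ?L2n_ge0.
have := le_trans (ler_norm _) CS2; lra.
Qed.

(** The energy vanishes at almost every time, hence at times arbitrarily close to any
    given one; continuity of the excess does the rest, the final time included. *)
Lemma excess_zero : (\int[lam]_(t in `]0%R, T[) (energy t)%:E = 0)%E ->
  forall t, 0 < t <= T -> L2n mu (excess_at t) = 0.
Proof.
move=> I0 t /andP[t0 tT].
have menr : measurable_fun (`]0, T[%classic : set (measurableTypeR R)) (EFin \o energy).
  by apply/measurable_funTS/measurable_EFinP; exact: measurable_energy.
have : ae_eq lam (`]0, T[%classic : set (measurableTypeR R)) (EFin \o energy) (cst 0%E).
  apply/ae_eq_integral_abs => //; rewrite -[RHS]I0; apply: eq_integral => r _ /=.
  by rewrite ger0_norm// energy_ge0.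
move=> [N [mN N0 subN]].
have tT2 : 0 <= t <= T by rewrite ltW.
apply/eqP; rewrite eq_le L2n_ge0 andbT; apply/ler_addgt0Pl => e e0; rewrite addr0.
have [dl dl0 H] := excess_at_cont tT2 e0.
pose c := Num.max 0 (t - dl).
have ct : c < t by rewrite gt_max t0 gtrBl.
have c0 : 0 <= c by rewrite le_max lexx.
have ctdl : t - dl <= c by rewrite le_max lexx orbT.
have [r [rc rN]] : exists r, `]c, t[%classic r /\ ~ N r.
  apply: contrapT => nr.
  have : (lam (`]c, t[%classic : set R) <= 0)%E.
    rewrite -N0; apply: le_measure; rewrite ?inE//.
    by move=> r rc; apply: contrapT => nN; apply: nr; exists r.
  by rewrite lebesgue_measure_itv/= lte_fin ct -EFinB lee_fin subr_le0 leNgt ct.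
move: rc; rewrite /= in_itv/= => /andP[cr rt].
have r0 : 0 < r by exact: le_lt_trans cr.
have rT : 0 < r < T by rewrite r0 (lt_le_trans rt).
have er : energy r = 0.
  apply: contrapT => ne; apply: rN; apply: subN => /= H'; apply: ne.
  by apply: EFin_inj; apply: H'; rewrite in_itv.
move: er; rewrite energyE// => /eqP; rewrite sqrf_eq0 => /eqP er.
have rT2 : 0 <= r <= T by have /andP[? ?] := rT; rewrite !ltW.
have rdl : `|r - t| < dl by rewrite ltr0_norm; lra.
have := H _ rT2 rdl; rewrite L2n_subC.
have /andP[_ /ltW rT'] := rT.
have := L2n_dist (excess_at_L2 tT) (excess_at_L2 rT'); rewrite er subr0 ger0_norm ?L2n_ge0//.
exact: le_trans.
Qed.

End energy_estimate.

(** * The maximum bound *)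
Section test_inequality.
Context {R : realType} {d : nat}.
Local Notation mu := (@lebesgue_rV R d).
Local Notation L2 := (Lfun mu 2%:E).

(** The library norm is zero by convention on a null space, so positivity of the total
    measure is needed. *)
Lemma Linfty_norm_le1 (Omega : set 'rV[R]_d) (f : 'rV[R]_d -> R) :
  (Linfty_norm Omega f <= 1)%E <-> {ae mu, forall x, `|(f \_ Omega) x| <= 1}.
Proof.
rewrite /Linfty_norm unlock.
have muT : (0 < mu [set: 'rV[R]_d])%E.
  apply: (@lt_le_trans _ _ (mu (unit_box 0 d))).
    by rewrite lebesgue_unit_box lte01.
  by apply: le_measure; rewrite ?inE//; exact: measurable_unit_box.
rewrite muT; split.
  by move=> /ess_supP; apply: ae_imply => x; rewrite /= lee_fin.
by move=> H; apply/ess_supP; apply: ae_imply H => x; rewrite /= lee_fin.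
Qed.

Lemma reaction_le (Omega : set 'rV[R]_d) (g : R -> R) (B : R) (ut : 'rV[R]_d -> R) :
  open Omega -> measurable_fun setT g -> measurable_fun setT ut ->
  (excess \o ut) \_ Omega \in L2 ->
  (forall x, `|g x * excess x| <= B * (excess x * excess x)) ->
  L2inner Omega (g \o ut) (excess \o ut) <=
    B * L2ip mu ((excess \o ut) \_ Omega) ((excess \o ut) \_ Omega).
Proof.
move=> oO mg mut eL gB; have mO := open_measurable_rV oO.
have mgu : measurable_fun setT ((g \o ut) \_ Omega).
  apply/(measurable_restrictT _ mO); apply: measurable_funTS; exact: measurableT_comp.
have bound x : `|((g \o ut) \_ Omega) x * ((excess \o ut) \_ Omega) x| <=
    B * (((excess \o ut) \_ Omega) x * ((excess \o ut) \_ Omega) x).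
  by rewrite !patchE; case: ifP => _; [exact: gB|rewrite !mulr0 normr0].
have iB : mu.-integrable setT (EFin \o (fun x =>
    B * (((excess \o ut) \_ Omega) x * ((excess \o ut) \_ Omega) x))).
  have -> : EFin \o (fun x => B * (((excess \o ut) \_ Omega) x * ((excess \o ut) \_ Omega) x)) =
    (fun x => B%:E * (EFin \o (fun x =>
        (((excess \o ut) \_ Omega) x * ((excess \o ut) \_ Omega) x)%R)) x)%E.
    by apply/funext.
  by apply: integrableZl => //; exact: L2_int.
rewrite L2innerE /L2ip -RintegralZl//; last exact: L2_int.
apply: le_Rintegral => //; last by move=> x _; exact: le_trans (ler_norm _) (bound x).
apply: (le_integrable measurableT _ _ iB).
  by apply/measurable_EFinP; apply: measurable_funM => //; exact: L2_measurable eL.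
move=> x _ /=; rewrite lee_fin (le_trans (bound x))//; exact: ler_norm.
Qed.

End test_inequality.

Unset Implicit Arguments.

Theorem theorem5p5 (R : realType) (d : nat) (hd : (1 <= d)%N)
  (Omega : set 'rV[R]_d) (hOmega : bounded_lipschitz_domain Omega)
  (s : R) (hs : 0 < s < 1) (alpha : R) (halpha : 0 < alpha <= 1)
  (eps : R) (heps : 0 < eps) (T : R) (hT : 0 < T)
  (g : R -> R)
  (hg1 : forall x, derivable g x 1) (hg2 : forall x, derivable (derive1 g) x 1)
  (hgC2 : continuous (derive1n 2 g : R -> R))
  (B : R) (hB : 0 < B)
  (hgB : forall x, [/\ `|g x| < B, `|derive1 g x| < B & `|derive1n 2 g x| < B])
  (rho : R) (hrho : 0 < rho)
  (hgf : forall x, -1 - rho <= x <= 1 + rho -> g x = x - x ^+ 3)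
  (v : 'rV[R]_d -> R) (hv : is_Linfty Omega v)
  (hv1 : (Linfty_norm Omega v <= 1)%E)
  (u : R -> 'rV[R]_d -> R) (hu : weak_solution Omega s alpha eps T g v u) :
  forall t, 0 < t <= T -> (Linfty_norm Omega (u t) <= 1)%E.
Proof.
have [_ oO _ bO _] := hOmega.
have [w [_ [Iw wb] uw] [[uH uHc] [u0 uv] pde]] := hu.
have mv : measurable_fun setT (v \_ Omega).
  by move: hv; rewrite /is_Linfty inE => /andP[]; rewrite inE.
pose F := traj Omega v u.
have FL t : t <= T -> F t \in Lfun (@lebesgue_rV R d) 2%:E.
  exact: (traj_L2 hT oO mv uH u0 uv).
have Fc := traj_cont hd hs hT oO bO mv uH uHc u0 uv.
have FE t : 0 < t -> F t = u t \_ Omega by exact: traj_pos.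
have F0 : {ae (@lebesgue_rV R d), forall x, `|F 0 x| <= 1}.
  by rewrite /F /traj ltxx; exact/Linfty_norm_le1.
have gE : forall x, `|g x * excess x| <= B * (excess x * excess x).
  by apply: (reaction_excess hg1 _ hrho hgf) => x; have [] := hgB x.
have mg : measurable_fun setT g.
  apply: continuous_measurable_fun => x.
  by apply: differentiable_continuous; apply/derivable1_diffP.
have eL t : 0 < t < T -> is_L2 Omega (excess \o u t).
  move=> /andP[t0 tT]; rewrite /is_L2 -(excess_at_restrict FE t0).
  exact: (excess_at_L2 FL (ltW tT)).
have test t c : 0 < t < T -> (forall phi, is_tildeHs Omega s phi ->
    L2inner Omega c phi + eps ^+ 2 * Hs_inner Omega s (u t) phi = L2inner Omega (g \o u t) phi) ->
    L2inner Omega c (excess \o u t) <= B * energy T F t.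
  move=> tT weak; have /andP[t0 tT'] := tT.
  have utH : is_tildeHs Omega s (u t) by apply: uH; rewrite t0 ltW.
  have := weak _ (is_tildeHs_comp measurable_excess excess0 excess_lip utH).
  have H0 : 0 <= eps ^+ 2 * Hs_inner Omega s (u t) (excess \o u t).
    rewrite mulr_ge0 ?sqr_ge0//; apply: Hs_inner_monotone_ge0; last exact: excess_nd.
    exact/ltW/Cds_gt0.
  have := reaction_le oO mg (L2_measurable utH.1.1) (eL _ tT) gE.
  rewrite -(excess_at_restrict FE t0) /energy tT; lra.
have I0 : (\int[lebesgue_measure]_(t in `]0%R, T[) (energy T F t)%:E = 0)%E.
  have [al1|al1] := eqVneq alpha 1.
    apply: (energy_zero_classical hT FL Fc FE F0 wb uw (K := 2 * B)).
      by rewrite mulr_ge0// ltW.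
    apply: ae_imply pde => t pt tT; have [c cE weak] := pt tT.
    move: cE weak; rewrite /is_caputo_derivative al1 eqxx => -> weak.
    by have := test t _ tT weak; lra.
  have al01 : 0 < alpha < 1.
    by have /andP[a0 a1] := halpha; rewrite a0 lt_neqAle al1.
  have G0 : 0 < Gamma (1 - alpha) by apply: Gamma_gt0; rewrite subr_gt0; have /andP[] := al01.
  apply: (energy_zero_caputo hT FL Fc FE F0 wb uw (al := alpha) (K :=
      2 * (Gamma (1 - alpha) * B))) => //.
    by rewrite !mulr_ge0// ltW.
  apply: ae_imply pde => t pt tT; have [c cE weak] := pt tT.
  move: cE; rewrite /is_caputo_derivative (negbTE al1) => -[I Ib cE]; exists I => //.
  have [_ IL _] := Ib.
  have := test t _ tT weak; rewrite cE L2innerZl//; last exact: eL.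
  rewrite ler_pdivrMl// => H.
  by rewrite -mulrA ler_wpM2l// -mulrA.
move=> t tT; have /andP[t0 tT'] := tT.
have E0 := excess_zero FL Fc I0 tT.
apply/Linfty_norm_le1.
have eLt := excess_at_L2 FL tT'.
have := L2nE eLt; rewrite E0 => /esym N0.
have mE : measurable_fun setT (EFin \o excess_at F t).
  by apply/measurable_EFinP; exact: L2_measurable eLt.
have := Lnorm_eq0_eq0 mE (lte0n 2) N0.
apply: ae_imply => x Hx; rewrite -(FE _ t0); apply: excess_eq0.
by apply: EFin_inj; exact: Hx.
Qed.
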